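(* Let $n\in\mathbb N$, $\alpha\in(0,\min\{1,n/2\})$ and let $\varphi:\mathbb R^n\to\mathbb R^n$ be $\eta$-quasisymmetric, with the additional assumption that $J_\varphi,J_{\varphi^{-1}}\in A_\infty(\mathbb R)$ when $n=1$. Then the composition operator $\mathcal C_\varphi(f):=f\circ\varphi^{-1}$ is bounded on $\mathcal Q_\alpha(\mathbb R^n)$ if and only if $\|\varphi\|_{\mathscr G_{1-\frac{2\alpha}{n}}}<\infty$. Moreover, there is a constant $C\ge 1$, depending only on $n,\alpha,\eta,[J_\varphi]_{A_\infty(\mathbb R^n)}$ and $[J_{\varphi^{-1}}]_{A_\infty(\mathbb R^n)}$, such that $$C^{-1}\,\|\varphi\|_{\mathscr G_{1-\frac{2\alpha}{n}}}\le \|\mathcal C_\varphi\|_{\mathcal Q_\alpha(\mathbb R^n)\to\mathcal Q_\alpha(\mathbb R^n)}^2\le C\,\|\varphi\|_{\mathscr G_{1-\frac{2\alpha}{n}}}.$$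
   Context: **Cubes.** All cubes in $\mathbb R^n$ have sides parallel to the coordinate axes (open, closed or half-open); $\ell(Q)$ is the side length, $|E|$ is Lebesgue measure. For a cube $Q$, $\mathcal D_0(Q)=\{Q\}$, and for $k\in\mathbb N$, $\mathcal D_k(Q)$ is the family of the $2^{kn}$ subcubes of side length $2^{-k}\ell(Q)$ obtained by $k$ successive bisections of each side of $Q$; $\mathcal D(Q)=\bigcup_{k\ge0}\mathcal D_k(Q)$. **The space $\mathcal Q_\alpha(\mathbb R^n)$.** It consists of all $f\in L^2_{\rm loc}(\mathbb R^n)$ with $$\|f\|_{\mathcal Q_\alpha(\mathbb R^n)}:=\sup_{\text{cubes }Q\subset\mathbb R^n}\left(|Q|^{\frac{2\alpha}{n}-1}\int_Q\int_Q\frac{|f(x)-f(y)|^2}{|x-y|^{n+2\alpha}}\,dx\,dy\right)^{1/2}<\infty .$$ $\|\mathcal C_\varphi\|_{\mathcal Q_\alpha\to\mathcal Q_\alpha}\in[0,\infty]$ is the least $M$ with $\|f\circ\varphi^{-1}\|_{\mathcal Q_\alpha}\le M\|f\|_{\mathcal Q_\alpha}$ for all $f\in\mathcal Q_\alpha(\mathbb R^n)$; $\mathcal C_\varphi$ is bounded iff it is finite. **Quasisymmetric maps.** A homeomorphism $\varphi:\mathbb R^n\to\mathbb R^n$ is $\eta$-quasisymmetric if $\eta:[0,\infty)\to[0,\infty)$ is an increasing homeomorphism with $\eta(0)=0$ and $\frac{|\varphi(x)-\varphi(y)|}{|\varphi(x)-\varphi(z)|}\le\eta\left(\frac{|x-y|}{|x-z|}\right)$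 for all distinct $x,y,z\in\mathbb R^n$. **Weights and Jacobians.** $A_\infty(\mathbb R^n)$ is the Muckenhoupt class of weights $w$ (nonnegative, locally integrable) with $[w]_{A_\infty(\mathbb R^n)}:=\sup_Q\left(\frac1{|Q|}\int_Qw\right)\exp\left(-\frac1{|Q|}\int_Q\log w\right)<\infty$, the supremum being over all cubes. $J_\varphi,J_{\varphi^{-1}}$ are the Jacobians of $\varphi,\varphi^{-1}$; an assumption $J_\varphi\in A_\infty$ is understood to include $|\varphi(E)|=\int_EJ_\varphi\,dx$ for all measurable $E$ (similarly for $\varphi^{-1}$). For $n\ge2$ quasisymmetry implies (Gehring) that $J_\varphi,J_{\varphi^{-1}}\in A_\infty(\mathbb R^n)$. **Capacity gauge.** For $\beta\in\mathbb R$, a homeomorphism $\varphi:\mathbb R^n\to\mathbb R^n$ and a cube $Q$, let $\mathscr T_\beta(Q)$ be the set of families $\{\lambda_I\}_{I\in\mathcal D(Q)}\subset[0,\infty)$ with $$\sum_{I\in\mathcal D(Q),\,I\supset J}\lambda_I\left(\frac{|I|}{|J|}\cdot\frac{|\varphi^{-1}(J)|}{|\varphi^{-1}(I)|}\right)^\beta\ge1\quad\text{for all }J\in\mathcal D(Q),$$ $$\|\varphi\|_{\mathscr G_\beta(Q)}:=\inf_{\{\lambda_I\}\in\mathscr T_\beta(Q)}\sum_{I\in\mathcal D(Q)}\lambda_I\left(\frac{|I|}{|Q|}\right)^\beta,\qquad \|\varphi\|_{\mathscr G_\beta}:=\sup_{\text{cubes }Q\subset\mathbb R^n}\|\varphi\|_{\mathscr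 G_\beta(Q)}\in[0,\infty].$$ *)

(* Defs.v *)
From HB Require Import structures.
From mathcomp Require Import all_boot all_order all_algebra.
From mathcomp Require Import all_classical all_reals all_analysis.

Set Implicit Arguments.
Unset Strict Implicit.
Unset Printing Implicit Defensive.

Import Order.TTheory GRing.Theory Num.Theory.
Import numFieldNormedType.Exports.

Local Open Scope classical_set_scope.
Local Open Scope ring_scope.

(* Lebesgue measure on 'rV[R]_n: the outer measure obtained from countable
   coverings by boxes, restricted to its Caratheodory-measurable sets, i.e. to
   the (complete) sigma-algebra of Lebesgue measurable sets. *)
Section lebesgue_measure_rV.
Context {R : realType} {n : nat}.
Local Open Scope ereal_scope.

(* [None] stands for the empty box, which is only needed for n = 0: in that
   case every [Some (a, b)] is the whole space. *)
Definition box (ab : option ('rV[R]_n * 'rV[R]_n)) : set 'rV[R]_n :=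
  if ab is Some (a, b) then
    [set x | forall i, (a ord0 i <= x ord0 i <= b ord0 i)%R]
  else set0.

Definition box_volume (ab : option ('rV[R]_n * 'rV[R]_n)) : \bar R :=
  if ab is Some (a, b) then
    (\prod_(i < n) Num.max 0 (b ord0 i - a ord0 i))%R%:E
  else 0.

Definition lebesgue_outer_rV (A : set 'rV[R]_n) : \bar R :=
  ereal_inf [set \sum_(k <oo) box_volume (B k) |
    B in [set B : nat -> _ | A `<=` \bigcup_k box (B k)]].

Lemma box_volume_ge0 ab : 0 <= box_volume ab.
Proof.
case: ab => [[a b]|//] /=; rewrite lee_fin prodr_ge0// => i _.
by rewrite le_max lexx.
Qed.

Lemma lebesgue_outer_rV_ge0 A : 0 <= lebesgue_outer_rV A.
Proof.
apply: le_ereal_inf_tmp => _ [B _ <-].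
by apply: nneseries_ge0 => *; exact: box_volume_ge0.
Qed.

Lemma lebesgue_outer_rV0 : lebesgue_outer_rV set0 = 0.
Proof.
apply/eqP; rewrite eq_le lebesgue_outer_rV_ge0 andbT.
apply: ereal_inf_lbound; exists (fun=> None); first exact: sub0set.
by rewrite eseries0.
Qed.

Lemma le_lebesgue_outer_rV :
  {homo lebesgue_outer_rV : A B / A `<=` B >-> A <= B}.
Proof.
move=> A B AB; apply/ereal_inf_le_tmp => _ [F BF <-].
by exists F => //; exact: subset_trans AB BF.
Qed.

Lemma lebesgue_outer_rV_sigma_subadditive :
  sigma_subadditive lebesgue_outer_rV.
Proof.
move=> A; have [[i ioo]|] := pselect (exists i, lebesgue_outer_rV (A i) = +oo).
  rewrite (eseries_pinfty _ _ ioo) ?leey// => k _.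
  by rewrite -ltNye (lt_le_trans _ (lebesgue_outer_rV_ge0 _)).
rewrite -forallNE => Aoo.
apply/lee_addgt0Pr => _/posnumP[e].
rewrite (le_trans _ (epsilon_trick _ _ _))//; last first.
  by move=> k; exact: lebesgue_outer_rV_ge0.
pose P k (B : nat -> option ('rV[R]_n * 'rV[R]_n)) :=
  A k `<=` \bigcup_j box (B j) /\
  \sum_(j <oo) box_volume (B j) <=
    lebesgue_outer_rV (A k) + (e%:num / (2 ^ k.+1)%:R)%:E.
have [G PG] : {G : nat -> nat -> _ & forall k, P k (G k)}.
  apply: (@choice _ _ P) => k; rewrite /P /lebesgue_outer_rV.
  set S := (X in ereal_inf X); move infS : (ereal_inf S) => iS.
  case: iS infS => [r Sr|Soo|Soo].
  - have en1 : (0 < e%:num / (2 ^ k.+1)%:R)%R by [].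
    have /(lb_ereal_inf_adherent en1) : ereal_inf S \is a fin_num by rewrite Sr.
    by move=> [x [B AB muBx] xS]; exists B; split => //; rewrite muBx -Sr ltW.
  - by have := Aoo k; rewrite /lebesgue_outer_rV Soo.
  - by have := lebesgue_outer_rV_ge0 (A k); rewrite /lebesgue_outer_rV Soo.
have G_ge0 x : 0 <= (box_volume \o uncurry G) x by exact: box_volume_ge0.
apply: (@le_trans _ _ (\esum_(i in setT) (box_volume \o uncurry G) i)).
  apply: ereal_inf_lbound => /=.
  have /card_esym/ppcard_eqP[f] := card_nat2.
  exists (uncurry G \o f).
    move=> t [i _ /(PG i).1[j _ Gijt]]; exists (f^-1%FUN (i, j)) => //=.
    by rewrite invK ?inE.
  rewrite -(esum_pred_image (box_volume \o uncurry G) _ xpredT);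
    rewrite ?[fun=> _]set_true//.
  by rewrite image_eq.
rewrite (_ : esum _ _ = \sum_(i <oo) \sum_(j <oo) box_volume (G i j)); last first.
  pose J : nat -> set (nat * nat) := fun i => [set (i, j) | j in setT].
  rewrite (_ : setT = \bigcup_k J k); last first.
    by rewrite predeqE => -[a b]; split => // _; exists a => //; exists b.
  rewrite esum_bigcupT /=; last 2 first.
    - apply/trivIsetP => i j _ _ ij.
      rewrite predeqE => -[k m] /=; split => //= -[] [_] _ [<-{k} _].
      by move=> [m' _] [] /esym/eqP; rewrite (negbTE ij).
    - by move=> /= [k m]; exact: box_volume_ge0.
  rewrite -(image_id [set: nat]) -fun_true esum_pred_image//; last first.
    by move=> k _; apply: esum_ge0 => x _; exact: G_ge0.
  apply: eq_eseriesr => /= j _.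
  rewrite -(esum_pred_image (box_volume \o uncurry G) (pair j) predT)//=;
    last 2 first.
    - by move=> x *; exact: box_volume_ge0.
    - by move=> ? ? _ _; exact: (@can_inj _ _ _ snd).
  by congr esum; rewrite predeqE => -[a b]; split; move=> [i _ <-]; exists i.
apply: lee_lim.
- apply: is_cvg_nneseries => k *.
  by apply: nneseries_ge0 => m *; exact: (G_ge0 (k, m)).
- apply: is_cvg_nneseries => k *.
  by apply: adde_ge0 => //; exact: lebesgue_outer_rV_ge0.
- by near=> k; apply: lee_sum => i _; exact: (PG i).2.
Unshelve. all: by end_near. Qed.

HB.instance Definition _ := isOuterMeasure.Build R 'rV[R]_n lebesgue_outer_rV
  lebesgue_outer_rV0 lebesgue_outer_rV_ge0 le_lebesgue_outer_rV
  lebesgue_outer_rV_sigma_subadditive.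

Definition lebesgue_rV : set (caratheodory_type lebesgue_outer_rV) -> \bar R :=
  lebesgue_outer_rV.

Let lebesgue_rV0 : lebesgue_rV set0 = 0.
Proof. exact: caratheodory_measure0. Qed.

Let lebesgue_rV_ge0 A : 0 <= lebesgue_rV A.
Proof. exact: caratheodory_measure_ge0. Qed.

Let lebesgue_rV_sigma_additive : semi_sigma_additive lebesgue_rV.
Proof. exact: caratheodory_measure_sigma_additive. Qed.

HB.instance Definition _ := isMeasure.Build _ _ _ lebesgue_rV
  lebesgue_rV0 lebesgue_rV_ge0 lebesgue_rV_sigma_additive.

End lebesgue_measure_rV.

Section definitions.
Context {R : realType} {n : nat}.
Local Notation E := 'rV[R]_n.
Local Notation mu := (@lebesgue_rV R n).

Definition lebesgue_measurable (A : set E) : Prop :=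
  (@lebesgue_outer_rV R n).-cara.-measurable A.

Definition lebesgue_measurable_fun (f : E -> R) : Prop :=
  measurable_fun [set: caratheodory_type (@lebesgue_outer_rV R n)] f.

Definition volume (A : set E) : R := fine (mu A).

(* The norm of the normed module 'rV[R]_n is the sup norm. *)
Definition enorm (x : E) : R := Num.sqrt (\sum_(i < n) x ord0 i ^+ 2).

(* The two booleans give all of the closed, open and half-open cubes. *)
Record cube := Cube {
  corner : E;
  side : R;
  side_gt0 : 0 < side;
  left_closed : bool;
  right_closed : bool }.

Definition cube_set (Q : cube) : set E :=
  [set x | forall i, x ord0 i \in
    Interval (BSide (left_closed Q) (corner Q ord0 i))
             (BSide (~~ right_closed Q) (corner Q ord0 i + side Q))].

Lemma subcube_side_gt0 (Q : cube) (k : nat) : 0 < side Q / 2 ^+ k.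
Proof. by rewrite divr_gt0 ?exprn_gt0// side_gt0. Qed.

Definition subcube (Q : cube) (k : nat) (j : 'I_n -> 'I_(2 ^ k)) : cube :=
  {| corner := corner Q + (side Q / 2 ^+ k) *: \row_i (j i)%:R;
     side := side Q / 2 ^+ k;
     side_gt0 := subcube_side_gt0 Q k;
     left_closed := left_closed Q;
     right_closed := right_closed Q |}.

Definition dyadic_level (k : nat) (Q : cube) : set (set E) :=
  [set cube_set (subcube Q j) | j in [set: 'I_n -> 'I_(2 ^ k)]].

Definition dyadic (Q : cube) : set (set E) := \bigcup_k dyadic_level k Q.

Definition L2loc (f : E -> R) : Prop :=
  lebesgue_measurable_fun f /\
  forall K : set E, compact K -> (\int[mu]_(x in K) (`|f x| ^+ 2)%:E < +oo)%E.

Definition Qnorm (alpha : R) (f : E -> R) : \bar R :=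
  ereal_sup [set
    ((volume (cube_set Q) `^ (2 * alpha / n%:R - 1))%:E *
      \int[mu]_(y in cube_set Q) \int[mu]_(x in cube_set Q)
        (`|f x - f y| ^+ 2 / enorm (x - y) `^ (n%:R + 2 * alpha))%:E)
    `^ 2^-1 | Q in [set: cube]]%E.

Definition Qspace (alpha : R) (f : E -> R) : Prop :=
  L2loc f /\ (Qnorm alpha f < +oo)%E.

(* Norm on Qspace of f |-> f \o psi, where psi is the inverse of the map that
   induces the composition operator; +oo if there is no finite bound. *)
Definition comp_norm (alpha : R) (psi : E -> E) : \bar R :=
  ereal_inf [set M%:E | M in [set M : R | 0 <= M /\
    forall f, Qspace alpha f ->
      (Qnorm alpha (f \o psi) <= M%:E * Qnorm alpha f)%E]].

Definition comp_bounded (alpha : R) (psi : E -> E) : Prop :=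
  (comp_norm alpha psi < +oo)%E.

Definition homeomorphism (phi psi : E -> E) : Prop :=
  [/\ cancel phi psi, cancel psi phi, continuous phi & continuous psi].

Definition increasing_homeo (eta : R -> R) : Prop :=
  [/\ eta 0 = 0,
      {in `[0, +oo[ &, {homo eta : s t / s < t}},
      set_bij `[0, +oo[ `[0, +oo[ eta,
      {within `[0, +oo[, continuous eta} &
      exists2 theta : R -> R, {in `[0, +oo[, cancel eta theta} &
        {within `[0, +oo[, continuous theta}].

Definition quasisymmetric (eta : R -> R) (phi : E -> E) : Prop :=
  increasing_homeo eta /\
  forall x y z : E, x != y -> x != z -> y != z ->
    enorm (phi x - phi y) / enorm (phi x - phi z) <=
    eta (enorm (x - y) / enorm (x - z)).

(* Only meaningful where phi is differentiable; quasisymmetric maps are so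
   almost everywhere. *)
Definition Jac (phi : E -> E) (x : E) : R := `|\det (jacobian phi x)|.

Definition locally_integrable_rV (w : E -> R) : Prop :=
  lebesgue_measurable_fun w /\
  forall K : set E, compact K -> (\int[mu]_(x in K) `|w x|%:E < +oo)%E.

(* [lne] is used because [ln 0 = 0] for the real-valued logarithm. *)
Definition Ainfty_const (w : E -> R) : \bar R :=
  ereal_sup [set
    ((volume (cube_set Q))^-1%:E * \int[mu]_(x in cube_set Q) (w x)%:E) *
    expeR (- ((volume (cube_set Q))^-1%:E *
              \int[mu]_(x in cube_set Q) lne (w x)%:E))
    | Q in [set: cube]]%E.

Definition Ainfty (w : E -> R) : Prop :=
  [/\ forall x, 0 <= w x, locally_integrable_rV w &
      (Ainfty_const w < +oo)%E].

Definition Ainfty_jacobian (phi : E -> E) : Prop :=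
  Ainfty (Jac phi) /\
  forall A : set E, lebesgue_measurable A ->
    mu (phi @` A) = (\int[mu]_(x in A) (Jac phi x)%:E)%E.

(* Families are functions on all sets, of which only the values on [dyadic Q]
   matter; phi^-1 of a cube is the preimage. *)
Definition test_families (beta : R) (phi : E -> E) (Q : cube) :
    set (set E -> R) :=
  [set lam | (forall I, dyadic Q I -> 0 <= lam I) /\
    forall J, dyadic Q J ->
      (1 <= \esum_(I in [set I | dyadic Q I /\ J `<=` I])
        (lam I * ((volume I / volume J) *
          (volume (phi @^-1` J) / volume (phi @^-1` I))) `^ beta)%:E)%E].

Definition local_gauge (beta : R) (phi : E -> E) (Q : cube) : \bar R :=
  ereal_inf [set
    (\esum_(I in dyadic Q)
       (lam I * (volume I / volume (cube_set Q)) `^ beta)%:E)%E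
    | lam in test_families beta phi Q].

Definition gauge (beta : R) (phi : E -> E) : \bar R :=
  ereal_sup [set local_gauge beta phi Q | Q in [set: cube]].

End definitions.

(* Main.v *)
(* Write v(I) for the volume of phi^-1(I) and beta = 1 - 2 alpha / n.
   Quasisymmetry enters through the v(I) of dyadic cubes I: they are comparable
   to the n-th powers of the diameters of phi^-1(I), and the ratio of v(I) to the
   value at the parent of I stays away from 0 and 1.

   If the gauge is finite, a test family bounds |J|^beta by a sum over the
   ancestors I of J, which reduces the energy of f o phi^-1 to the oscillations of
   f over the preimages of the cubes below each I; these cost at most a multiple
   of v(I)^beta times the squared norm of f.  The oscillations determine f o phi^-1
   almost everywhere because phi maps null sets to null sets, and the double
   integral over a cube is reduced to dyadic grids by the one-third trick.

   Conversely, by linear programming duality on trees, solved by a greedy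
   algorithm, the gauge is the largest sum of c(J) |J|^beta over weights c with
   the Carleson property that c(J) v(J)^beta summed over J in I is at most
   v(I)^beta.  For such weights the tent functions b(J) over phi^-1(J) give functions
   sum +-sqrt(c(J)) b(J) of bounded norm, and by the parallelogram identity the
   signs can be chosen so that the energies of the b(J) o phi^-1 add up. *)

Require Import Defs.
From HB Require Import structures.
From mathcomp Require Import all_boot all_order all_algebra.
From mathcomp Require Import all_classical all_reals all_analysis.
From mathcomp Require Import measurable_realfun ring lra zify.
Set Implicit Arguments.
Unset Strict Implicit.
Unset Printing Implicit Defensive.
Import Order.TTheory GRing.Theory Num.Theory.
Import numFieldNormedType.Exports.
Local Open Scope classical_set_scope.
Local Open Scope ring_scope.

(** * Lebesgue measure of cubes *)

(** The exponents fit because n + 2 alpha = n (2 - beta): for two points of phi^-1(J) the kernel is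
    at least a multiple of v(J)^-(2 - beta), and the test inequality trades |J|^beta v(J)^-2 for
    sums of v(J)^-(2 - beta) with coefficients attached to the ancestors of J. The factor v(J)^-2 is
    what turns the double integral of |f(u) - f(w)|^2 over phi^-1(J) into a squared mean
    oscillation.

    Two obstacles shape the proof. The function f o phi^-1 is not known to be measurable when its
    energy is estimated, so the squared differences are first dominated everywhere by measurable
    functions, which are infinite on an exceptional null set. And constants have to be uniform in
    phi: quasisymmetry is replaced by two functions [up] and [dn], computed from eta alone and
    transferred to the inverse map, and every constant is an explicit expression in them, n and
    alpha.

    That null sets are preserved rests, for n > 1, on an elementary length estimate along rows of
    cells. Duality yields test families on finite trees only; a limit along an ultrafilter gives the
    one on the full tree. *)

Section lebesgue_rV_theory.
Context {R : realType} {n : nat}.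
Local Notation E := 'rV[R]_n.
Local Notation L := (caratheodory_type (@lebesgue_outer_rV R n)).
Local Notation mu := (@lebesgue_rV R n).

(** A cut by a hyperplane changes only the side in direction [i]. Cutting every box of a covering in
    this way makes half-spaces Caratheodory measurable. *)
Lemma box_split_volume (a b : E) (i : 'I_n) (t : R) :
  (box_volume (Some (a, \row_j if j == i then Num.min (b ord0 j) t else b ord0 j)) +
   box_volume (Some (\row_j if j == i then Num.max (a ord0 j) t else a ord0 j, b))
   <= box_volume (Some (a, b)))%E.
Proof.
have H (F G : 'I_n -> R) : (forall j, j != i -> F j = G j) ->
    \prod_j F j = F i * \prod_(j | j != i) G j.
  by move=> FG; rewrite (bigD1 i)//=; congr (_ * _); apply: eq_bigr.
pose G j := Num.max 0 (b ord0 j - a ord0 j).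
rewrite /= -EFinD lee_fin (H _ G); last by move=> j /negbTE ji; rewrite mxE ji.
rewrite (H _ G); last by move=> j /negbTE ji; rewrite mxE ji.
rewrite [leRHS](H _ G)// !mxE eqxx.
rewrite -mulrDl ler_wpM2r//; first by apply: prodr_ge0 => j _; rewrite le_max lexx.
have [||] := ltgtP (b ord0 i) t; have [||] := ltgtP (a ord0 i) t;
  rewrite /Num.max; repeat case: ifPn; rewrite -?leNgt; lra.
Qed.

Lemma halfspace_measurable (i : 'I_n) (t : R) :
  (@lebesgue_outer_rV R n).-cara.-measurable [set x : E | x ord0 i < t].
Proof.
apply: le_caratheodory_measurable => X.
apply: le_ereal_inf_tmp => _ [B XB <-].
pose B1 k := if B k is Some (a, b) then
  Some (a, \row_j if j == i then Num.min (b ord0 j) t else b ord0 j) else None.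
pose B2 k := if B k is Some (a, b) then
  Some (\row_j if j == i then Num.max (a ord0 j) t else a ord0 j, b) else None.
apply: (@le_trans _ _ (\sum_(k <oo) box_volume (B1 k) + \sum_(k <oo) box_volume (B2 k))%E).
  apply: leeD; apply: ereal_inf_lbound => /=.
  - exists B1 => // x [/XB [k _ Bk] /= xt]; exists k => //; rewrite /B1.
    move: Bk; case: (B k) => [[a b]|//] /= ab j; rewrite mxE.
    by case: ifPn => [/eqP ->|_]; rewrite ?le_min// andbA ab ltW.
  - exists B2 => // x [/XB [k _ Bk] /= /negP]; rewrite -leNgt => xt; exists k => //; rewrite /B2.
    move: Bk; case: (B k) => [[a b]|//] /= ab j; rewrite mxE.
    case: ifPn => [/eqP ->|_]; rewrite ?ge_max//.
    by case/andP: (ab i) => -> ->; rewrite xt.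
rewrite -nneseriesD; [|by move=> k _ _; exact: box_volume_ge0..].
apply: lee_nneseries => [k _|k _]; first by rewrite adde_ge0// box_volume_ge0.
rewrite /B1 /B2; case: (B k) => [[a b]|]; first exact: box_split_volume.
by rewrite /= adde0.
Qed.

Lemma measurable_coord (i : 'I_n) :
  measurable_fun [set: L] (fun x : E => x ord0 i).
Proof.
apply: (measurability _ ((RGenInftyO.measurableE R))) => //.
by move=> _ [_ [x ->] <-]; rewrite setTI; apply: halfspace_measurable.
Qed.

(* Integrating the inequality of indicator functions one coordinate at a time
   turns a covering of a box by boxes into the inequality of the volumes. *)
Lemma box_volume_le_outer (ab : option (E * E)) :
  (box_volume ab <= @lebesgue_outer_rV R n (box ab))%E.
Proof.
apply: le_ereal_inf_tmp => _ [B abB <-].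
pose len (c : option (E * E)) (i : 'I_n) : R :=
  if c is Some (a, b) then Num.max 0 (b ord0 i - a ord0 i) else 0.
pose inb (c : option (E * E)) (i : 'I_n) : set R :=
  if c is Some (a, b) then [set` `[a ord0 i, b ord0 i]] else set0.
pose G m (x : E) (c : option (E * E)) : R :=
  if c is Some _ then
    \prod_(i < n) if (i < m)%N then len c i else \1_(inb c i) (x ord0 i) else 0.
have len_ge0 c i : 0 <= len c i.
  by rewrite /len; case: c => [[a b]|//]; rewrite le_max lexx.
have G_ge0 m x c : 0 <= G m x c.
  by rewrite /G; case: c => [c|//]; apply: prodr_ge0 => i _; case: ifP.
suff H m : (m <= n)%N -> forall x, ((G m x ab)%:E <= \sum_(k <oo) (G m x (B k))%:E)%E.
  have := H n (leqnn n) 0.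
  have Gn c : ((G n 0 c)%:E = box_volume c)%E.
    rewrite /G /box_volume; case: c => [[a b]|//].
    by congr (_%:E); apply: eq_bigr => i _; rewrite ltn_ord.
  by rewrite Gn; under eq_eseriesr do rewrite Gn.
elim: m => [_ x|m IH mn x].
  have G0 c : box c x -> G 0 x c = 1.
    case: c => [[a b]|//] /= h; rewrite big1// => i _ /=.
    by rewrite indicE mem_set//= in_itv/= h.
  have [xab|xab] := pselect (box ab x); last first.
    have -> : G 0 x ab = 0.
      move: xab; rewrite /G; case: (ab) => [[a b]|//] /= /existsNP[i xi].
      rewrite (bigD1 i)//= indicE memNset ?mul0r//= in_itv/=.
    by apply: nneseries_ge0 => k _ _; rewrite lee_fin.
  have [k _ xk] := abB _ xab.
  rewrite (@nneseriesD1 _ _ k)//; last by move=> j _; rewrite lee_fin.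
  by rewrite !G0// leeDl// nneseries_ge0// => j _ _; rewrite lee_fin.
pose i0 := Ordinal mn.
pose xt (t : R) : E := \row_j if j == i0 then t else x ord0 j.
pose C (c : option (E * E)) : R := if c is Some _ then
  \prod_(i < n | i != i0) if (i < m)%N then len c i else \1_(inb c i) (x ord0 i) else 0.
have C_ge0 c : 0 <= C c.
  by rewrite /C; case: c => [c|//]; apply: prodr_ge0 => i _; case: ifP.
have GC t c : G m (xt t) c = C c * \1_(inb c i0) t.
  rewrite /G /C; case: c => [c|]; last by rewrite mul0r.
  rewrite (bigD1 i0)//= ltnn mxE eqxx mulrC; congr (_ * _).
  by apply: eq_bigr => i /negbTE ii0; rewrite mxE ii0.
have GC1 c : G m.+1 x c = C c * len c i0.
  rewrite /G /C; case: c => [c|]; last by rewrite mul0r.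
  rewrite (bigD1 i0)//= ltnSn mulrC; congr (_ * _).
  apply: eq_bigr => i ii0; have im : (i != m :> nat)%N by [].
  by rewrite ltnS leq_eqVlt (negbTE im).
have minb c i : measurable (inb c i) by rewrite /inb; case: c => [[a b]|].
have mC c : measurable_fun setT (fun t : R => (C c * \1_(inb c i0) t)%:E).
  by apply/measurable_EFinP; apply: measurable_funM => //; exact: measurable_indic.
have IC c : (\int[lebesgue_measure]_t (C c * \1_(inb c i0) t)%:E = (C c * len c i0)%:E)%E.
  under eq_integral do rewrite EFinM.
  rewrite ge0_integralZl_EFin//; last first.
    by apply/measurable_EFinP; apply: measurable_indic; exact: minb.
  have -> : (\int[lebesgue_measure]_x (\1_(inb c i0) x)%:E = lebesgue_measure (inb c i0))%E.
    by rewrite integral_indic ?setIT//; exact: minb.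
  rewrite /inb /len; case: c => [[a b]|]; last by rewrite measure0 mule0 mulr0.
  rewrite lebesgue_measure_itv/= lte_fin; case: ifPn => [ab_|]; first by rewrite max_r// subr_ge0 ltW.
  by rewrite -leNgt => ab_; rewrite max_l ?mule0 ?mulr0// subr_le0.
rewrite GC1 -IC; under eq_eseriesr do rewrite GC1 -IC.
rewrite -integral_nneseries//; last by move=> k t _; rewrite lee_fin mulr_ge0.
apply: ge0_le_integral => //.
- by move=> t _; rewrite lee_fin mulr_ge0.
- exact: mC.
- apply: (@ge0_emeasurable_sum _ _ _ _ _ xpredT) => [k t _ _|k _]; last exact: mC.
  by rewrite lee_fin mulr_ge0.
- move=> t _; rewrite -GC; under eq_eseriesr do rewrite -GC.
  exact: IH (ltnW mn) _.
by move=> k; exact: mC.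
Qed.

Lemma lebesgue_rV_box ab : mu (box ab) = box_volume ab.
Proof.
apply/eqP; rewrite eq_le; apply/andP; split; last exact: box_volume_le_outer.
apply: ereal_inf_lbound => /=; exists (fun k => if k == 0%N then ab else None).
  by move=> x abx; exists 0%N.
rewrite (@nneseriesD1 _ _ 0%N)//=; last by move=> k _; exact: box_volume_ge0.
by rewrite eseries0 ?adde0// => k _ /= /negbTE ->.
Qed.

Lemma le_lebesgue_rV (A B : set E) : A `<=` B -> (mu A <= mu B)%E.
Proof. exact: le_lebesgue_outer_rV. Qed.

Lemma measurable_cube_itv (I : 'I_n -> interval R) :
  (@lebesgue_outer_rV R n).-cara.-measurable [set x : E | forall i, x ord0 i \in I i].
Proof.
rewrite (_ : [set _ | _] = \big[setI/setT]_(i < n) [set x : E | x ord0 i \in I i]); last first.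
  apply/seteqP; split => x /=.
    move=> h; elim/big_ind : _ => // i _; exact: h.
  move=> h i; move: h; rewrite (bigD1 i)//=; by case.
apply: (@bigsetI_measurable _ L) => i _.
have := @measurable_coord i measurableT [set` I i] (measurable_itv _).
by rewrite setTI.
Qed.

Lemma measurable_cube_set (Q : @cube R n) : (@lebesgue_outer_rV R n).-cara.-measurable (cube_set Q).
Proof. exact: measurable_cube_itv. Qed.

(** Concentric closed boxes with sides [t * l], t < 1, fit inside; letting t tend to 1 avoids a
    separate proof that faces are null. *)
Lemma open_cube_le (a : E) (l : R) : 0 < l ->
  ((l ^+ n)%:E <= mu [set x | forall i, (a ord0 i < x ord0 i < a ord0 i + l)%R])%E.
Proof.
move=> l0; have H (t : R) : 0 < t < 1 ->
    (((t * l) ^+ n)%:E <= mu [set x | forall i, (a ord0 i < x ord0 i < a ord0 i + l)%R])%E.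
  move=> /andP[t0 t1].
  pose d := (1 - t) * l / 2.
  have d0 : 0 < d by rewrite /d divr_gt0// mulr_gt0// subr_gt0.
  have <- : mu (box (Some (a + const_mx d, a + const_mx (l - d)))) = ((t * l) ^+ n)%:E.
    rewrite lebesgue_rV_box /=; congr _%:E; rewrite -[in RHS](card_ord n) -prodr_const.
    apply: eq_bigr => i _; rewrite !mxE.
    rewrite (_ : _ + _ - _ = t * l); first by rewrite max_r// mulr_ge0// ltW.
    by rewrite /d; lra.
  apply: le_lebesgue_rV => x /= h i; have := h i; rewrite !mxE => /andP[h1 h2].
  by apply/andP; split; lra.
move: (mu _) H => m H.
have [m0|m0] := boolP (m == +oo)%E; first by rewrite (eqP m0) leey.
have mfin : m \is a fin_num.
  rewrite fin_numE m0 andbT; apply/eqP => moo.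
  by have := H 2^-1; rewrite moo => /(_ ltac:(lra)); rewrite leeNy_eq.
rewrite -(fineK mfin) lee_fin.
have cf : (fun t : R => t ^+ n * l ^+ n) @ 1^'- --> (1 ^+ n * l ^+ n).
  by apply: cvg_at_left_filter; apply: cvgM; [exact: exprn_continuous|exact: cvg_cst].
rewrite expr1n mul1r in cf; rewrite -(cvg_lim _ cf)//.
apply: limr_le; first by apply/cvg_ex; eexists; exact: cf.
near=> t; rewrite -exprMn -lee_fin fineK//; apply: H; apply/andP; split; near: t.
  by apply: nbhs_left_gt.
exact: nbhs_left_lt.
Unshelve. all: by end_near. Qed.

Lemma lebesgue_rV_cube (Q : @cube R n) : mu (cube_set Q) = ((side Q) ^+ n)%:E.
Proof.
apply/eqP; rewrite eq_le; apply/andP; split.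
  have <- : mu (box (Some (corner Q, corner Q + const_mx (side Q)))) = ((side Q) ^+ n)%:E.
    rewrite lebesgue_rV_box /=; congr _%:E.
    rewrite (eq_bigr (fun=> side Q)) ?prodr_const ?card_ord// => i _.
    by rewrite !mxE addrAC subrr add0r max_r// ltW// side_gt0.
  apply: le_lebesgue_rV => x /= h i; have := h i; rewrite !mxE in_itv/=.
  by case/andP; case: (left_closed Q); case: (right_closed Q) => /= a b; apply/andP; split => //; exact: ltW.
apply: le_trans (open_cube_le (corner Q) (side_gt0 Q)) _.
apply: le_lebesgue_rV => x /= h i; have /andP[h1 h2] := h i; rewrite in_itv/=.
by case: (left_closed Q); case: (right_closed Q) => /=; rewrite ?h1 ?h2 ?(ltW h1) ?(ltW h2).
Qed.

Lemma volume_cube (Q : @cube R n) : volume (cube_set Q) = (side Q) ^+ n.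
Proof. by rewrite /volume lebesgue_rV_cube. Qed.

End lebesgue_rV_theory.

(** * Open sets and sigma-finiteness *)

Section lebesgue_rV_open.
Context {R : realType} {n : nat}.
Local Notation E := 'rV[R]_n.
Local Notation L := (caratheodory_type (@lebesgue_outer_rV R n)).
Local Notation mu := (@lebesgue_rV R n).

Lemma normr_lt_rV (x : E) (e : R) : 0 < e -> (`|x| < e <-> forall i, `|x ord0 i| < e).
Proof.
move=> e0; split=> [xe i|H].
  apply: le_lt_trans xe; rewrite /Num.norm/= mx_normrE.
  by apply: (@le_bigmax _ _ _ _ (fun ij : 'I_1 * 'I_n => `|x ij.1 ij.2|) (ord0, i)).
rewrite /Num.norm/= mx_normrE; apply/bigmax_ltP; split => // -[i j] _ /=.
by rewrite (ord1 i).
Qed.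

Lemma normr_le_rV (x : E) (e : R) : 0 <= e -> (`|x| <= e <-> forall i, `|x ord0 i| <= e).
Proof.
move=> e0; split=> [xe i|H].
  apply: le_trans xe; rewrite /Num.norm/= mx_normrE.
  by apply: (@le_bigmax _ _ _ _ (fun ij : 'I_1 * 'I_n => `|x ij.1 ij.2|) (ord0, i)).
rewrite /Num.norm/= mx_normrE; apply/bigmax_leP; split => // -[i j] _ /=.
by rewrite (ord1 i).
Qed.

Lemma coord_le_normr (x : E) i : `|x ord0 i| <= `|x|.
Proof. by have [H _] := @normr_le_rV x _ (normr_ge0 x); exact: H. Qed.

Lemma open_rVP (A : set E) : open A <->
  forall x, A x -> exists2 e : R, 0 < e & forall y, `|y - x| < e -> A y.
Proof.
split=> [oA x Ax|H].
  have /nbhs_ballP[e /= e0 eA] : nbhs x A by exact: open_nbhs_nbhs.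
  exists e => // y yx; apply: eA; rewrite mx_norm_ball /ball_/=.
  by rewrite distrC.
rewrite openE => x /H[e e0 eA]; apply/nbhs_ballP; exists e => //= y.
by rewrite mx_norm_ball /ball_/= distrC; exact: eA.
Qed.

Lemma open_lebesgue_measurable (A : set E) : open A ->
  (@lebesgue_outer_rV R n).-cara.-measurable A.
Proof.
move=> /open_rVP oA.
(* The open cubes with rational centre and side 2 / (k + 1) contained in [A] form a countable
   covering of [A]. *)
pose I (pk : 'rV[rat]_n * nat) : set E :=
  [set x | forall i, x ord0 i \in `]ratr (pk.1 ord0 i) - pk.2.+1%:R^-1, ratr (pk.1 ord0 i) + pk.2.+1%:R^-1[].
pose F pk := if pselect (I pk `<=` A) then I pk else set0.
have mF pk : (@lebesgue_outer_rV R n).-cara.-measurable (F pk).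
  rewrite /F; case: (pselect _) => H; last exact: (@measurable0 _ L).
  exact: measurable_cube_itv.
suff -> : A = \bigcup_pk F pk by apply: (@countable_bigcupT_measurable _ L).
apply/seteqP; split => x; last first.
  by move=> [pk _]; rewrite /F; case: pselect => //; exact.
move=> /oA[e e0 eA].
pose k := Num.truncn (2 / e).
have ke : 2 * k.+1%:R^-1 < e.
  rewrite ltr_pdivrMr// mulrC -ltr_pdivrMr//.
  exact: truncnS_gt.
have k0 : 0 < (k.+1%:R^-1 : R) by rewrite invr_gt0.
have H (i : 'I_n) : exists q : rat, ratr q \in `]x ord0 i - k.+1%:R^-1, x ord0 i + k.+1%:R^-1[.
  by apply: rat_in_itvoo; move: k0; set d := _^-1; lra.
have [q qP] := choice H.
exists (\row_i q i, k) => //.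
rewrite /F; case: pselect => /= [_ i|].
  by rewrite mxE; have := qP i; move: k0; rewrite !in_itv/=; set d := _^-1; lra.
case=> y /= yq; apply: eA; apply/normr_lt_rV => // i; rewrite !mxE.
have := yq i; have := qP i; move: ke k0; rewrite !mxE !in_itv/= ltr_norml; set d := _^-1; lra.
Qed.

Lemma continuous_lebesgue_measurable (f : E -> R) : continuous f ->
  measurable_fun [set: L] f.
Proof.
move=> cf; apply: (measurability _ (RGenInftyO.measurableE R)) => //.
move=> _ [_ [x ->] <-]; rewrite setTI; apply: open_lebesgue_measurable.
by apply: open_comp => // y _; exact: cf.
Qed.

Lemma lebesgue_rV_sigma_finite : sigma_finite [set: L] mu.
Proof.
exists (fun k => box (Some (const_mx (- k%:R), const_mx k%:R))).
  apply/seteqP; split => // x _; exists (Num.truncn `|x|).+1 => //= i.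
  rewrite !mxE -ler_norml; apply: le_trans (coord_le_normr x i) _.
  by rewrite ltW// truncnS_gt.
move=> k; split; last by rewrite [X in (X < _)%E]lebesgue_rV_box /= ltry.
rewrite (_ : box _ = [set x : E | forall i, x ord0 i \in `[- k%:R, k%:R]]).
  exact: measurable_cube_itv.
by apply/seteqP; split => x /= h i; have := h i; rewrite !mxE in_itv/=.
Qed.

End lebesgue_rV_open.
HB.instance Definition _ (R : realType) (n : nat) :=
  @Measure_isSigmaFinite.Build _ (caratheodory_type (@lebesgue_outer_rV R n)) R
    (@lebesgue_rV R n) lebesgue_rV_sigma_finite.

Section integral_nomeas.
Context d (T : measurableType d) (R : realType) (m : {measure set T -> \bar R}).
Local Open Scope ereal_scope.

(** The integral of a nonnegative function is a supremum over simple functions below it, so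
    monotonicity holds without measurability. This is what allows [f \o psi] to be treated before
    anything is known about its measurability. *)
Lemma le_integral_lower (D : set T) (f g : T -> \bar R) :
  (forall x, D x -> 0 <= f x) -> (forall x, D x -> f x <= g x) ->
  \int[m]_(x in D) f x <= \int[m]_(x in D) g x.
Proof.
move=> f0 fg.
have g0 x : D x -> 0 <= g x by move=> Dx; exact: le_trans (f0 _ Dx) (fg _ Dx).
rewrite !ge0_integralE//.
apply: ereal_sup_le => _ /= [h hf <-]; exists h => // x.
apply: le_trans (hf x) _; rewrite /patch; case: ifPn => // /set_mem; exact: fg.
Qed.
End integral_nomeas.

(** * Outer regularity, and the two norms *)

Section lebesgue_rV_regular.
Context {R : realType} {n : nat}.
Local Notation E := 'rV[R]_n.
Local Notation L := (caratheodory_type (@lebesgue_outer_rV R n)).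
Local Notation mu := (@lebesgue_rV R n).

Lemma box_open_cover (ab : option (E * E)) (e : R) : 0 < e ->
  exists U : set E, [/\ open U, box ab `<=` U & (mu U <= box_volume ab + e%:E)%E].
Proof.
move=> e0; case: ab => [[a b]|]; last first.
  exists set0; split => //.
  by rewrite [X in (X <= _)%E](@measure0 _ L) /= add0e lee_fin ltW.
(* The volume of the box with every side enlarged by [t], as a polynomial in [t]; its continuity at
   0 gives an admissible enlargement. *)
pose p : {poly R} := \prod_(i < n) ('X + (Num.max 0 (b ord0 i - a ord0 i))%:P).
have : p.[t] @[t --> 0^'+] --> p.[0].
  by apply: cvg_at_right_filter; exact: continuous_horner.
move=> /cvgrPdist_le /(_ _ e0) pe.
have pE t : p.[t] = \prod_(i < n) (t + Num.max 0 (b ord0 i - a ord0 i)).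
  by rewrite horner_prod; apply: eq_bigr => i _; rewrite !hornerE.
near (0 : R)^'+ => t.
have t0 : 0 < t by near: t; exact: nbhs_right_gt.
have pt : p.[t] <= p.[0] + e.
  have : `|p.[0] - p.[t]| <= e by near: t.
  by rewrite ler_norml; lra.
exists [set x | forall i, x ord0 i \in `]a ord0 i - t / 2, b ord0 i + t / 2[]; split.
- apply/open_rVP => x xP.
  pose d := \big[Num.min/1]_(i < n) Num.min (x ord0 i - (a ord0 i - t / 2)) (b ord0 i + t / 2 - x ord0 i).
  exists d.
    rewrite /d; elim/big_rec : _ => // i m _ m0; rewrite lt_min m0 andbT.
    by have := xP i; rewrite in_itv/= lt_min !subr_gt0.
  move=> y yx i; have d0 : 0 < d by apply: le_lt_trans yx.
  have /normr_lt_rV -/(_ d0) /(_ i) := yx.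
  rewrite !mxE => yxi.
  have di : d <= Num.min (x ord0 i - (a ord0 i - t / 2)) (b ord0 i + t / 2 - x ord0 i).
    exact: bigmin_le.
  move: di yxi; rewrite le_min ltr_norml in_itv/=; lra.
- move=> x /= xab i; have := xab i; rewrite in_itv/=; lra.
- apply: (@le_trans _ _ (mu (box (Some (a - const_mx (t/2), b + const_mx (t/2)))))).
    by apply: le_lebesgue_rV => x /= h i; have := h i; rewrite in_itv/= !mxE; lra.
  rewrite lebesgue_rV_box /= lee_fin; apply: le_trans (le_trans _ pt) _.
    rewrite pE; apply: ler_prod => i _; rewrite !mxE le_max lexx/=.
    rewrite ge_max; apply/andP; split; first by rewrite addr_ge0 ?le_max ?lexx// ltW.
    rewrite (_ : _ - _ = t + (b ord0 i - a ord0 i)); last lra.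
    by rewrite lerD2l le_max lexx orbT.
  rewrite pE lerD2r; apply: ler_prod => i _; rewrite add0r lexx andbT le_max lexx//.
Unshelve. all: by end_near. Qed.

Lemma lebesgue_rV_outer_regular (A : set E) (e : R) : 0 < e -> (mu A < +oo)%E ->
  exists U : set E, [/\ open U, A `<=` U & (mu U <= mu A + e%:E)%E].
Proof.
move=> e0 Aoo.
have Afin : mu A \is a fin_num.
  by rewrite ge0_fin_numE//; exact: lebesgue_outer_rV_ge0.
have e20 : 0 < e / 2 by rewrite divr_gt0.
have [_ [B AB <-] Be] := lb_ereal_inf_adherent e20 Afin.
have ek k : 0 < e / 2 / (2 ^ k.+1)%:R by rewrite divr_gt0.
have H k := box_open_cover (B k) (ek k).
have [U UP] := choice H.
exists (\bigcup_k U k); split.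
- by apply: bigcup_open => k _; have [] := UP k.
- by move=> x /AB[k _ Bkx]; exists k => //; have [_ h _] := UP k; exact: h.
apply: le_trans (lebesgue_outer_rV_sigma_subadditive _) _.
apply: (@le_trans _ _ (\sum_(k <oo) (box_volume (B k) + (e / 2 / (2 ^ k.+1)%:R)%:E))%E).
  apply: lee_nneseries => [k *|k *]; first exact: lebesgue_outer_rV_ge0.
  by have [] := UP k.
apply: le_trans (epsilon_trick _ _ _) _; [|exact: ltW|].
  by move=> k; exact: box_volume_ge0.
rewrite [e in leRHS]splitr EFinD addeA; apply: leeD => //; exact: ltW.
Qed.

Lemma measurable_enorm_sub :
  measurable_fun [set: L * L] (fun x : L * L => enorm ((x.1 : E) - (x.2 : E))).
Proof.
apply: measurableT_comp => //.
  by apply: continuous_measurable_fun; exact: sqrt_continuous.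
apply: measurable_sum => i.
under eq_fun do rewrite !mxE.
apply: measurable_funX; apply: measurable_funB.
  exact: (measurableT_comp (measurable_coord i) measurable_fst).
exact: (measurableT_comp (measurable_coord i) measurable_snd).
Qed.

Lemma measurable_Qkernel (f : E -> R) (p : R) : measurable_fun [set: L] f ->
  measurable_fun [set: L * L]
    (fun x : L * L => (`|f x.1 - f x.2| ^+ 2 / enorm ((x.1 : E) - (x.2 : E)) `^ p)%:E).
Proof.
move=> mf; apply/measurable_EFinP; under eq_fun do rewrite -powRN.
apply: measurable_funM; last first.
  by apply: (measurableT_comp (measurable_powR _)); exact: measurable_enorm_sub.
apply: measurable_funX; apply: measurableT_comp => //.
apply: measurable_funB.
  exact: (measurableT_comp mf measurable_fst).
exact: (measurableT_comp mf measurable_snd).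
Qed.

Lemma enorm_ge (x : E) : `|x| <= enorm x.
Proof.
apply/normr_le_rV; first exact: sqrtr_ge0.
move=> i; rewrite /enorm -sqrtr_sqr ler_sqrt ?sumr_ge0// => [|j _]; last exact: sqr_ge0.
by rewrite (bigD1 i)//= lerDl sumr_ge0// => j _; exact: sqr_ge0.
Qed.

Lemma enorm_le (x : E) : enorm x <= Num.sqrt n%:R * `|x|.
Proof.
rewrite -[`|x|]normr_id -(sqrtr_sqr `|x|) -sqrtrM// /enorm ler_sqrt; last first.
  by rewrite mulr_ge0// sqr_ge0.
have -> : n%:R * `|x| ^+ 2 = \sum_(i < n) `|x| ^+ 2 by rewrite sumr_const card_ord mulr_natl.
apply: ler_sum => i _.
by rewrite -(real_normK (num_real (x ord0 i))) lerXn2r ?nnegrE// coord_le_normr.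
Qed.

End lebesgue_rV_regular.

(** * Quasisymmetric maps *)

Section quasisymmetry.
Context {R : realType} {n : nat}.
Local Notation E := 'rV[R]_n.
Local Notation L := (caratheodory_type (@lebesgue_outer_rV R n)).
Local Notation mu := (@lebesgue_rV R n).

Definition distortion (up dn : R -> R) :=
  (forall T, 0 < T -> 0 < up T) /\ (forall e, 0 < e -> 0 < dn e).

(* Quasisymmetry in the sup norm, in a form that passes to the inverse map. *)
Definition ratio_control (up dn : R -> R) (th : E -> E) :=
  (forall T x y z, 0 < T -> `|x - y| <= T * `|x - z| ->
     `|th x - th y| <= up T * `|th x - th z|) /\
  (forall e x y z, 0 < e -> `|x - y| <= dn e * `|x - z| ->
     `|th x - th y| <= e * `|th x - th z|).

(** Contraposition: a violated ratio for [psi] is, with two points exchanged, a hypothesis on ratios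
    for [phi]. The factors 2 in the new functions turn the outcome into [|a - b| <= |a - b| / 2],
    which leaves only the degenerate case. *)
Lemma ratio_control_inverse (up dn : R -> R) : distortion up dn ->
  exists up' dn' : R -> R, distortion up' dn' /\
    forall phi psi : E -> E, cancel phi psi -> cancel psi phi ->
      ratio_control up dn phi -> ratio_control up' dn' psi.
Proof.
move=> [up0 dn0].
exists (fun T => (dn ((2 * T)^-1))^-1), (fun e => (2 * up (e^-1))^-1); split.
  split=> [T T0|e e0]; rewrite invr_gt0; first by rewrite dn0// invr_gt0 mulr_gt0.
  by rewrite mulr_gt0// up0// invr_gt0.
move=> phi psi pK Kp [cup cdn]; split.
- move=> T a b c T0 abc; rewrite leNgt; apply/negP => H.
  have d0 : 0 < dn ((2 * T)^-1) by rewrite dn0// invr_gt0 mulr_gt0.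
  have H' : `|psi a - psi c| <= dn (2 * T)^-1 * `|psi a - psi b|.
    by rewrite -ler_pdivrMl// ltW.
  have := cdn _ _ _ _ _ H'; rewrite invr_gt0 mulr_gt0// => /(_ isT); rewrite !Kp => H2.
  have : `|a - b| <= 0.
    have : `|a - b| <= T * ((2 * T)^-1 * `|a - b|).
      by apply: le_trans abc _; rewrite ler_wpM2l// ltW.
    by rewrite mulrA invfM mulrCA divff ?gt_eqF// mulr1; lra.
  rewrite normr_le0 subr_eq0 => /eqP ab; move: H; rewrite ab subrr normr0.
  by rewrite ltNge mulr_ge0// invr_ge0 ltW.
- move=> e a b c e0 abc; rewrite leNgt; apply/negP => H.
  have u0 : 0 < up e^-1 by rewrite up0// invr_gt0.
  have H' : `|psi a - psi c| <= e^-1 * `|psi a - psi b| by rewrite ler_pdivlMl// ltW.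
  have := cup _ _ _ _ _ H'; rewrite invr_gt0// => /(_ e0); rewrite !Kp => H2.
  have : `|a - b| <= 0.
    have : `|a - b| <= (2 * up e^-1)^-1 * (up e^-1 * `|a - b|).
      by apply: le_trans abc _; rewrite ler_wpM2l// invr_ge0 mulr_ge0// ltW.
    rewrite (_ : _ * (_ * _) = 2^-1 * `|a - b|); first lra.
    by field; rewrite gt_eqF.
  rewrite normr_le0 subr_eq0 => /eqP ab; move: H; rewrite ab subrr normr0.
  by rewrite ltNge mulr_ge0// ltW.
Qed.

End quasisymmetry.

Section quasisymmetric_control.
Context {R : realType} {n : nat}.
Hypothesis n_gt0 : (0 < n)%N.
Local Notation E := 'rV[R]_n.

(** The factor [q], inside and outside of [eta], pays for the passage between the Euclidean and the
    sup norm. The value [dn e] exists because [eta] is onto and vanishes at 0. Quasisymmetry speaks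
    of distinct points only: the summand 1 in [up] covers the case y = z, and [dn e < 1] excludes it
    in the second part. *)
Lemma quasisymmetric_control (eta : R -> R) : increasing_homeo eta ->
  exists up dn : R -> R, distortion up dn /\
    forall phi psi : E -> E, cancel phi psi -> quasisymmetric eta phi ->
      ratio_control up dn phi.
Proof.
move=> [eta0 etaM [etaS _ etaJ] _ _].
set q := Num.sqrt (n%:R : R).
have q0 : 0 < q by rewrite sqrtr_gt0 ltr0n.
have in0 t : (t \in `[0, +oo[) = (0 <= t :> R) by rewrite in_itv/= andbT.
have eta_ge0 t : 0 <= t -> 0 <= eta t.
  by rewrite -in0 => /etaS /=; rewrite in0.
have eta_le s t : 0 <= s -> s <= t -> eta s <= eta t.
  move=> s0; rewrite le_eqVlt => /predU1P[->//|st].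
  by apply/ltW/etaM => //; rewrite in0// (le_trans s0)// ltW.
have Hdn (e : R) : {d : R | 0 < d < 1 /\ (0 < e -> q * eta (q * d) <= e)}.
  apply/cid; have [e0|e0] := leP e 0; first by exists 2^-1; split; [lra|by []].
  have : `[0, +oo[%classic (e / q) by rewrite /= in0 divr_ge0// ltW.
  move=> /etaJ[s /=]; rewrite in0 => s0 es.
  have s_gt0 : 0 < s.
    rewrite lt_neqAle s0 andbT; apply/eqP => s00; move: es; rewrite -s00 eta0 => /eqP.
    by rewrite lt_eqF// divr_gt0.
  exists (Num.min 2^-1 (s / q)); split.
    by rewrite lt_min divr_gt0// gt_min; lra.
  move=> _; rewrite -ler_pdivlMl// [_^-1 * _]mulrC -es; apply: eta_le.
    by rewrite mulr_ge0 ?le_min ?divr_ge0 ?invr_ge0 ?ler0n ?(ltW q0).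
  by rewrite mulrC -ler_pdivlMr// ge_min lexx orbT.
exists (fun T => q * eta (q * T) + 1), (fun e => sval (Hdn e)); split.
  split=> [T T0|e e0]; last by case: (Hdn e) => d /= [/andP[]].
  by rewrite ltr_wpDl// mulr_ge0 ?eta_ge0 ?mulr_ge0// ltW.
move=> phi psi pK [_ qs].
have key T x y z : 0 < T -> x != y -> x != z -> y != z -> `|x - y| <= T * `|x - z| ->
    `|phi x - phi y| <= q * eta (q * T) * `|phi x - phi z|.
  move=> T0 xy xz yz H.
  have nz (u v : E) : u != v -> 0 < enorm (u - v).
    by move=> uv; apply: lt_le_trans (enorm_ge _); rewrite normr_gt0 subr_eq0.
  have := qs x y z xy xz yz; rewrite ler_pdivrMr; last first.
    by apply: nz; rewrite (can_eq pK).
  move=> H1; apply: le_trans (enorm_ge _) _; apply: le_trans H1 _.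
  rewrite (mulrC q) -mulrA.
  apply: ler_pM => //; last exact: enorm_le.
  - by rewrite eta_ge0// divr_ge0// sqrtr_ge0.
  - exact: sqrtr_ge0.
  - apply: eta_le; first by rewrite divr_ge0// sqrtr_ge0.
    rewrite ler_pdivrMr ?nz//; apply: le_trans (enorm_le _) _.
    rewrite -mulrA ler_pM2l//; apply: le_trans H _.
    by rewrite ler_pM2l// enorm_ge.
split.
- move=> T x y z T0 H; have [->|xy] := eqVneq x y.
    by rewrite subrr normr0 mulr_ge0// addr_ge0// mulr_ge0 ?eta_ge0 ?mulr_ge0// ltW.
  have [xz|xz] := eqVneq x z.
    by move: H; rewrite xz subrr normr0 mulr0 normr_le0 subr_eq0 -xz (negbTE xy).
  have [->|yz] := eqVneq y z.
    by rewrite ler_peMl// lerDr mulr_ge0 ?eta_ge0 ?mulr_ge0// ltW.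
  by apply: le_trans (key _ _ _ _ T0 xy xz yz H) _; rewrite ler_wpM2r// lerDl.
- move=> e x y z e0; case: (Hdn e) => d /= [/andP[d0 d1]] /(_ e0) ed H.
  have [->|xy] := eqVneq x y; first by rewrite subrr normr0 mulr_ge0// ltW.
  have [xz|xz] := eqVneq x z.
    by move: H; rewrite xz subrr normr0 mulr0 normr_le0 subr_eq0 -xz (negbTE xy).
  have [yz|yz] := eqVneq y z.
    exfalso; move: H; rewrite -yz leNgt gtr_pMl ?d1// normr_gt0 subr_eq0//.
  by apply: le_trans (key _ _ _ _ d0 xy xz yz H) _; rewrite ler_wpM2r.
Qed.

End quasisymmetric_control.

(** * Preimages of dyadic cubes *)

Section ball_images.
Context {R : realType} {n : nat}.
Hypothesis n_gt0 : (0 < n)%N.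
Local Notation E := 'rV[R]_n.
Local Notation mu := (@lebesgue_rV R n).

Lemma lebesgue_rV_closed_ball (x : E) (r : R) : 0 <= r ->
  mu [set y | `|y - x| <= r] = ((2 * r) ^+ n)%:E.
Proof.
move=> r0; rewrite (_ : [set _ | _] = box (Some (x - const_mx r, x + const_mx r))).
  rewrite lebesgue_rV_box /=; congr _%:E.
  rewrite (eq_bigr (fun=> 2 * r)) ?prodr_const ?card_ord// => i _.
  by rewrite !mxE max_r; lra.
apply/seteqP; split => y /=.
  by move/normr_le_rV => /(_ r0) h i; have := h i; rewrite !mxE ler_norml; lra.
by move=> h; apply/normr_le_rV => // i; have := h i; rewrite !mxE ler_norml; lra.
Qed.

Lemma lebesgue_rV_open_ball_ge (x : E) (r : R) : 0 < r ->
  (((2 * r) ^+ n)%:E <= mu [set y | `|y - x| < r]%R)%E.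
Proof.
move=> r0; have r20 : 0 < 2 * r by lra.
apply: le_trans (open_cube_le (x - const_mx r) r20) _.
apply: le_lebesgue_rV => y /= h; apply/normr_lt_rV => // i.
by have := h i; rewrite !mxE ltr_norml; lra.
Qed.

Lemma normr_const_mx (r : R) : 0 <= r -> `|const_mx r : E| = r.
Proof.
move=> r0; apply/eqP; rewrite eq_le; apply/andP; split.
  by apply/normr_le_rV => // i; rewrite mxE ger0_norm.
by have := coord_le_normr (const_mx r : E) (Ordinal n_gt0); rewrite mxE ger0_norm.
Qed.

Variables (up dn : R -> R) (phi psi : E -> E).
Hypotheses (updn : distortion up dn) (pK : cancel phi psi) (Kp : cancel psi phi)
  (cpsi : ratio_control up dn psi).

(** In the sup norm [x + const_mx h] is at distance [h] from [x]. This single point represents the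
    whole sphere of radius [h], since ratio control compares all of its points with one another. *)
Definition image_radius (x : E) (h : R) := `|psi x - psi (x + const_mx h)|.
Local Notation rho := image_radius.

Lemma image_radius_gt0 (x : E) (h : R) : 0 < h -> 0 < rho x h.
Proof.
move=> h0; rewrite normr_gt0 subr_eq0 (can_eq Kp) -subr_eq0 opprD addrA subrr add0r oppr_eq0.
by rewrite -normr_gt0 normr_const_mx// ltW.
Qed.

Lemma image_dist_le (T h : R) (x y : E) : 0 < T -> 0 < h -> `|y - x| <= T * h ->
  `|psi y - psi x| <= up T * rho x h.
Proof.
move=> T0 h0 yx; rewrite distrC; apply: cpsi.1 => //.
by rewrite distrC opprD addrA subrr add0r normrN normr_const_mx// ltW.
Qed.

Lemma image_dist_ge (T h : R) (x y : E) : 0 < T -> 0 < h -> h <= T * `|y - x| ->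
  rho x h <= up T * `|psi y - psi x|.
Proof.
move=> T0 h0 yx; rewrite (distrC (psi y)); apply: cpsi.1 => //.
by rewrite opprD addrA subrr add0r normrN normr_const_mx// ?(distrC x) // ltW.
Qed.

Lemma preimage_sub_ball (T h : R) (x : E) (A : set E) : 0 < T -> 0 < h ->
  (forall y, A y -> `|y - x| <= T * h) ->
  phi @^-1` A `<=` [set u | `|u - psi x| <= up T * rho x h].
Proof.
by move=> T0 h0 Ax u /= /Ax H; rewrite -(pK u); apply: image_dist_le.
Qed.

Lemma ball_sub_preimage (h : R) (x : E) (A : set E) : 0 < h ->
  (forall y, `|y - x| < h -> A y) ->
  [set u | `|u - psi x| < (up 1)^-1 * rho x h] `<=` phi @^-1` A.
Proof.
move=> h0 Ax u /= H; apply: Ax; rewrite ltNge; apply/negP => hu.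
have up1 : 0 < up 1 by apply: updn.1.
have := @image_dist_ge 1 h x (phi u) ltr01 h0; rewrite mul1r => /(_ hu); rewrite pK.
by move: H; rewrite ltr_pdivlMl// ltNge => /negbTE ->.
Qed.

Lemma preimage_volume_le (T h : R) (x : E) (A : set E) : 0 < T -> 0 < h ->
  (forall y, A y -> `|y - x| <= T * h) ->
  (mu (phi @^-1` A) <= ((2 * (up T * rho x h)) ^+ n)%:E)%E.
Proof.
move=> T0 h0 Ax; rewrite -(lebesgue_rV_closed_ball (psi x)); last first.
  by rewrite mulr_ge0 ?normr_ge0// ltW// updn.1.
by apply: le_lebesgue_rV; apply: preimage_sub_ball.
Qed.

Lemma preimage_volume_ge (h : R) (x : E) (A : set E) : 0 < h ->
  (forall y, `|y - x| < h -> A y) ->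
  (((2 * ((up 1)^-1 * rho x h)) ^+ n)%:E <= mu (phi @^-1` A))%E.
Proof.
move=> h0 Ax; apply: le_trans (lebesgue_rV_open_ball_ge (psi x) _) _.
  by rewrite mulr_gt0// ?image_radius_gt0// invr_gt0 updn.1.
by apply: le_lebesgue_rV; apply: ball_sub_preimage.
Qed.

Lemma preimage_volume_fin (T h : R) (x : E) (A : set E) : 0 < T -> 0 < h ->
  (forall y, A y -> `|y - x| <= T * h) -> mu (phi @^-1` A) \is a fin_num.
Proof.
move=> T0 h0 Ax; rewrite ge0_fin_numE; last exact: lebesgue_outer_rV_ge0.
by apply: le_lt_trans (preimage_volume_le T0 h0 Ax) _; rewrite ltry.
Qed.

(** The preimages are compared with balls about [psi x]: one of radius [rho / up 1] inside the
    first, one of radius [up T * rho] around the second. The constant is the n-th power of the ratio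
    of the radii. *)
Lemma preimage_volume_doubling (T h : R) (x : E) (A B : set E) : 0 < T -> 0 < h ->
  (forall y, `|y - x| < h -> A y) -> (forall y, B y -> `|y - x| <= T * h) ->
  (mu (phi @^-1` B) <= ((up 1 * up T) ^+ n)%:E * mu (phi @^-1` A))%E.
Proof.
move=> T0 h0 Ax Bx; apply: le_trans (preimage_volume_le T0 h0 Bx) _.
have u1 : 0 < up 1 by apply: updn.1.
have uT : 0 < up T by apply: updn.1.
have := preimage_volume_ge h0 Ax; set m := mu _ => H.
apply: le_trans (lee_wpmul2l _ H); last by rewrite lee_fin exprn_ge0// mulr_ge0// ltW.
rewrite -EFinM lee_fin -exprMn.
rewrite (_ : _ * _ * _ = 2 * (up T * rho x h))//; by field; rewrite gt_eqF.
Qed.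

Lemma preimage_diam (h : R) (x : E) (A : set E) (u w : E) : 0 < h ->
  (forall y, `|y - x| < h -> A y) -> (forall y, A y -> `|y - x| <= h) ->
  A (phi u) -> A (phi w) ->
  ((`|u - w| ^+ n)%:E <= ((up 1 ^+ 2) ^+ n)%:E * mu (phi @^-1` A))%E.
Proof.
move=> h0 Ax xA Au Aw.
have u1 : 0 < up 1 by apply: updn.1.
have := preimage_volume_ge h0 Ax; set m := mu _ => H.
apply: le_trans (lee_wpmul2l _ H); last by rewrite lee_fin exprn_ge0// exprn_ge0// ltW.
rewrite -EFinM lee_fin -exprMn lerXn2r ?nnegrE//.
  by rewrite mulr_ge0 ?exprn_ge0 ?mulr_ge0 ?invr_ge0 ?ltW// image_radius_gt0.
rewrite (_ : _ * _ = up 1 * rho x h + up 1 * rho x h); last first.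
  by field; rewrite gt_eqF.
rewrite -(pK u) -(pK w) -(subrKA (psi x)); apply: le_trans (ler_normD _ _) _.
by apply: lerD; last rewrite distrC; apply: image_dist_le => //; rewrite mul1r; apply: xA.
Qed.

End ball_images.

(** * Half-open dyadic cells addressed by words *)

Section dyadic_words.
Context {R : realType} {n : nat}.
Local Notation E := 'rV[R]_n.
Local Notation word := (seq {ffun 'I_n -> bool}).

(** Half-open in every coordinate, so that the cells of one level partition their root exactly. *)
Definition hcube (a : E) (l : R) : set E :=
  [set x | forall i, a ord0 i <= x ord0 i < a ord0 i + l].

(* A word lists binary digits of the position of a dyadic subcube, the last
   bisection first: children are obtained by [cons], ancestors by [drop]. *)
Fixpoint wpos (s : word) (i : 'I_n) : nat :=
  if s is e :: s' then (wpos s' i).*2 + e i else 0.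

Definition wcorner (a : E) (l : R) (s : word) : E :=
  a + (l / 2 ^+ size s) *: \row_i (wpos s i)%:R.
Definition wside (l : R) (s : word) : R := l / 2 ^+ size s.
Definition cell (a : E) (l : R) (s : word) : set E := hcube (wcorner a l s) (wside l s).

(** The address of the cell of level [k] that contains [x], for [x] in the root. That two points
    share a cell is expressed by the equality of their codes. *)
Fixpoint wcode (a : E) (l : R) (k : nat) (x : E) : word :=
  if k is k'.+1 then
    let s := wcode a l k' x in
    [ffun i => wcorner a l s ord0 i + wside l s / 2 <= x ord0 i] :: s
  else [::].

Fixpoint words (k : nat) : seq word :=
  if k is k'.+1 then [seq e :: s | s <- words k', e <- enum {ffun 'I_n -> bool}]
  else [:: [::]].

Lemma mem_words k (s : word) : (s \in words k) = (size s == k).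
Proof.
elim: k s => [|k IH] [|e s] //=.
  by apply/negbTE/negP => /allpairsP[[? ?] /= []].
rewrite eqSS -IH; apply/allpairsP/idP => [[[s' e'] /= [h _ [_ ->]]]//|h].
by exists (s, e); rewrite mem_enum.
Qed.

Lemma uniq_words k : uniq (words k).
Proof.
elim: k => // k IH; apply: allpairs_uniq => //; first exact: enum_uniq.
by move=> [s e] [s' e'] /= _ _ [-> ->].
Qed.

Lemma size_words k : size (words k) = ((2 ^ n) ^ k)%N.
Proof.
elim: k => // k IH; rewrite /= size_allpairs IH -cardE card_ffun card_bool card_ord.
by rewrite expnS mulnC.
Qed.

Lemma size_code (a : E) l k x : size (wcode a l k x) = k.
Proof. by elim: k => //= k ->. Qed.

Lemma code_words (a : E) l k x : wcode a l k x \in words k.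
Proof. by rewrite mem_words size_code. Qed.

Lemma wside_gt0 (l : R) (s : word) : 0 < l -> 0 < wside l s.
Proof. by move=> l0; rewrite divr_gt0// exprn_gt0. Qed.

Lemma wside_cons (l : R) e (s : word) : wside l (e :: s) = wside l s / 2.
Proof. by rewrite /wside /= exprS invfM mulrA mulrAC. Qed.

Lemma wcorner_cons (a : E) l e (s : word) i :
  wcorner a l (e :: s) ord0 i = wcorner a l s ord0 i + wside l s / 2 * (e i)%:R.
Proof.
rewrite !mxE /= natrD -mul2n natrM -/(wside l (e :: s)) wside_cons -/(wside l s).
by lra.
Qed.

Lemma cell_nil (a : E) l : cell a l [::] = hcube a l.
Proof.
apply/seteqP; split => x /= h i; have := h i; rewrite !mxE /wside/= divr1; lra.
Qed.

Lemma cell_cons (a : E) (l : R) e (s : word) x : 0 < l ->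
  cell a l (e :: s) x <->
  cell a l s x /\ forall i, e i = (wcorner a l s ord0 i + wside l s / 2 <= x ord0 i).
Proof.
move=> l0; have s0 := wside_gt0 s l0; split => [h|[h1 h2] i].
  split=> i; have := h i; rewrite wcorner_cons wside_cons; case: (e i) => /=; first lra.
  - by lra.
  - by move=> H; apply/esym; lra.
  - by move=> H; apply/esym/negbTE; rewrite -ltNge; lra.
have := h1 i; have := h2 i; rewrite wcorner_cons wside_cons.
by case: (e i) => /esym; [|move/negbT; rewrite -ltNge] => /=; lra.
Qed.

Lemma cell_code (a : E) (l : R) k x : 0 < l -> hcube a l x -> cell a l (wcode a l k x) x.
Proof.
move=> l0 ax; elim: k => [|k IH]; first by rewrite cell_nil.
by apply/cell_cons => //; split => // i; rewrite ffunE.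
Qed.

Lemma code_cell (a : E) (l : R) (s : word) x : 0 < l -> cell a l s x -> wcode a l (size s) x = s.
Proof.
move=> l0; elim: s => // e s IH /cell_cons -/(_ l0)[xs es] /=.
by rewrite IH//; congr (_ :: _); apply/ffunP => i; rewrite ffunE -es.
Qed.

Lemma cell_sub (a : E) (l : R) (w s : word) : 0 < l -> cell a l (w ++ s) `<=` cell a l s.
Proof.
by move=> l0; elim: w => // e w IH x /cell_cons -/(_ l0)[/IH].
Qed.

Lemma cell_sub_nil (a : E) (l : R) (s : word) : 0 < l -> cell a l s `<=` hcube a l.
Proof. by move=> l0; rewrite -cell_nil -{1}(cats0 s); apply: cell_sub. Qed.

Lemma wside_cat (l : R) (w s : word) : wside l (w ++ s) = wside (wside l s) w.
Proof. by rewrite /wside size_cat exprD invfM; lra. Qed.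

Lemma wcorner_cat (a : E) (l : R) (w s : word) :
  wcorner a l (w ++ s) = wcorner (wcorner a l s) (wside l s) w.
Proof.
apply/rowP; elim: w => [|e w IH] i; first by rewrite !mxE /= mulr0 addr0.
by rewrite /= !wcorner_cons IH wside_cat.
Qed.

Lemma cell_cat (a : E) (l : R) (w s : word) :
  cell a l (w ++ s) = cell (wcorner a l s) (wside l s) w.
Proof. by rewrite /cell wcorner_cat wside_cat. Qed.

Lemma code_add (a : E) (l : R) j k x : 0 < l -> hcube a l x ->
  exists2 w, size w = j & wcode a l (j + k) x = w ++ wcode a l k x.
Proof.
move=> l0 ax; elim: j => [|j [w wj jk]]; first by exists [::].
by rewrite addSn /= jk; eexists (_ :: w); rewrite /= ?wj.
Qed.

Definition wcenter (a : E) (l : R) (s : word) : E := wcorner a l s + const_mx (wside l s / 2).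

Lemma rowB (x y : E) i : (x - y) ord0 i = x ord0 i - y ord0 i.
Proof. by rewrite !mxE. Qed.

Lemma wcenterE (a : E) (l : R) (s : word) i :
  wcenter a l s ord0 i = wcorner a l s ord0 i + wside l s / 2.
Proof. by rewrite mxE [X in _ + X]mxE. Qed.

Lemma ball_sub_cell (a : E) (l : R) (s : word) x : 0 < l ->
  `|x - wcenter a l s| < wside l s / 2 -> cell a l s x.
Proof.
move=> l0; have s0 := wside_gt0 s l0.
move/normr_lt_rV => H i; have := H ltac:(lra) i.
by rewrite rowB wcenterE ltr_norml; lra.
Qed.

Lemma cell_sub_ball (a : E) (l : R) (s : word) x : 0 < l ->
  cell a l s x -> `|x - wcenter a l s| <= wside l s / 2.
Proof.
move=> l0; have s0 := wside_gt0 s l0.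
move=> H; apply/normr_le_rV; first lra.
move=> i; have := H i.
by rewrite rowB wcenterE ler_norml; lra.
Qed.

End dyadic_words.

Section product_integrals.
Context d (T : measurableType d) (R : realType) (m : {sigma_finite_measure set T -> \bar R}).
Local Open Scope ereal_scope.

(** The seminorm is written with iterated integrals, while sums over cells are exchanged with the
    integral on the product space. *)
Lemma iterated_integral_prod (A B : set T) (F : T * T -> \bar R) :
  measurable A -> measurable B -> measurable_fun setT F -> (forall z, 0 <= F z) ->
  \int[m]_(y in A) \int[m]_(x in B) F (x, y) = \int[m \x m]_(z in B `*` A) F z.
Proof.
move=> mA mB mF F0.
rewrite [RHS]integral_mkcond fubini_tonelli2; last 2 first.
  - by apply/(measurable_restrictT _ (measurableX mB mA)); apply: measurable_funTS.
  - by move=> z; rewrite erestrict_ge0.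
rewrite [LHS]integral_mkcond; apply: eq_integral => y _.
rewrite /fubini_G /= [LHS]/patch; case: ifPn => yA.
  rewrite integral_mkcond; apply: eq_integral => x _; rewrite /patch.
  by rewrite in_setX/= yA andbT.
by rewrite integral0_eq// => x _; rewrite /patch in_setX/= (negbTE yA) andbF.
Qed.

End product_integrals.

Section nonneg_sums.
Context {R : realType}.
Local Open Scope ereal_scope.

Lemma powR_inv_le (x y g : R) : (0 < x -> 0 <= g -> x <= y -> (y `^ g)^-1 <= (x `^ g)^-1)%R.
Proof.
move=> x0 g0 xy; rewrite lef_pV2 ?posrE ?powR_gt0//; last exact: lt_le_trans xy.
by rewrite ge0_ler_powR// nnegrE ltW// (lt_le_trans x0).
Qed.
End nonneg_sums.

(** * Volumes of the preimages of cells *)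

Section cell_volumes.
Context {R : realType} {n : nat}.
Hypothesis n_gt0 : (0 < n)%N.
Local Notation E := 'rV[R]_n.
Local Notation L := (caratheodory_type (@lebesgue_outer_rV R n)).
Local Notation mu := (@lebesgue_rV R n).
Local Notation word := (seq {ffun 'I_n -> bool}).
Variables (up dn : R -> R) (phi psi : E -> E).
Hypotheses (updn : distortion up dn) (pK : cancel phi psi) (Kp : cancel psi phi)
  (cphi : continuous phi) (cpsi : ratio_control up dn psi).

Definition doubling_const (T : R) := (up 1 * up T) ^+ n.

Lemma doubling_const_gt0 T : 0 < T -> 0 < doubling_const T.
Proof. by move=> T0; rewrite exprn_gt0// mulr_gt0// updn.1. Qed.

Definition pcell (a : E) (l : R) (s : word) : set E := phi @^-1` cell a l s.
Definition pvol (a : E) (l : R) (s : word) : R := volume (pcell a l s).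

Lemma measurable_preimage_itv (I : 'I_n -> interval R) :
  (@lebesgue_outer_rV R n).-cara.-measurable (phi @^-1` [set x : E | forall i, x ord0 i \in I i]).
Proof.
rewrite (_ : _ @^-1` _ = \big[setI/setT]_(i < n) ((fun x : E => phi x ord0 i) @^-1` [set` I i])); last first.
  apply/seteqP; split => x /=.
    move=> h; elim/big_ind : _ => // i _; exact: h.
  move=> h i; move: h; rewrite (bigD1 i)//=; by case.
apply: (@bigsetI_measurable _ L) => i _; rewrite -[X in measurable X]setTI.
apply: continuous_lebesgue_measurable => //.
by move=> x; apply: (@continuous_comp _ _ _ phi (fun y : E => y ord0 i)); [exact: cphi|exact: coord_continuous].
Qed.

Lemma hcube_itv (a : E) l : hcube a l = [set x | forall i, x ord0 i \in `[a ord0 i, a ord0 i + l[].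
Proof. by apply/seteqP; split => x /= h i; have := h i; rewrite in_itv/=. Qed.

Lemma measurable_hcube (a : E) l : (@lebesgue_outer_rV R n).-cara.-measurable (hcube a l).
Proof. by rewrite hcube_itv; exact: measurable_cube_itv. Qed.

Lemma measurable_pcell a l s : (@lebesgue_outer_rV R n).-cara.-measurable (pcell a l s).
Proof. by rewrite /pcell /cell hcube_itv; exact: measurable_preimage_itv. Qed.

Lemma lebesgue_rV_hcube (a : E) l : 0 < l -> mu (hcube a l) = (l ^+ n)%:E.
Proof.
move=> l0; rewrite (_ : hcube a l = cube_set (Cube a l0 true false)) ?lebesgue_rV_cube//.
Qed.

Section fixed_cube.
Variables (a : E) (l : R).
Hypothesis l0 : 0 < l.
Local Notation V := (pcell a l).
Local Notation v := (pvol a l).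

Let h0 (s : word) : 0 < wside l s / 2. Proof. by rewrite divr_gt0// wside_gt0. Qed.

Lemma pvol_fin s : mu (V s) = (v s)%:E.
Proof.
rewrite fineK//; apply: (preimage_volume_fin n_gt0 updn pK cpsi ltr01 (h0 s)) => y.
by rewrite mul1r; exact: cell_sub_ball.
Qed.

Lemma pvol_gt0 s : 0 < v s.
Proof.
rewrite -lte_fin -pvol_fin.
apply: lt_le_trans (preimage_volume_ge n_gt0 updn pK Kp cpsi (h0 s) (@ball_sub_cell _ _ a l s ^~ l0)).
rewrite lte_fin exprn_gt0// mulr_gt0// mulr_gt0 ?invr_gt0 ?updn.1//.
exact: image_radius_gt0 (h0 s).
Qed.

Lemma pcell_sub w s : V (w ++ s) `<=` V s.
Proof. by move=> u /=; exact: cell_sub. Qed.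

Lemma pvol_sub w s : v (w ++ s) <= v s.
Proof. by rewrite -lee_fin -!pvol_fin; apply: le_lebesgue_rV; exact: pcell_sub. Qed.

(** The 4 counts half sides of the child: the parent stays within that distance of the centre of the
    child. *)
Lemma pvol_parent e s : v s <= doubling_const 4 * v (e :: s).
Proof.
rewrite -lee_fin EFinM -!pvol_fin.
apply: (preimage_volume_doubling n_gt0 updn pK Kp cpsi _ (h0 (e :: s))) => //.
  by move=> y; exact: ball_sub_cell.
move=> y ys; rewrite -(subrKA (wcenter a l s)); apply: le_trans (ler_normD _ _) _.
rewrite wside_cons; have := cell_sub_ball l0 ys; set c := `|y - _|.
suff : `|wcenter a l s - wcenter a l (e :: s)| <= wside l s / 2 by have := wside_gt0 s l0; lra.
apply/normr_le_rV; first exact/ltW/h0.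
move=> i; rewrite rowB !wcenterE wcorner_cons wside_cons ler_norml.
by have := wside_gt0 s l0; case: (e i) => /=; lra.
Qed.

(** The child with all digits flipped is disjoint from the given one and, by [pvol_parent], takes a
    fixed fraction of the volume of the parent. *)
Lemma pvol_child e s : v (e :: s) <= (1 - (doubling_const 4)^-1) * v s.
Proof.
have i0 := Ordinal n_gt0.
pose e' := [ffun i => ~~ e i] : {ffun 'I_n -> bool}.
have H : v (e :: s) + v (e' :: s) <= v s.
  rewrite -lee_fin EFinD -!pvol_fin.
  rewrite -[leLHS](@measureU _ R L mu); [|exact: measurable_pcell..|].
    apply: le_lebesgue_rV => u []; exact: (@pcell_sub [:: _]).
  apply/seteqP; split => // u [] /= /code_cell -/(_ l0) /= h1 /code_cell -/(_ l0) /= h2.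
  move: h1; rewrite h2 => -[] /ffunP/(_ i0); rewrite ffunE; by case: (e i0).
have := pvol_parent e' s; have d0 := doubling_const_gt0 (ltr0n R 4).
rewrite -ler_pdivrMl// mulrBl mul1r; lra.
Qed.

Lemma pvol_diam s u w : V s u -> V s w ->
  `|u - w| ^+ n <= (up 1 ^+ 2) ^+ n * v s.
Proof.
move=> su sw; rewrite -lee_fin [(_ * v s)%:E]EFinM -pvol_fin.
apply: (preimage_diam n_gt0 updn pK Kp cpsi (h0 s)) su sw.
  by move=> y; exact: ball_sub_cell.
by move=> y; exact: cell_sub_ball.
Qed.

(** The seminorm only sees cubes, so the energy on the preimage of a cell is estimated in a cube of
    comparable volume. *)
Lemma pcell_sub_cube s : exists Q : @cube R n,
  V s `<=` cube_set Q /\ (side Q) ^+ n <= (up 1 ^+ 2) ^+ n * v s.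
Proof.
have u1 : 0 < up 1 by apply: updn.1.
pose r := up 1 * image_radius psi (wcenter a l s) (wside l s / 2).
have r0 : 0 < r by rewrite mulr_gt0//; exact: (image_radius_gt0 n_gt0 Kp).
have r20 : 0 < 2 * r by rewrite mulr_gt0.
exists (Cube (psi (wcenter a l s) - const_mx r) r20 true true); split => /=.
  move=> u su i.
  have : `|u - psi (wcenter a l s)| <= r.
    apply: (preimage_sub_ball n_gt0 pK cpsi ltr01 (h0 s) _ su) => y.
    by rewrite mul1r; exact: cell_sub_ball.
  move/normr_le_rV => /(_ (ltW r0)) /(_ i); rewrite !mxE in_itv/= ler_norml; lra.
rewrite -lee_fin [(_ * v s)%:E]EFinM -pvol_fin.
apply: le_trans (lee_wpmul2l _ (preimage_volume_ge n_gt0 updn pK Kp cpsi (h0 s) (@ball_sub_cell _ _ a l s ^~ l0))); last first.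
  by rewrite lee_fin exprn_ge0// exprn_ge0// ltW.
rewrite -EFinM lee_fin -exprMn (_ : _ * (2 * _) = 2 * r)//.
by rewrite /r; field; rewrite gt_eqF.
Qed.

Lemma hcube_words k : hcube a l = \big[setU/set0]_(s <- @words n k) cell a l s.
Proof.
rewrite -bigcup_seq; apply/seteqP; split => x.
  by move=> ax; exists (wcode a l k x); [exact: code_words|exact: cell_code].
by case=> s _ /(cell_sub_nil l0).
Qed.

Lemma trivIset_cell k : trivIset [set` @words n k] (cell a l).
Proof.
move=> s t; rewrite /= !mem_words => /eqP sk /eqP tk [x [xs xt]].
by rewrite -(code_cell l0 xs) -(code_cell l0 xt) sk tk.
Qed.

Lemma preimage_hcube_words k : phi @^-1` hcube a l = \big[setU/set0]_(s <- @words n k) V s.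
Proof.
rewrite -bigcup_seq; apply/seteqP; split => x /=.
  by move=> ax; exists (wcode a l k (phi x)); [exact: code_words|exact: cell_code].
by case=> s _ /(cell_sub_nil l0).
Qed.

Lemma trivIset_pcell k : trivIset [set` @words n k] V.
Proof.
move=> s t; rewrite /= !mem_words => /eqP sk /eqP tk [x [xs xt]].
by rewrite -(code_cell l0 xs) -(code_cell l0 xt) sk tk.
Qed.

Lemma integral_hcube_words k (f : E -> \bar R) : measurable_fun [set: L] f ->
  (forall x, 0 <= f x)%E ->
  (\int[mu]_(x in hcube a l) f x = \sum_(s <- @words n k) \int[mu]_(x in cell a l s) f x)%E.
Proof.
move=> mf f0; rewrite (hcube_words k).
rewrite (@ge0_integral_bigsetU _ L R mu _ (cell a l) f (@words n k))//.
- by move=> s; exact: measurable_hcube.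
- exact: uniq_words.
- exact: trivIset_cell.
- exact: measurable_funTS.
Qed.

Lemma integral_preimage_words k (f : E -> \bar R) : measurable_fun [set: L] f ->
  (forall x, 0 <= f x)%E ->
  (\int[mu]_(x in phi @^-1` hcube a l) f x = \sum_(s <- @words n k) \int[mu]_(x in V s) f x)%E.
Proof.
move=> mf f0; rewrite (preimage_hcube_words k).
rewrite (@ge0_integral_bigsetU _ L R mu _ V f (@words n k))//.
- exact: measurable_pcell.
- exact: uniq_words.
- exact: trivIset_pcell.
- exact: measurable_funTS.
Qed.

End fixed_cube.

Lemma pcell_cat a l w s : pcell a l (w ++ s) = pcell (wcorner a l s) (wside l s) w.
Proof. by rewrite /pcell cell_cat. Qed.

Lemma pvol_cat a l w s : pvol a l (w ++ s) = pvol (wcorner a l s) (wside l s) w.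
Proof. by rewrite /pvol pcell_cat. Qed.

End cell_volumes.

Global Opaque pvol powR enorm volume.

(** * Oscillation sums *)

Section ereal_helpers.
Context {R : realType}.
Local Open Scope ereal_scope.

Lemma nneseries_le_bound (f : nat -> \bar R) (M : \bar R) :
  (forall k, 0 <= f k) -> (forall m, \sum_(0 <= k < m) f k <= M) -> \sum_(k <oo) f k <= M.
Proof.
move=> f0 fM; apply: lime_le; first by apply: is_cvg_nneseries => k _ _.
by apply: nearW => m; exact: fM.
Qed.

Lemma poweR_half_le (x : \bar R) (M : R) : 0 <= x -> (0 <= M)%R ->
  (x `^ 2^-1 <= M%:E) = (x <= (M ^+ 2)%:E).
Proof.
move=> x0 M0; case: x x0 => [x x0|_|//]; last by rewrite poweRyr ?invr_eq0 ?pnatr_eq0// !leye_eq.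
rewrite poweR_EFin !lee_fin powR12_sqrt//.
by rewrite -[in RHS](sqr_sqrtr x0) ler_sqr ?nnegrE ?sqrtr_ge0.
Qed.

(** Each summand is at most [th] times the next one, so the last summand before [P] fails dominates
    the whole sum. *)
Lemma sum_if_chain (P : nat -> bool) (c : nat -> R) (th B : R) (m : nat) :
  (0 <= th < 1 -> (forall k, P k.+1 -> P k) -> (forall k, P k -> 0 <= c k <= B) -> 0 <= B ->
  (forall k, P k.+1 -> c k <= th * c k.+1) ->
  \sum_(0 <= k < m) (if P k then c k else 0) <= B / (1 - th))%R.
Proof.
move=> /andP[th0 th1] Pd cB B0 cth.
have d0 : (0 < 1 - th)%R by rewrite subr_gt0.
have B1 : (0 <= B / (1 - th))%R by rewrite divr_ge0// ltW.
case: m => [|m]; first by rewrite big_nil.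
suff : (\sum_(0 <= k < m.+1) (if P k then c k else 0) <=
    (if P m then c m else B) / (1 - th))%R.
  move=> /le_trans; apply; case: ifP => // /cB/andP[_ cmB].
  by rewrite ler_pM2r// invr_gt0.
elim: m => [|m IH].
  rewrite big_nat1; case: ifP => // P0; have /andP[c0 _] := cB _ P0.
  by rewrite ler_pdivlMr//; nra.
rewrite big_nat_recr//=; case: ifP => [PS|PS].
  move: IH; rewrite (Pd _ PS) => IH.
  have := cth _ PS; have /andP[c0 _] := cB _ PS.
  move=> cc; apply: (@le_trans _ _ (c m / (1 - th) + c m.+1)%R); first by rewrite lerD2r.
  rewrite ler_pdivlMr// mulrDl divfK ?gt_eqF//; nra.
rewrite addr0; apply: le_trans IH _; case: ifP => // /cB/andP[_ cmB].
by rewrite ler_pM2r// invr_gt0.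
Qed.

End ereal_helpers.

Section energy.
Context {R : realType} {n : nat}.
Hypothesis n_gt0 : (0 < n)%N.
Local Notation E := 'rV[R]_n.
Local Notation L := (caratheodory_type (@lebesgue_outer_rV R n)).
Local Notation mu := (@lebesgue_rV R n).
Local Notation word := (seq {ffun 'I_n -> bool}).
Variable alpha : R.
Hypothesis alpha_gt0 : 0 < alpha.

Definition Qbeta : R := 1 - 2 * alpha / n%:R.
Definition Qexp : R := n%:R + 2 * alpha.
Definition Qker (f : E -> R) (z : L * L) : \bar R :=
  (`|f z.1 - f z.2| ^+ 2 / enorm ((z.1 : E) - (z.2 : E)) `^ Qexp)%:E.
Definition Qenergy (f : E -> R) (A : set E) : \bar R :=
  (\int[mu]_(y in A) \int[mu]_(x in A) Qker f (x, y))%E.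

Lemma Qker_ge0 f z : (0 <= Qker f z)%E.
Proof. by rewrite lee_fin divr_ge0// ?exprn_ge0// powR_ge0. Qed.

Lemma Qenergy_ge0 f A : (0 <= Qenergy f A)%E.
Proof. by apply: integral_ge0 => y _; apply: integral_ge0 => x _; exact: Qker_ge0. Qed.

(** Rewrites the exponent of the kernel as n times 2 - beta, so that powers of distances become
    powers of volumes. *)
Lemma QbetaE : n%:R * (1 + (1 - Qbeta)) = Qexp.
Proof. by rewrite /Qbeta /Qexp; field; rewrite pnatr_eq0 -lt0n. Qed.

Let volE (Q : @cube R n) : volume (cube_set Q) `^ (2 * alpha / n%:R - 1) = ((side Q ^+ n) `^ Qbeta)^-1.
Proof. by rewrite volume_cube -powRN /Qbeta opprB. Qed.

Let sQ0 (Q : @cube R n) : 0 < (side Q ^+ n) `^ Qbeta.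
Proof. by rewrite powR_gt0// exprn_gt0// side_gt0. Qed.

Lemma Qnorm_ge0 (f : E -> R) : (0 <= Qnorm alpha f)%E.
Proof.
by apply: le_ereal_sup_tmp; eexists; [exists (Cube (0 : E) ltr01 true true) => //|exact: poweR_ge0].
Qed.

Lemma Qenergy_le f (Q : @cube R n) (N : R) : (Qnorm alpha f <= N%:E)%E -> 0 <= N ->
  (Qenergy f (cube_set Q) <= ((side Q ^+ n) `^ Qbeta * N ^+ 2)%:E)%E.
Proof.
move=> H N0; have : (((volume (cube_set Q) `^ (2 * alpha / n%:R - 1))%:E * Qenergy f (cube_set Q)) `^ 2^-1 <= N%:E)%E.
  by apply: le_trans H; apply: ereal_sup_ubound; exists Q.
rewrite volE poweR_half_le//; last first.
  by rewrite mule_ge0 ?Qenergy_ge0// lee_fin invr_ge0 ltW.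
by rewrite lee_pdivrMl ?EFinM// lee_pdivrMl.
Qed.

Lemma Qnorm_le f (N : R) : 0 <= N ->
  (forall Q : @cube R n, Qenergy f (cube_set Q) <= ((side Q ^+ n) `^ Qbeta * N ^+ 2)%:E)%E ->
  (Qnorm alpha f <= N%:E)%E.
Proof.
move=> N0 H; apply: ge_ereal_sup => _ [Q _ <-].
rewrite volE [leLHS](_ : _ = ((((side Q ^+ n) `^ Qbeta)^-1)%:E * Qenergy f (cube_set Q)) `^ 2^-1)%E//.
rewrite poweR_half_le//; last by rewrite mule_ge0 ?Qenergy_ge0// lee_fin invr_ge0 ltW.
by rewrite lee_pdivrMl// -EFinM.
Qed.

End energy.

Section oscillation.
Context d (T : measurableType d) (R : realType) (m : {sigma_finite_measure set T -> \bar R}).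
Variable f : T -> R.
Hypothesis mf : measurable_fun setT f.
Local Open Scope ereal_scope.

Definition sq_diff (z : T * T) : \bar R := (`|f z.1 - f z.2| ^+ 2)%:E.

Lemma measurable_sq_diff : measurable_fun setT sq_diff.
Proof.
apply/measurable_EFinP; apply: measurable_funX; apply: measurableT_comp => //.
apply: measurable_funB.
  exact: (measurableT_comp mf measurable_fst).
exact: (measurableT_comp mf measurable_snd).
Qed.

Lemma sq_diff_ge0 z : 0 <= sq_diff z.
Proof. by rewrite lee_fin exprn_ge0. Qed.

Definition osc_energy (A : set T) : \bar R := \int[m \x m]_(z in A `*` A) sq_diff z.

Lemma osc_energy_ge0 A : 0 <= osc_energy A.
Proof. by apply: integral_ge0 => z _; exact: sq_diff_ge0. Qed.

Lemma le_osc_energy A B : measurable A -> measurable B -> A `<=` B -> osc_energy A <= osc_energy B.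
Proof.
move=> mA mB AB; apply: ge0_subset_integral => //.
- exact: measurableX.
- exact: measurableX.
- by apply: measurable_funTS; exact: measurable_sq_diff.
- by move=> z _; exact: sq_diff_ge0.
- by move=> z [/AB ? /AB ?].
Qed.

(** By Tonelli the weighted sum of oscillations is a single double integral, whose kernel adds up
    the coefficients of the sets containing both points. *)
Lemma sum_osc_energy_le (I : eqType) (ws : nat -> seq I) (V : I -> set T) (c : I -> R)
    (D : set T) (Kr : T * T -> \bar R) :
  (forall s, measurable (V s)) -> (forall s, V s `<=` D) -> measurable D ->
  (forall s, 0 <= c s)%R -> measurable_fun setT Kr -> (forall z, 0 <= Kr z) ->
  (forall u w, D u -> D w ->
    \sum_(k <oo) \sum_(s <- ws k) (c s * \1_(V s) u * \1_(V s) w)%:E * sq_diff (u, w) <= Kr (u, w)) ->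
  \sum_(k <oo) \sum_(s <- ws k) (c s)%:E * osc_energy (V s) <=
  \int[m \x m]_(z in D `*` D) Kr z.
Proof.
move=> mV VD mD c0 mK K0 H.
pose h s z := (c s * \1_(V s) z.1 * \1_(V s) z.2)%:E * sq_diff z.
have h_ge0 s z : 0 <= h s z.
  by rewrite mule_ge0 ?sq_diff_ge0// lee_fin !mulr_ge0// indicE ler0n.
have mh s : measurable_fun setT (h s).
  apply: emeasurable_funM; last exact: measurable_sq_diff.
  apply/measurable_EFinP; apply: measurable_funM.
    apply: measurable_funM => //; apply: (measurableT_comp _ measurable_fst).
    exact: measurable_indic.
  apply: (measurableT_comp _ measurable_snd); exact: measurable_indic.
have mDD : measurable (D `*` D) by exact: measurableX.
have hE s : (c s)%:E * osc_energy (V s) = \int[m \x m]_(z in D `*` D) h s z.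
  rewrite /osc_energy -ge0_integralZl_EFin//; last 3 first.
  - exact: measurableX.
  - by move=> z _; exact: sq_diff_ge0.
  - by apply: measurable_funTS; exact: measurable_sq_diff.
  rewrite [LHS]integral_mkcond [RHS]integral_mkcond; apply: eq_integral => -[u w] _.
  rewrite /patch /h /=; case: ifPn => [|uw].
    rewrite inE /= => -[Vu Vw].
    rewrite ifT; last by rewrite inE; split; apply: VD; eassumption.
    by rewrite !indicE !mem_set// !mulr1.
  case: ifPn => // _; move: uw; rewrite in_setX /= negb_and => /orP[] uw.
    by rewrite !indicE (negbTE uw) mulr0 mul0r mul0e.
  by rewrite !indicE (negbTE uw) mulr0 mul0e.
under eq_eseriesr => k _ do under eq_bigr => s _ do rewrite hE.
have mh' s : measurable_fun (D `*` D) (h s) by exact: measurable_funTS.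
under eq_eseriesr => k _ do rewrite -ge0_integral_sum//.
rewrite -integral_nneseries//; last 2 first.
- by move=> k; apply: emeasurable_sum.
- by move=> k z _; apply: sume_ge0.
apply: ge0_le_integral => //.
- by move=> z _; apply: nneseries_ge0 => k _ _; apply: sume_ge0.
- apply: (@ge0_emeasurable_sum _ _ _ _ _ xpredT) => [k z _ _|k _].
    by apply: sume_ge0.
  by apply: emeasurable_sum.
- exact: measurable_funTS.
- by move=> [u w] [/= Du Dw]; exact: H.
Qed.

Lemma sum_osc_energy_le_iterated (I : eqType) (ws : nat -> seq I) (V : I -> set T) (c : I -> R)
    (D P : set T) (Kr : T * T -> \bar R) (C : R) :
  (forall s, measurable (V s)) -> (forall s, V s `<=` D) -> measurable D ->
  measurable P -> D `<=` P -> (0 <= C)%R ->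
  (forall s, 0 <= c s)%R -> measurable_fun setT Kr -> (forall z, 0 <= Kr z) ->
  (forall u w, D u -> D w ->
    \sum_(k <oo) \sum_(s <- ws k) (c s * \1_(V s) u * \1_(V s) w)%:E * sq_diff (u, w)
      <= C%:E * Kr (u, w)) ->
  \sum_(k <oo) \sum_(s <- ws k) (c s)%:E * osc_energy (V s) <=
  C%:E * \int[m]_(w in P) \int[m]_(u in P) Kr (u, w).
Proof.
move=> mV VD mD mP DP C0 c0 mK K0 H.
have CK z : 0 <= C%:E * Kr z by rewrite mule_ge0// lee_fin.
have S := sum_osc_energy_le mV VD mD c0 (measurable_funeM C%:E mK) CK H.
apply: le_trans S _.
rewrite (iterated_integral_prod m mP mP mK K0) ge0_integralZl_EFin//; last 2 first.
- exact: measurableX.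
- exact: measurable_funTS.
rewrite lee_wpmul2l ?lee_fin//; apply: ge0_subset_integral => //.
- exact: measurableX.
- exact: measurableX.
- exact: measurable_funTS.
- by move=> z [/DP ? /DP ?].
Qed.

Lemma osc_energy_iterated A : measurable A ->
  osc_energy A = \int[m]_(w in A) \int[m]_(u in A) (`|f u - f w| ^+ 2)%:E.
Proof.
move=> mA; rewrite /osc_energy -(iterated_integral_prod m mA mA)//.
  exact: measurable_sq_diff.
exact: sq_diff_ge0.
Qed.

(* A value of [f] at a suitable point replaces the mean value. *)
Lemma osc_energy_center (A : set T) (v : R) : measurable A -> m A = v%:E -> (0 < v)%R ->
  osc_energy A < +oo ->
  exists c : R, v%:E * \int[m]_(u in A) (`|f u - c| ^+ 2)%:E <= 2%:E * osc_energy A.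
Proof.
move=> mA Av v0 fin.
pose H w := \int[m]_(u in A) (`|f u - f w| ^+ 2)%:E.
have H0 w : 0 <= H w by apply: integral_ge0 => u _; rewrite lee_fin exprn_ge0.
have mH : measurable_fun setT H.
  pose F := (fun z : T * T => (\1_A z.1)%:E * sq_diff z).
  have mF : measurable_fun setT F.
    apply: emeasurable_funM; last exact: measurable_sq_diff.
    by apply/measurable_EFinP; apply: (measurableT_comp _ measurable_fst); exact: measurable_indic.
  have := measurable_fun_fubini_tonelli_G (m1 := m) F mF.
  rewrite (_ : fubini_G m F = H); last first.
    apply/funext => w; rewrite /fubini_G /H [RHS]integral_mkcond.
    apply: eq_integral => u _; rewrite /F /patch /= indicE.
    by case: ifPn => uA; rewrite /= ?mul1e ?mul0e.
  by apply; move=> z; rewrite mule_ge0 ?sq_diff_ge0// lee_fin indicE.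
have HA : measurable_fun A H by exact: measurable_funTS.
have oscE : osc_energy A = \int[m]_(w in A) H w by exact: osc_energy_iterated.
apply: contrapT => /forallNP nc.
have nH w : 2%:E * osc_energy A < v%:E * H w by rewrite ltNge; apply/negP; exact: nc.
(* Averaging contradicts the factor 2 only for a positive energy. If the energy vanishes, [H]
   vanishes almost everywhere on [A], hence somewhere, as [A] has positive measure. *)
have [z0|z0] := eqVneq (osc_energy A) 0.
  have : \int[m]_(w in A) `|H w| = 0.
    by rewrite -{}z0 oscE; apply: eq_integral => w _; rewrite gee0_abs.
  move/(ae_eq_integral_abs m mA HA) => [N [mN N0 AN]].
  have : m A <= m N.
    apply: le_measure; rewrite ?inE// => w Aw; apply: AN => /(_ Aw) /= Hw.
    by have := nH w; rewrite z0 mule0 Hw mule0 ltxx.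
  by rewrite Av N0 leNgt lte_fin v0.
have o_fin : osc_energy A \is a fin_num by rewrite ge0_fin_numE// osc_energy_ge0.
have : 2%:E * osc_energy A * v%:E <= v%:E * osc_energy A.
  have -> : v%:E * osc_energy A = \int[m]_(w in A) (v%:E * H w).
    by rewrite ge0_integralZl_EFin// ?(ltW v0)// oscE.
  have -> : 2%:E * osc_energy A * v%:E = \int[m]_(w in A) cst (2%:E * osc_energy A) w.
    by rewrite -Av; apply/esym; exact: (integral_cst m mA).
  apply: ge0_le_integral => //.
  - by move=> w _; rewrite mule_ge0 ?osc_energy_ge0 ?lee_fin.
  - by apply: measurable_funeM.
  - by move=> w _; exact/ltW.
have : 0 < osc_energy A by rewrite lt0e z0 osc_energy_ge0.
rewrite -(fineK o_fin) lte_fin => op; rewrite -!EFinM lee_fin leNgt => /negP; apply.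
by nra.
Qed.

Lemma measurable_sq_dist (x : R) A : measurable_fun A (fun u => (`|f u - x| ^+ 2)%:E).
Proof.
apply: measurable_funTS; apply/measurable_EFinP; apply: measurable_funX.
by apply: measurableT_comp => //; exact: measurable_funB.
Qed.

Lemma centers_dist (A B : set T) (v cA cB a b : R) : measurable A -> measurable B -> B `<=` A ->
  m B = v%:E ->
  \int[m]_(u in A) (`|f u - cA| ^+ 2)%:E <= a%:E ->
  \int[m]_(u in B) (`|f u - cB| ^+ 2)%:E <= b%:E ->
  (`|cB - cA| ^+ 2 * v <= 2 * (b + a))%R.
Proof.
move=> mA mB BA Bv Aa Bb; rewrite -lee_fin.
have p0 (x : R) (u : T) : 0 <= (`|f u - x| ^+ 2)%:E by rewrite lee_fin exprn_ge0.
have ms := measurable_sq_dist.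
apply: (@le_trans _ _ (2%:E * (\int[m]_(u in B) (`|f u - cB| ^+ 2)%:E +
    \int[m]_(u in B) (`|f u - cA| ^+ 2)%:E))); last first.
  rewrite (_ : (2 * (b + a))%:E = 2%:E * (b%:E + a%:E)) //.
  apply: lee_wpmul2l => //; apply: (leeD Bb); apply: le_trans Aa.
  by apply: ge0_subset_integral => //; exact: ms.
rewrite -ge0_integralD// -ge0_integralZl_EFin//; last 2 first.
- by move=> u _; rewrite adde_ge0.
- by apply: emeasurable_funD.
rewrite EFinM -Bv -(integral_cst m mB).
apply: ge0_le_integral => //.
- by move=> u _; rewrite lee_fin exprn_ge0.
- by apply: measurable_funeM; apply: emeasurable_funD.
- move=> u _; rewrite -EFinD -EFinM lee_fin -!normrX !ger0_norm ?sqr_ge0//.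
  have := sqr_ge0 ((f u - cB) + (f u - cA)); nra.
Qed.

(** The sum of the squared errors is integrable, hence finite off a null set, and where it is finite
    its terms tend to 0. *)
Lemma summable_sq_diff_cvg (D : set T) (c : nat -> T -> R) : measurable D ->
  (forall k, measurable_fun setT (c k)) ->
  \sum_(k <oo) \int[m]_(u in D) (`|f u - c k u| ^+ 2)%:E < +oo ->
  exists N, [/\ measurable N, m N = 0 & forall u, D u -> ~ N u -> c k u @[k --> \oo] --> f u].
Proof.
move=> mD mc fin.
pose h k u := (`|f u - c k u| ^+ 2)%:E.
have h0 k u : 0 <= h k u by rewrite lee_fin exprn_ge0.
have mh k : measurable_fun D (h k).
  apply: measurable_funTS; apply/measurable_EFinP; apply: measurable_funX.
  by apply: measurableT_comp => //; exact: measurable_funB.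
pose S u := \sum_(k <oo) h k u.
have mS : measurable_fun D S by apply: (@ge0_emeasurable_sum _ _ _ _ _ xpredT).
have S0 u : 0 <= S u by apply: nneseries_ge0.
have iS : m.-integrable D S.
  apply/integrableP; split => //; under eq_integral => u _ do rewrite gee0_abs//.
  by rewrite integral_nneseries.
have [N [mN N0 DN]] := integrable_ae mD iS.
exists N; split => // u Du Nu.
have Sfin : S u \is a fin_num.
  by apply: contrapT => H; apply: Nu; apply: DN => /(_ Du).
pose r k : R := (`|f u - c k u| ^+ 2)%R.
have r0 k : (0 <= r k)%R by rewrite exprn_ge0.
have cr : cvgn (series r).
  apply: nondecreasing_is_cvgn.
    by apply/nondecreasing_seqP => k; rewrite -subr_ge0 seriesSB.
  exists (fine (S u)) => _ [k _ <-]; rewrite -lee_fin fineK// /series /= -sumEFin.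
  by apply: nneseries_lim_ge => j _ _; exact: h0.
have /cvgr0Pnorm_lt rc := cvg_series_cvg_0 cr.
apply/cvgrPdist_lt => e e0; have e20 : (0 < e ^+ 2)%R by rewrite exprn_gt0.
near=> k; have : (`|r k| < e ^+ 2)%R by near: k; exact: rc.
by rewrite ger0_norm// /r ltr_sqr// nnegrE ltW.
Unshelve. all: by end_near. Qed.

End oscillation.

(** * Oscillations below a cell, bounded by the energy of one cube *)

Section tree_energy.
Context {R : realType} {n : nat}.
Hypothesis n_gt0 : (0 < n)%N.
Local Notation E := 'rV[R]_n.
Local Notation L := (caratheodory_type (@lebesgue_outer_rV R n)).
Local Notation mu := (@lebesgue_rV R n).
Local Notation word := (seq {ffun 'I_n -> bool}).
Variable alpha : R.
Hypotheses (alpha_gt0 : 0 < alpha) (alpha_lt : alpha < n%:R / 2).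
Variables (up dn : R -> R) (phi psi : E -> E).
Hypotheses (updn : distortion up dn) (pK : cancel phi psi) (Kp : cancel psi phi)
  (cphi : continuous phi) (cpsi : ratio_control up dn psi).
Variable (f : E -> R).
Hypothesis mf : measurable_fun [set: L] f.

Local Notation beta := (@Qbeta R n alpha).
Local Notation p := (@Qexp R n alpha).
Local Notation g := (1 + (1 - beta)).

Lemma Qbeta_gt0 : 0 < beta.
Proof.
rewrite subr_gt0 ltr_pdivrMr ?ltr0n// mul1r mulrC -ltr_pdivlMr//.
Qed.

Lemma Qbeta_lt1 : beta < 1.
Proof. by rewrite gtrBl divr_gt0 ?mulr_gt0 ?ltr0n. Qed.

Let g0 : 0 < g. Proof. by have := Qbeta_lt1; lra. Qed.

Definition shrink := 1 - (@doubling_const R n up 4)^-1.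
Definition diam_const := (up 1 ^+ 2) ^+ n.

Lemma diam_const_gt0 : 0 < diam_const.
Proof. by rewrite !exprn_gt0// updn.1. Qed.

Lemma shrink_bounds : 0 < shrink < 1.
Proof.
have d0 := @doubling_const_gt0 R n up dn updn 4 (ltr0n R 4).
apply/andP; split; last by rewrite gtrBl invr_gt0.
have := pvol_child n_gt0 updn pK Kp cphi cpsi (0 : E) ltr01 [ffun=> true] [::].
have := pvol_gt0 n_gt0 updn pK Kp cpsi (0 : E) ltr01 [:: [ffun=> true]].
have := pvol_gt0 n_gt0 updn pK Kp cpsi (0 : E) ltr01 [::].
by rewrite -/shrink => v0 v1 /(lt_le_trans v1); rewrite pmulr_lgt0.
Qed.

Definition kernel_const := Num.sqrt n%:R `^ p * diam_const `^ g / (1 - shrink `^ g).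

Let th0 : 0 <= shrink `^ g < 1.
Proof.
have /andP[s0 s1] := shrink_bounds; rewrite powR_ge0/=.
have g1 : 1 `^ g = 1 :> R by rewrite powR1.
rewrite -[ltRHS]g1.
by apply: gt0_ltr_powR; rewrite ?nnegrE ?ler01 ?(ltW s0) ?g0.
Qed.

Lemma kernel_const_ge0 : 0 <= kernel_const.
Proof.
rewrite !mulr_ge0 ?powR_ge0// invr_ge0 subr_ge0 ltW//; by case/andP: th0.
Qed.

Section one_cube.
Variables (a : E) (l : R).
Hypothesis l0 : 0 < l.
Local Notation V := (pcell phi a l).
Local Notation v := (pvol phi a l).

Let v0 (s : word) : 0 < v s. Proof. exact: (pvol_gt0 n_gt0 updn pK Kp cpsi a l0 s). Qed.

(** Every cell whose preimage contains [u] and [w] has [v] at least a multiple of [|u - w| ^+ n], by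
    [pvol_diam]; along the chain of common cells the volumes decrease geometrically, so the smallest
    common cell governs the sum. *)
Lemma kernel_sum (u w : E) (m : nat) : u != w -> V [::] u -> V [::] w ->
  \sum_(0 <= k < m) (if wcode a l k (phi u) == wcode a l k (phi w)
     then (v (wcode a l k (phi u)) `^ g)^-1 else 0) <=
  kernel_const * (enorm (u - w) `^ p)^-1.
Proof.
rewrite /pcell /= !cell_nil => uw Vu Vw.
pose B := Num.sqrt n%:R `^ p * diam_const `^ g * (enorm (u - w) `^ p)^-1.
rewrite (_ : kernel_const * _ = B / (1 - shrink `^ g)); last by rewrite /B /kernel_const mulrAC.
have uw0 : 0 < enorm (u - w) by apply: lt_le_trans (enorm_ge _); rewrite normr_gt0 subr_eq0.
apply: (sum_if_chain (c := fun k => (v (wcode a l k (phi u)) `^ g)^-1)).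
- exact: th0.
- by move=> k /=; rewrite eqseq_cons => /andP[].
- move=> k /eqP uwk; rewrite invr_ge0 powR_ge0/=.
  rewrite /B ler_pdivlMr ?powR_gt0// mulrC ler_pdivrMr ?powR_gt0//.
  have su : V (wcode a l k (phi u)) u by exact: cell_code.
  have sw : V (wcode a l k (phi u)) w by rewrite uwk; exact: cell_code.
  have := pvol_diam n_gt0 updn pK Kp cpsi l0 su sw; set vv := v _ => H.
  apply: (@le_trans _ _ ((Num.sqrt n%:R * `|u - w|) `^ p)).
    by rewrite ge0_ler_powR ?enorm_le ?nnegrE ?mulr_ge0 ?sqrtr_ge0// addr_ge0// mulr_ge0// ltW.
  rewrite powRM ?sqrtr_ge0// -mulrA ler_wpM2l ?powR_ge0// -powRM//; last 2 first.
  + exact/ltW/diam_const_gt0.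
  + exact/ltW/v0.
  rewrite -(QbetaE n_gt0) powRrM powR_mulrn//.
  rewrite ge0_ler_powR// ?nnegrE ?exprn_ge0// ?(ltW g0)//.
  by rewrite mulr_ge0 ?(ltW diam_const_gt0)// ltW// v0.
- by rewrite /B !mulr_ge0 ?powR_ge0// invr_ge0 powR_ge0.
- move=> k _ /=; have := pvol_child n_gt0 updn pK Kp cphi cpsi a l0; set e := finfun _.
  move=> /(_ e (wcode a l k (phi u))); rewrite -/shrink => H.
  rewrite -ler_pdivrMl; last by rewrite powR_gt0; case/andP: shrink_bounds.
  rewrite -invfM -powRM; [|by case/andP: shrink_bounds => /ltW|exact/ltW/v0].
  by apply: powR_inv_le => //; exact: ltW.
Qed.

Local Notation O s := (@osc_energy _ L R mu f (V s)).

Lemma sum_words_pick (G : word -> R) (k : nat) (u w : E) : V [::] u -> V [::] w ->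
  \sum_(s <- @words n k) G s * \1_(V s) u * \1_(V s) w =
   if wcode a l k (phi u) == wcode a l k (phi w) then G (wcode a l k (phi u)) else 0.
Proof.
rewrite /pcell /= cell_nil => Vu aw.
have ku : wcode a l k (phi u) \in @words n k by exact: code_words.
rewrite (bigD1_seq (wcode a l k (phi u)))//=; last exact: uniq_words.
rewrite big_seq_cond big1 ?addr0; last first.
  move=> s /andP[sk su]; rewrite indicE memNset ?mulr0 ?mul0r//= => us.
  move: su; rewrite -{1}(code_cell l0 us); move: sk; rewrite mem_words => /eqP ->.
  by rewrite eqxx.
rewrite !indicE mem_set; last exact: cell_code.
rewrite mulr1; case: ifPn => [/eqP uw|uw].
  by rewrite mem_set ?mulr1//= uw; exact: cell_code.
rewrite memNset ?mulr0//= => wu; move: uw.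
by rewrite -(code_cell l0 wu) size_code eqxx.
Qed.

(** Integrating [kernel_sum] over pairs controls the oscillations at all scales below the root by
    the energy on one cube around [V [::]]. The power of [v [::]] is the normalisation of the norm
    on that cube. *)
Lemma osc_sum_Qnorm (N : R) : 0 <= N -> (Qnorm alpha f <= N%:E)%E ->
 (\sum_(k <oo) \sum_(s <- @words n k) ((v s `^ g)^-1)%:E * O s
  <= (kernel_const * diam_const `^ beta * v [::] `^ beta * N ^+ 2)%:E)%E.
Proof.
move=> N0 fN.
have [Q [VQ QV]] := pcell_sub_cube n_gt0 updn pK Kp cpsi a l0 [::].
apply: (@le_trans _ _ (kernel_const%:E * Qenergy alpha f (cube_set Q))%E).
  apply: (@sum_osc_energy_le_iterated _ L R mu f mf _ (@words n) V
     (fun s => (v s `^ g)^-1) (V [::]) (cube_set Q) (Qker alpha f) kernel_const).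
  - by move=> s; exact: measurable_pcell.
  - by move=> s; rewrite -{1}(cats0 s); exact: pcell_sub.
  - exact: measurable_pcell.
  - exact: measurable_cube_set.
  - exact: VQ.
  - exact: kernel_const_ge0.
  - by move=> s; rewrite invr_ge0 powR_ge0.
  - exact: measurable_Qkernel.
  - by move=> z; exact: Qker_ge0.
  move=> u w Vu Vw.
  have [->|uw] := eqVneq u w.
    rewrite [leLHS](_ : _ = 0%E).
      by apply: mule_ge0; [rewrite lee_fin kernel_const_ge0|exact: Qker_ge0].
    rewrite eseries0// => k _ _; rewrite big1// => s _.
    by rewrite /sq_diff subrr normr0 expr0n mule0.
  apply: nneseries_le_bound => [k|m].
    apply: sume_ge0 => s _; rewrite mule_ge0 ?sq_diff_ge0// lee_fin.
    by rewrite !mulr_ge0 ?indicE ?ler0n// invr_ge0 powR_ge0.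
  rewrite /sq_diff; under eq_bigr => k _.
    under eq_bigr => s _ do rewrite -EFinM.
    rewrite sumEFin -mulr_suml sum_words_pick//; over.
  rewrite sumEFin -mulr_suml /Qker -EFinM lee_fin /=.
  by rewrite [leRHS]mulrCA [leLHS]mulrC ler_wpM2l ?exprn_ge0// kernel_sum.
have H := Qenergy_le Q fN N0.
rewrite (_ : _ * N ^+ 2 = kernel_const * ((diam_const * v [::]) `^ beta * N ^+ 2)); last first.
  rewrite powRM; [by ring|exact/ltW/diam_const_gt0|exact/ltW/v0].
rewrite [leRHS]EFinM; apply: lee_wpmul2l; first by rewrite lee_fin kernel_const_ge0.
apply: le_trans H _; rewrite lee_fin ler_wpM2r ?exprn_ge0//.
apply: ge0_ler_powR; rewrite ?nnegrE ?exprn_ge0 ?(ltW Qbeta_gt0) ?(ltW (side_gt0 Q))//.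
by rewrite mulr_ge0 ?(ltW diam_const_gt0) ?(ltW (v0 _)).
Qed.

End one_cube.
End tree_energy.

Section powR_helpers.
Context {R : realType}.

Lemma powRV (x r : R) : 0 < x -> x^-1 `^ r = (x `^ r)^-1.
Proof.
move=> x0; apply: (mulfI (lt0r_neq0 (powR_gt0 r x0))).
by rewrite -powRM ?invr_ge0 ?(ltW x0)// !divff ?powR1// gt_eqF// powR_gt0.
Qed.

Lemma powR_div (x y r : R) : 0 <= x -> 0 < y -> (x / y) `^ r = x `^ r / y `^ r.
Proof. by move=> x0 y0; rewrite powRM ?invr_ge0 ?(ltW y0)// powRV. Qed.
End powR_helpers.

(** * Sums over the tree of words *)

Section word_sums.
Context {R : realType} {n : nat}.
Local Notation word := (seq {ffun 'I_n -> bool}).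
Local Open Scope ereal_scope.

Definition wsum (F : word -> \bar R) : \bar R := \sum_(k <oo) \sum_(s <- @words n k) F s.

Lemma wsum_esum (F : word -> \bar R) : (forall s, 0 <= F s) -> wsum F = \esum_(s in setT) F s.
Proof.
move=> F0; rewrite /wsum.
pose J k : set word := [set s | size s = k].
have -> : [set: word] = \bigcup_(k in setT) J k.
  by apply/seteqP; split => // s _; exists (size s).
rewrite esum_bigcupT//; last first.
  by move=> i j _ _ [s [/= <- <-]].
rewrite nneseries_esumT; last by move=> k; apply: sume_ge0.
apply: eq_esum => k _.
have -> : J k = [set` @words n k].
  by apply/seteqP; split => s /=; rewrite mem_words => /eqP.
rewrite esum_fset//; last exact: finite_seq.
by rewrite fsbig_seq//; exact: uniq_words.
Qed.

Lemma wsum_ge0 (F : word -> \bar R) : (forall s, 0 <= F s) -> 0 <= wsum F.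
Proof. by move=> F0; apply: nneseries_ge0 => k _ _; apply: sume_ge0. Qed.

Lemma le_wsum (F G : word -> \bar R) : (forall s, 0 <= F s) -> (forall s, F s <= G s) ->
  wsum F <= wsum G.
Proof.
move=> F0 FG; apply: lee_nneseries => [k *|k *]; first exact: sume_ge0.
exact: lee_sum.
Qed.

Lemma eq_wsum (F G : word -> \bar R) : F =1 G -> wsum F = wsum G.
Proof. by move=> FG; apply: eq_eseriesr => k _; apply: eq_bigr => s _; exact: FG. Qed.

Lemma wsumZl (F : word -> \bar R) (c : R) : (0 <= c)%R -> (forall s, 0 <= F s) ->
  wsum (fun s => c%:E * F s) = c%:E * wsum F.
Proof.
move=> c0 F0; rewrite /wsum -nneseriesZl//; last by move=> k _; apply: sume_ge0.
by apply: eq_eseriesr => k _; rewrite ge0_sume_distrr.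
Qed.

Lemma wsum_ge_term (F : word -> \bar R) s : (forall s, 0 <= F s) -> F s <= wsum F.
Proof.
move=> F0; rewrite wsum_esum// (esumID [set s])//.
rewrite (_ : setT `&` [set s] = [set s]) ?setTI// esum_set1// leeDl//.
by apply: esum_ge0.
Qed.

(** A word with a marked ancestor [t] is [w ++ t] for exactly one [w]. *)
Lemma wsum_ancestors (F : word -> word -> \bar R) : (forall t s, 0 <= F t s) ->
  wsum (fun s => \sum_(0 <= i < (size s).+1) F (drop i s) s) =
  wsum (fun t => wsum (fun w => F t (w ++ t))).
Proof.
move=> F0; rewrite wsum_esum; last by move=> s; apply: sume_ge0.
rewrite [RHS]wsum_esum; last by move=> t; apply: wsum_ge0.
rewrite [RHS](eq_esum (b := fun t => \esum_(w in setT) F t (w ++ t))); last first.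
  by move=> t _; rewrite wsum_esum.
rewrite [LHS](eq_esum (b := fun s => \esum_(i in [set i | (i < (size s).+1)%N]) F (drop i s) s)); last first.
  move=> s _; rewrite (_ : [set i | _] = [set` index_iota 0 (size s).+1]); last first.
    by apply/seteqP; split => i /=; rewrite mem_index_iota.
  rewrite esum_fset; [|exact: finite_seq|by move=> i _; exact: F0].
  by rewrite (fsbig_seq _ _ (iota_uniq _ _)).
rewrite !esum_esum//.
pose e (x : word * word) : word * nat := (x.2 ++ x.1, size x.2).
rewrite (reindex_esum ([set: word] `*`` (fun=> [set: word])) _ e).
  by apply: eq_esum => -[t w] _ /=; rewrite drop_size_cat.
split.
- by move=> [t w] _ /=; split => //; rewrite size_cat ltnS leq_addr.
- move=> [t w] [t' w'] _ _ [] /eqP + sw.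
  by rewrite eqseq_cat// => /andP[/eqP -> /eqP ->].
- move=> [s i] [_ /= is_]; exists (drop i s, take i s) => //.
  by rewrite /e /= cat_take_drop size_takel.
Qed.

(** Here [m] stands for volumes of cells and [v] for those of their preimages. Multiplied by
    [m s ^ beta / v s ^ 2], the test inequality at [s] distributes the summand over the ancestors
    [t] with coefficients lam t (m t / v t)^beta v s^-g, because g + beta = 2. After the exchange of
    sums the bound for the subtree of [t] cancels [v t ^ beta], and the objective of the test family
    remains. *)
Lemma weighted_word_sum (v m : word -> R) (W : word -> \bar R) (beta g C : R)
    (lam : word -> R) (X : R) :
  (forall s, 0 < v s)%R -> (forall s, 0 < m s)%R -> (forall s, 0 <= W s) ->
  (g + beta = 2)%R ->
  (forall s, 0 <= lam s)%R ->
  (forall s, 1 <= \sum_(0 <= i < (size s).+1)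
     lam (drop i s) * (m (drop i s) / m s * (v s / v (drop i s))) `^ beta)%R ->
  wsum (fun s => (lam s * (m s / m [::]) `^ beta)%:E) <= X%:E ->
  (0 <= C)%R ->
  (forall t, wsum (fun w => ((v (w ++ t) `^ g)^-1)%:E * W (w ++ t)) <= (C * v t `^ beta)%:E) ->
  wsum (fun s => (m s `^ beta / v s ^+ 2)%:E * W s) <= (C * m [::] `^ beta * X)%:E.
Proof.
move=> v0 m0 W0 gb lam0 lam1 lamX C0 WC.
pose F (t s : word) : \bar R := ((lam t * m t `^ beta / v t `^ beta / v s `^ g)%:E * W s)%E.
have F0 t s : (0 <= F t s)%E.
  by rewrite mule_ge0// lee_fin !mulr_ge0 ?invr_ge0 ?powR_ge0.
apply: (@le_trans _ _ (wsum (fun s => \sum_(0 <= i < (size s).+1) F (drop i s) s))%E).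
  apply: le_wsum => s.
    by rewrite mule_ge0// lee_fin mulr_ge0 ?powR_ge0// invr_ge0 exprn_ge0// ltW.
  rewrite -ge0_sume_distrl; last by move=> i _; rewrite lee_fin !mulr_ge0 ?invr_ge0 ?powR_ge0.
  apply: lee_wpmul2r => //; rewrite sumEFin lee_fin.
  rewrite -[leLHS]mulr1; apply: le_trans (ler_wpM2l _ (lam1 s)) _.
    by rewrite mulr_ge0 ?powR_ge0// invr_ge0 exprn_ge0// ltW.
  rewrite mulr_sumr le_eqVlt; apply/orP; left; apply/eqP; apply: eq_bigr => i _.
  set t := drop i s.
  have vg : (v s ^+ 2 = v s `^ g * v s `^ beta)%R.
    rewrite -powRD; last by apply/implyP => _; rewrite gt_eqF.
    by rewrite gb powR_mulrn// ltW.
  rewrite vg powRM ?divr_ge0 ?(ltW (v0 _)) ?(ltW (m0 _))//.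
  rewrite !powR_div ?(ltW (v0 _)) ?(ltW (m0 _))//.
  have key (A B D M P c : R) : (A != 0 -> B != 0 -> D != 0 -> P != 0 ->
      A / (P * B) * (M * (c / A * (B / D))) = M * c / D / P)%R.
    by move=> A0 B0 D0 P0; field; rewrite A0 B0 D0 P0.
  by apply: key; rewrite gt_eqF// powR_gt0.
rewrite wsum_ancestors//.
apply: (@le_trans _ _ (wsum (fun t => (C * m [::] `^ beta)%:E * (lam t * (m t / m [::]) `^ beta)%:E))%E).
  apply: le_wsum => t; first exact: wsum_ge0.
  rewrite (eq_wsum (G := fun w => ((lam t * m t `^ beta / v t `^ beta)%:E *
     (((v (w ++ t) `^ g)^-1)%:E * W (w ++ t)))%E)); last by move=> w; rewrite /F EFinM muleA.
  rewrite wsumZl; last 2 first.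
  - by rewrite !mulr_ge0 ?invr_ge0 ?powR_ge0.
  - by move=> w; rewrite mule_ge0// lee_fin invr_ge0 powR_ge0.
  apply: le_trans (lee_wpmul2l _ (WC t)) _.
    by rewrite lee_fin !mulr_ge0 ?invr_ge0 ?powR_ge0.
  rewrite -!EFinM lee_fin powR_div ?(ltW (m0 _))//.
  rewrite le_eqVlt; apply/orP; left; apply/eqP.
  have key (A B M P K : R) : (B != 0 -> P != 0 ->
      M * A / B * (K * B) = K * P * (M * (A / P)))%R.
    by move=> B0 P0; field; rewrite B0 P0.
  by apply: key; rewrite gt_eqF// powR_gt0.
rewrite wsumZl; last 2 first.
- by rewrite mulr_ge0 ?powR_ge0.
- by move=> t; rewrite lee_fin mulr_ge0 ?powR_ge0.
rewrite [leRHS]EFinM lee_wpmul2l// lee_fin mulr_ge0 ?powR_ge0//.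
Qed.

End word_sums.

(** * Step functions on cells and majorants of their limits *)

Section step_functions.
Context d (T : measurableType d) (R : realType) (m : {measure set T -> \bar R}).
Context (I : eqType) (ws : seq I) (V : I -> set T).
Hypotheses (mV : forall s, measurable (V s)) (uws : uniq ws) (tV : trivIset [set` ws] V).
Local Open Scope ereal_scope.

Definition step (c : I -> R) (u : T) : R := (\sum_(s <- ws) c s * \1_(V s) u)%R.

Lemma stepE c s u : s \in ws -> V s u -> step c u = c s.
Proof.
move=> sw su; rewrite /step (bigD1_seq s)//= indicE mem_set// mulr1 big_seq_cond big1 ?addr0//.
move=> t /andP[tw ts]; rewrite indicE memNset ?mulr0// => tu.
by move: ts; rewrite (tV tw sw _) ?eqxx//; exists u.
Qed.

Lemma measurable_step c : measurable_fun setT (step c).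
Proof.
by apply: measurable_sum => s; apply: measurable_funM => //; exact: measurable_indic.
Qed.

Lemma step_ge0 c u : (forall s, 0 <= c s)%R -> (0 <= step c u)%R.
Proof. by move=> c0; apply: sumr_ge0 => s _; rewrite mulr_ge0// indicE ler0n. Qed.

Lemma integral_step c (D : set T) : (forall s, 0 <= c s)%R ->
  D = \big[setU/set0]_(s <- ws) V s ->
  \int[m]_(u in D) (step c u)%:E = \sum_(s <- ws) (c s)%:E * m (V s).
Proof.
move=> c0 ->; rewrite ge0_integral_bigsetU//; last 2 first.
- by apply: measurable_funTS; apply/measurable_EFinP; exact: measurable_step.
- by move=> u _; rewrite lee_fin step_ge0.
rewrite [LHS]big_seq_cond [RHS]big_seq_cond; apply: eq_bigr => s; rewrite andbT => sw.
rewrite -(integral_cst m (mV s)); apply: eq_integral => u; rewrite inE => su.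
by rewrite /= (stepE _ sw su).
Qed.

Lemma integral_step_sq (f : T -> R) c (D : set T) : measurable_fun setT f ->
  D = \big[setU/set0]_(s <- ws) V s ->
  \int[m]_(u in D) (`|f u - step c u| ^+ 2)%:E =
  \sum_(s <- ws) \int[m]_(u in V s) (`|f u - c s| ^+ 2)%:E.
Proof.
move=> mf ->; rewrite ge0_integral_bigsetU//; last first.
  apply: measurable_funTS; apply/measurable_EFinP; apply: measurable_funX.
  by apply: measurableT_comp => //; apply: measurable_funB => //; exact: measurable_step.
rewrite [LHS]big_seq_cond [RHS]big_seq_cond; apply: eq_bigr => s; rewrite andbT => sw.
by apply: eq_integral => u; rewrite inE => su; rewrite (stepE _ sw su).
Qed.
End step_functions.

Section chain_majorant.
Context {R : realType}.

(* Young's inequality with geometric weights, iterated along the chain. *)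
Lemma chain_sq_le (tau : R) (y : nat -> R) (i : nat) : 1 < tau ->
  (y i - y 0%N) ^+ 2 <= tau / (tau - 1) * \sum_(0 <= j < i) tau ^+ j * (y j.+1 - y j) ^+ 2.
Proof.
move=> t1; have d0 : 0 < tau - 1 by rewrite subr_gt0.
have t0 : 0 < tau by lra.
have A0 : 0 <= tau / (tau - 1) by rewrite divr_ge0// ltW.
elim: i y => [|i IH] y; first by rewrite big_nil subrr expr0n mulr0.
have := IH (fun j => y j.+1) => /= H.
rewrite big_nat_recl//= expr0 mul1r.
rewrite (eq_bigr (fun j => tau * (tau ^+ j * (y j.+2 - y j.+1) ^+ 2))); last first.
  by move=> j _; rewrite exprS mulrA.
rewrite -mulr_sumr mulrDr [X in _ <= _ + X]mulrCA.
set S := tau / (tau - 1) * (\sum_(_ <= _ < _) _) in H *.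
apply: (@le_trans _ _ (tau / (tau - 1) * (y 1%N - y 0%N) ^+ 2 + tau * (y i.+1 - y 1%N) ^+ 2)).
  set p := y 1%N - y 0%N; set q := y i.+1 - y 1%N.
  have -> : y i.+1 - y 0%N = p + q by rewrite /p /q; ring.
  rewrite -subr_ge0.
  have -> : tau / (tau - 1) * p ^+ 2 + tau * q ^+ 2 - (p + q) ^+ 2 =
     (p - (tau - 1) * q) ^+ 2 / (tau - 1) by field; rewrite gt_eqF.
  by rewrite divr_ge0 ?sqr_ge0// ltW.
by rewrite lerD2l ler_pM2l.
Qed.

Lemma sum_if_le (F : nat -> R) (i j : nat) : (forall k, 0 <= F k) ->
  \sum_(0 <= k < i) (if (k <= j)%N then F k else 0) <= \sum_(0 <= k < j.+1) F k.
Proof.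
move=> F0; have E q : (q <= j.+1)%N ->
    \sum_(0 <= k < q) (if (k <= j)%N then F k else 0) = \sum_(0 <= k < q) F k.
  move=> qj; apply: eq_big_nat => k /andP[_ kq].
  by rewrite ifT// -ltnS (leq_trans kq).
have [ij|ji] := leqP i j.+1.
  by rewrite E// (@big_cat_nat _ _ _ i 0 j.+1)//= lerDl sumr_ge0.
rewrite (@big_cat_nat _ _ _ j.+1)//=; last exact: ltnW.
rewrite E// [X in _ + X]big_nat_cond [X in _ + X]big1 ?addr0// => k /andP[/andP[jk _] _].
by rewrite ifF// leqNgt jk.
Qed.

Lemma geometric_sum_le (tau : R) (j : nat) : 1 < tau ->
  \sum_(0 <= k < j.+1) tau ^+ k <= tau / (tau - 1) * tau ^+ j.
Proof.
move=> t1; have d0 : 0 < tau - 1 by rewrite subr_gt0.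
elim: j => [|j IH]; first by rewrite big_nat1 expr0 mulr1 ler_pdivlMr//; lra.
rewrite big_nat_recr//=; apply: le_trans (lerD IH (lexx _)) _.
rewrite exprS le_eqVlt; apply/orP; left; apply/eqP; field; by rewrite gt_eqF.
Qed.

Context d (T : measurableType d) (m : {measure set T -> \bar R}).
Variables (M D : set T) (dd : nat -> T -> R) (tau C : R).
Hypotheses (mM : measurable M) (M0 : m M = 0%E) (mD : measurable D)
  (mdd : forall j, measurable_fun setT (dd j)) (dd0 : forall j x, 0 <= dd j x)
  (tau1 : 1 < tau) (C0 : 0 <= C).
Local Open Scope ereal_scope.

Definition majorant_sum (k : nat) (x : T) : \bar R :=
  \sum_(j <oo) (if (k <= j)%N then tau ^+ (j - k) * dd j x else 0)%:E.
(** The value +oo on the null set [M] makes the later pointwise estimates hold at every point, at no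
    cost in the integral. *)
Definition majorant (k : nat) (x : T) : \bar R :=
  C%:E * majorant_sum k x + (\1_M x)%:E * +oo.

Let t0 : (0 < tau)%R. Proof. exact: lt_trans tau1. Qed.

Let term_ge0 k j x : 0 <= (if (k <= j)%N then tau ^+ (j - k) * dd j x else 0)%:E.
Proof. by case: ifP => // _; rewrite lee_fin mulr_ge0// exprn_ge0// ltW. Qed.

Let mterm k j : measurable_fun setT (fun x => (if (k <= j)%N then tau ^+ (j - k) * dd j x else 0)%:E).
Proof.
by apply/measurable_EFinP; case: (k <= j)%N => //; apply: measurable_funM.
Qed.

Lemma majorant_sum_ge0 k x : 0 <= majorant_sum k x.
Proof. by apply: nneseries_ge0 => j _ _; exact: term_ge0. Qed.

Lemma measurable_majorant_sum k : measurable_fun setT (majorant_sum k).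
Proof. by apply: (@ge0_emeasurable_sum _ _ _ _ _ xpredT). Qed.

Lemma majorant_ge0 k x : 0 <= majorant k x.
Proof. by rewrite adde_ge0 ?mule_ge0 ?majorant_sum_ge0// lee_fin. Qed.

Let mMoo : measurable_fun setT (fun x => (\1_M x)%:E * (+oo : \bar R)).
Proof.
apply: emeasurable_funM => //; apply/measurable_EFinP; exact: measurable_indic.
Qed.

Lemma measurable_majorant k : measurable_fun setT (majorant k).
Proof.
by apply: emeasurable_funD => //; apply: measurable_funeM; exact: measurable_majorant_sum.
Qed.

Lemma integral_majorant k : \int[m]_(x in D) majorant k x = C%:E * \int[m]_(x in D) majorant_sum k x.
Proof.
rewrite ge0_integralD//; last 3 first.
- by move=> x _; rewrite mule_ge0 ?majorant_sum_ge0.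
- by apply: measurable_funTS; apply: measurable_funeM; exact: measurable_majorant_sum.
- exact: measurable_funTS.
rewrite ge0_integralZl_EFin//; last 2 first.
- by move=> x _; exact: majorant_sum_ge0.
- by apply: measurable_funTS; exact: measurable_majorant_sum.
rewrite [X in _ + X](_ : _ = 0) ?adde0//.
under eq_integral do rewrite muleC.
rewrite ge0_integralZl//; last first.
  by apply/measurable_EFinP; exact: measurable_indic.
rewrite integral_indic// [m _](_ : _ = 0) ?mule0//.
apply/eqP; rewrite -measure_le0 -M0; apply: le_measure; rewrite ?inE//; exact: measurableI.
Qed.

(** After exchanging the sums over [k] and [j], the second hypothesis says that [w] grows fast
    enough to absorb the factors [tau ^+ (j - k)]. *)
Lemma sum_majorant_le (w : nat -> R) (K : R) : (forall k, 0 <= w k)%R ->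
  (forall j, \sum_(0 <= k < j.+1) w k * tau ^+ (j - k) <= K * w j)%R ->
  \sum_(k <oo) (w k)%:E * \int[m]_(x in D) majorant k x <=
  (C * K)%:E * \sum_(j <oo) (w j)%:E * \int[m]_(x in D) (dd j x)%:E.
Proof.
move=> w0 wK.
pose J j := \int[m]_(x in D) (dd j x)%:E.
have J0 j : 0 <= J j by apply: integral_ge0 => x _; rewrite lee_fin.
have K0 : (0 <= K * w 0%N)%R.
  by apply: le_trans (wK 0%N); rewrite sumr_ge0// => k _; rewrite mulr_ge0// exprn_ge0// ltW.
have E1 k : (w k)%:E * \int[m]_(x in D) majorant k x =
    \sum_(j <oo) C%:E * ((if (k <= j)%N then w k * tau ^+ (j - k) else 0)%:E * J j).
  rewrite integral_majorant /majorant_sum integral_nneseries//; last first.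
    by move=> j; exact: measurable_funTS.
  rewrite nneseriesZl; last first.
    move=> j _; rewrite mule_ge0//; case: ifP => // _.
    by rewrite lee_fin mulr_ge0// exprn_ge0// ltW.
  rewrite muleCA; congr (_ * _); rewrite -nneseriesZl; last first.
    by move=> j _; apply: integral_ge0 => x _; exact: term_ge0.
  apply: eq_eseriesr => j _; case: ifP => kj; last by rewrite integral0 mule0 mul0e.
  rewrite EFinM -muleA; congr (_ * _); rewrite /J -ge0_integralZl_EFin//.
  - by move=> x _; rewrite lee_fin.
  - by apply: measurable_funTS; apply/measurable_EFinP.
  - by rewrite exprn_ge0// ltW.
under eq_eseriesr => k _ do rewrite E1.
have F0 k j : 0 <= C%:E * ((if (k <= j)%N then w k * tau ^+ (j - k) else 0)%:E * J j).
  rewrite !mule_ge0// ?lee_fin//; case: ifP => // _.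
  by rewrite mulr_ge0// exprn_ge0// ltW.
rewrite nneseries_interchange// -nneseriesZl; last first.
  by move=> j _; apply: mule_ge0; [rewrite lee_fin|exact: J0].
apply: lee_nneseries => [j *|j *]; first exact: nneseries_ge0.
rewrite EFinM -muleA nneseriesZl; last first.
  move=> k _; rewrite mule_ge0//; case: ifP => // _.
  by rewrite lee_fin mulr_ge0// exprn_ge0// ltW.
apply: lee_wpmul2l; first by rewrite lee_fin.
rewrite muleA -EFinM.
apply: nneseries_le_bound => [k|i].
  by rewrite mule_ge0//; case: ifP => // _; rewrite lee_fin mulr_ge0// exprn_ge0// ltW.
rewrite -ge0_sume_distrl; last first.
  by move=> k _; case: ifP => // _; rewrite lee_fin mulr_ge0// exprn_ge0// ltW.
apply: lee_wpmul2r => //; rewrite sumEFin lee_fin; apply: le_trans (wK j).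
apply: sum_if_le => k; by rewrite mulr_ge0// exprn_ge0// ltW.
Qed.

End chain_majorant.

Lemma outer_null_measurable {R : realType} {n : nat} (A : set 'rV[R]_n) :
  @lebesgue_rV R n A = 0%E -> (@lebesgue_outer_rV R n).-cara.-measurable A.
Proof.
move=> A0; apply: le_caratheodory_measurable => X.
rewrite [X in (X + _ <= _)%E](_ : _ = 0%E) ?add0e; last first.
  apply/eqP; rewrite eq_le lebesgue_outer_rV_ge0 andbT -A0.
  by apply: le_lebesgue_outer_rV; exact: subIsetr.
by apply: le_lebesgue_outer_rV; exact: subIsetl.
Qed.

(** * The composed function over one root cube *)

Section sufficiency.
Context {R : realType} {n : nat}.
Hypothesis n_gt0 : (0 < n)%N.
Local Notation E := 'rV[R]_n.
Local Notation L := (caratheodory_type (@lebesgue_outer_rV R n)).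
Local Notation mu := (@lebesgue_rV R n).
Local Notation word := (seq {ffun 'I_n -> bool}).
Variable alpha : R.
Hypotheses (alpha_gt0 : 0 < alpha) (alpha_lt : alpha < n%:R / 2).
Variables (up dn : R -> R) (phi psi : E -> E).
Hypotheses (updn : distortion up dn) (pK : cancel phi psi) (Kp : cancel psi phi)
  (cphi : continuous phi) (cpsi : ratio_control up dn psi).
Variable (f : E -> R).
Hypothesis mf : measurable_fun [set: L] f.
Variables (a : E) (l : R).
Hypothesis l0 : 0 < l.
Variable N : R.
Hypotheses (N0 : 0 <= N) (fN : (Qnorm alpha f <= N%:E)%E).

Local Notation beta := (@Qbeta R n alpha).
Local Notation g := (1 + (1 - beta)).
Local Notation V := (pcell phi a l).
Local Notation v := (pvol phi a l).
Local Notation O s := (@osc_energy _ L R mu f (V s)).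
Local Notation KC := (@kernel_const R n alpha up).
Local Notation DC := (@diam_const R n up).
Local Notation dc := (@doubling_const R n up 4).

Let v0 (s : word) : 0 < v s. Proof. exact: (pvol_gt0 n_gt0 updn pK Kp cpsi a l0 s). Qed.
Let b0 : 0 < beta. Proof. exact: Qbeta_gt0. Qed.
Let b1 : beta < 1. Proof. exact: Qbeta_lt1. Qed.
Let KC0 : 0 <= KC. Proof. exact: (kernel_const_ge0 n_gt0 alpha_gt0 updn pK Kp cphi cpsi). Qed.
Let O0 s : (0 <= O s)%E. Proof. exact: (@osc_energy_ge0 _ L). Qed.

Definition csize (s : word) : R := wside l s ^+ n.
Local Notation m := csize.

Lemma csize_gt0 s : 0 < m s.
Proof. by rewrite exprn_gt0// wside_gt0. Qed.

Definition suff_const := KC * DC `^ beta.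

Lemma suff_const_ge0 : 0 <= suff_const.
Proof. by rewrite mulr_ge0 ?powR_ge0. Qed.

(** Every cell is the root of its own tree, with the same constants. *)
Lemma sub_osc_sum (t : word) :
  (wsum (fun w => ((v (w ++ t) `^ g)^-1)%:E * O (w ++ t)) <= (suff_const * v t `^ beta * N ^+ 2)%:E)%E.
Proof.
have := osc_sum_Qnorm n_gt0 alpha_gt0 alpha_lt updn pK Kp cphi cpsi mf
  (wcorner a l t) (wside_gt0 t l0) N0 fN.
rewrite -(pvol_cat phi a l [::] t) /= => H; apply: le_trans H.
rewrite le_eqVlt; apply/orP; left; apply/eqP; apply: eq_wsum => w.
by rewrite pvol_cat pcell_cat.
Qed.

Lemma osc_fin s : O s \is a fin_num.
Proof.
rewrite ge0_fin_numE//.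
have T0 w : (0 <= ((v (w ++ s) `^ g)^-1)%:E * O (w ++ s))%E.
  by rewrite mule_ge0// lee_fin invr_ge0 powR_ge0.
have := le_trans (wsum_ge_term [::] T0) (sub_osc_sum s).
rewrite /= lee_pdivrMl ?powR_gt0// -EFinM => /le_lt_trans; apply; exact: ltry.
Qed.

Section weights.
Variables (lam : word -> R) (X : R).
Hypotheses (lam0 : forall s, 0 <= lam s)
  (lam1 : forall s, 1 <= \sum_(0 <= i < (size s).+1)
     lam (drop i s) * (m (drop i s) / m s * (v s / v (drop i s))) `^ beta)
  (lamX : (wsum (fun s => (lam s * (m s / m [::]) `^ beta)%:E) <= X%:E)%E).

Lemma weighted_osc_sum :
  (wsum (fun s => (m s `^ beta / v s ^+ 2)%:E * O s) <=
   (suff_const * N ^+ 2 * m [::] `^ beta * X)%:E)%E.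
Proof.
apply: (weighted_word_sum (g := g) v0 csize_gt0 O0 _ lam0 lam1 lamX).
- by ring.
- by rewrite mulr_ge0 ?suff_const_ge0 ?exprn_ge0.
- move=> t; apply: le_trans (sub_osc_sum t) _.
  by rewrite lee_fin mulrAC.
Qed.

End weights.

Definition osc_real (s : word) : R := fine (O s).
Local Notation o := osc_real.
Lemma osc_realE s : O s = (o s)%:E.
Proof. by rewrite /osc_real fineK// osc_fin. Qed.

Lemma osc_real_ge0 s : 0 <= o s.
Proof. by rewrite -lee_fin -osc_realE. Qed.

Lemma centers_exist : exists c : word -> R, forall s,
  (\int[mu]_(u in V s) (`|f u - c s| ^+ 2)%:E <= (2 * o s / v s)%:E)%E.
Proof.
have H s : exists c : R,
    (\int[mu]_(u in V s) (`|f u - c| ^+ 2)%:E <= (2 * o s / v s)%:E)%E.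
  have [|c cP] := @osc_energy_center _ L R mu f mf (V s) (v s)
    (measurable_pcell cphi a l s) (pvol_fin n_gt0 updn pK cpsi a l0 s) (v0 s).
    by rewrite osc_realE ltry.
  exists c; move: cP; rewrite osc_realE -EFinM -lee_pdivlMl// => /le_trans; apply.
  by rewrite -EFinM mulrC.
by have [c cP] := choice H; exists c.
Qed.

Section centers.
Variable c : word -> R.
Hypothesis cP : forall s,
  (\int[mu]_(u in V s) (`|f u - c s| ^+ 2)%:E <= (2 * o s / v s)%:E)%E.

(** Both centres approximate [f] on the preimage of the child, whose volume is comparable to that of
    the preimage of the parent. *)
Lemma center_diff e s : `|c (e :: s) - c s| ^+ 2 <= 4 * dc * (dc + 1) * o s / v s ^+ 2.
Proof.
set t := e :: s.
have dc0 : 0 < dc by exact: (@doubling_const_gt0 R n up dn updn 4 (ltr0n R 4)).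
have Vts : V t `<=` V s by exact: (pcell_sub (phi := phi) l0 (w := [:: e])).
have vst := pvol_parent n_gt0 updn pK Kp cpsi a l0 e s.
have mV w : measurable (V w : set L) by exact: measurable_pcell.
have ot : o t <= o s.
  by rewrite -lee_fin -!osc_realE; apply: (@le_osc_energy _ L).
have H : `|c t - c s| ^+ 2 * v t <= 2 * (2 * o t / v t + 2 * o s / v s).
  exact: (@centers_dist _ L R mu f mf (V s) (V t) (v t) (c s) (c t) _ _ (mV s) (mV t) Vts
    (pvol_fin n_gt0 updn pK cpsi a l0 t) (cP s) (cP t)).
have o0 := osc_real_ge0 s; have o0' := osc_real_ge0 t.
have v0s := v0 s; have v0t := v0 t.
have I1 : (v t)^-1 <= dc / v s.
  by rewrite ler_pdivlMr// mulrC ler_pdivrMr.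
rewrite -(ler_pM2r (v0 t)); apply: le_trans H _.
have -> : 2 * (2 * o t / v t + 2 * o s / v s) = 4 * (o t / v t + o s / v s) by ring.
apply: (@le_trans _ _ (4 * (o s * (dc / v s) + o s / v s))).
  rewrite ler_pM2l// lerD2r; apply: ler_pM => //; by rewrite invr_ge0 ltW.
rewrite (_ : 4 * _ = 4 * (dc + 1) * o s / v s); last by ring.
rewrite (_ : _ / v s ^+ 2 * v t = 4 * (dc + 1) * o s / v s * (dc * v t / v s)); last first.
  by field; rewrite gt_eqF.
rewrite ler_peMr//; first by rewrite !mulr_ge0 ?invr_ge0 ?addr_ge0 ?(ltW dc0) ?(ltW v0s).
by rewrite ler_pdivlMr// mul1r.
Qed.


Definition cstep (k : nat) : L -> R := @step _ L R word (@words n k) V c.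

Lemma cstepE k (u : E) : V [::] u -> cstep k u = c (wcode a l k (phi u)).
Proof.
rewrite /pcell /= cell_nil => Vu; apply: stepE.
- exact: uniq_words.
- exact: trivIset_pcell.
- exact: code_words.
- exact: cell_code.
Qed.

(** The factor [(v s)^-1] of the mean square error is [v s ^ (1 - beta)] times the weight
    [v s ^ (- g)] of [sub_osc_sum], and [v s] is at most [v [::]]. *)
Lemma cstep_summable :
  (\sum_(k <oo) \int[mu]_(u in V [::]) (`|f u - cstep k u| ^+ 2)%:E < +oo)%E.
Proof.
have VE k : V [::] = \big[setU/set0]_(s <- @words n k) V s.
  by rewrite -(preimage_hcube_words phi a l0 k) /pcell cell_nil.
pose W s := (((v s `^ g)^-1)%:E * O s)%E.
have W0 s : (0 <= W s)%E by rewrite mule_ge0// lee_fin invr_ge0 powR_ge0.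
apply: (@le_lt_trans _ _ ((2 * v [::] `^ (1 - beta))%:E * wsum W)%E); last first.
  have H : (wsum W <= (suff_const * v [::] `^ beta * N ^+ 2)%:E)%E.
    apply: le_trans (sub_osc_sum [::]).
    by apply: (le_wsum W0) => s; rewrite cats0.
  apply: le_lt_trans (lee_wpmul2l _ H) _; first by rewrite lee_fin mulr_ge0 ?powR_ge0.
  by rewrite -EFinM ltry.
rewrite -wsumZl//; last by rewrite mulr_ge0 ?powR_ge0.
apply: lee_nneseries => [k *|k *].
  by apply: integral_ge0 => u _; rewrite lee_fin exprn_ge0.
rewrite (@integral_step_sq _ L R mu word (@words n k) V (measurable_pcell cphi a l)
  (uniq_words k) (@trivIset_pcell _ _ phi a _ l0 k) f c (V [::]) mf (VE k)).
apply: lee_sum => s _; apply: le_trans (cP s) _.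
rewrite /W osc_realE -!EFinM lee_fin.
have -> : (v s)^-1 = v s `^ (1 - beta) * (v s `^ g)^-1.
  rewrite -powRN -powRD; last by apply/implyP => _; rewrite gt_eqF.
  by rewrite (_ : _ + _ = -1) ?powR_inv1 ?(ltW (v0 s))//; ring.
have key (p A A' B : R) : A <= A' -> 0 <= B -> 0 <= p -> 2 * p * (A * B) <= 2 * A' * (B * p).
  move=> AA B0 p0; rewrite (_ : 2 * p * (A * B) = A * (2 * B * p)); last by ring.
  rewrite (_ : 2 * A' * (B * p) = A' * (2 * B * p)); last by ring.
  by rewrite ler_wpM2r// !mulr_ge0.
apply: key; [|by rewrite invr_ge0 powR_ge0|exact: osc_real_ge0].
apply: ge0_ler_powR; rewrite ?nnegrE ?(ltW (v0 _))// ?subr_ge0 ?(ltW b1)//.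
by have := pvol_sub n_gt0 updn pK cpsi a l0 s [::]; rewrite cats0.
Qed.

(** [behead] gives the parent, so these are the squared jumps of the centres. The step functions
    [dstep] made of them live on the cells, while [cstep] lives on the preimages. *)
Definition cdist (t : word) : R := `|c t - c (behead t)| ^+ 2.
Definition dstep (j : nat) : L -> R := @step _ L R word (@words n j.+1) (cell a l) cdist.

Lemma dstepE j (x : E) : hcube a l x ->
  dstep j x = `|c (wcode a l j.+1 x) - c (wcode a l j x)| ^+ 2.
Proof.
move=> ax; have -> : dstep j x = cdist (wcode a l j.+1 x); last by [].
apply: stepE.
- exact: uniq_words.
- exact: (@trivIset_cell _ _ a _ l0 _).
- exact: code_words.
- exact: cell_code.
Qed.

(** The weights [scale_weight k] grow like [tau ^+ (2 * k)]: one factor [tau] per level is spent on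
    the weights of the chain inequality, the other keeps the sum over coarser levels geometric. *)
Definition tau := 2 `^ alpha : R.
Definition tauA := tau / (tau - 1).

Lemma tau_gt1 : 1 < tau.
Proof.
have H : 1 `^ alpha = 1 :> R by rewrite powR1.
by rewrite -[ltLHS]H; apply: gt0_ltr_powR => //; rewrite ?nnegrE// ltr1n.
Qed.

Lemma tauA_ge0 : 0 <= tauA.
Proof. by have := tau_gt1; move=> t1; rewrite divr_ge0//; lra. Qed.

Definition scale_weight (k : nat) : R := ((l / 2 ^+ k) `^ (2 * alpha))^-1.

Lemma scale_weightE k : scale_weight k = (l `^ (2 * alpha))^-1 * (tau ^+ k) ^+ 2.
Proof.
rewrite /scale_weight powR_div ?exprn_gt0// ?(ltW l0)// invfM invrK; congr (_ * _).
rewrite -exprM -[tau ^+ _]powR_mulrn ?powR_ge0// /tau -powRrM -[2 ^+ k]powR_mulrn// -powRrM natrM.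
by congr (_ `^ _); ring.
Qed.

Lemma scale_weight_ge0 k : 0 <= scale_weight k.
Proof. by rewrite invr_ge0 powR_ge0. Qed.

Lemma scale_weight_sum j :
  \sum_(0 <= k < j.+1) scale_weight k * tau ^+ (j - k) <= tauA * scale_weight j.
Proof.
rewrite (eq_big_nat _ _ (F2 := fun k => (l `^ (2 * alpha))^-1 * tau ^+ j * tau ^+ k)); last first.
  move=> k; rewrite ltnS => /andP[_ kj]; rewrite scale_weightE.
  by rewrite -[in tau ^+ j](subnK kj) exprD; ring.
rewrite -mulr_sumr scale_weightE.
have P0 : 0 <= (l `^ (2 * alpha))^-1 * tau ^+ j.
  by rewrite mulr_ge0 ?invr_ge0 ?exprn_ge0 ?powR_ge0.
apply: le_trans (ler_wpM2l P0 (geometric_sum_le j tau_gt1)) _.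
by rewrite -/tauA le_eqVlt; apply/orP; left; apply/eqP; ring.
Qed.

Lemma scale_weight_csize k s : size s = k -> scale_weight k * m s = m s `^ beta.
Proof.
move=> sk; rewrite /scale_weight /csize /wside sk; set x := l / 2 ^+ k.
have x0 : 0 < x by rewrite divr_gt0// exprn_gt0.
rewrite -(powR_mulrn _ (ltW x0)) -powRrM -powRN -powRD; last by apply/implyP => _; rewrite gt_eqF.
by congr (_ `^ _); rewrite /Qbeta; field; rewrite pnatr_eq0 -lt0n.
Qed.

Definition jump_const := 4 * dc * (dc + 1).

Lemma dstep_sum : (\sum_(j <oo) (scale_weight j)%:E * \int[mu]_(x in hcube a l) (dstep j x)%:E <=
  jump_const%:E * wsum (fun s => (m s `^ beta / v s ^+ 2)%:E * O s))%E.
Proof.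
have dc0 : 0 < dc by exact: (@doubling_const_gt0 R n up dn updn 4 (ltr0n R 4)).
have j0 : 0 <= jump_const by rewrite !mulr_ge0 ?addr_ge0 ?(ltW dc0).
rewrite -wsumZl//; last first.
  by move=> s; rewrite mule_ge0// lee_fin mulr_ge0 ?powR_ge0// invr_ge0 exprn_ge0// ltW.
apply: lee_nneseries => [j *|j *].
  rewrite mule_ge0 ?lee_fin ?scale_weight_ge0//; apply: integral_ge0 => x _.
  by rewrite lee_fin; apply: step_ge0 => s; rewrite exprn_ge0.
rewrite (@integral_step _ L R mu word (@words n j.+1) (cell a l) (fun s => measurable_hcube _ _)
  (uniq_words _) (@trivIset_cell _ _ a _ l0 _) cdist (hcube a l) _ (hcube_words a l0 _)); last first.
  by move=> s; rewrite exprn_ge0.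
under eq_bigr => t _.
  rewrite [X in (_ * X)%E](_ : _ = (m t)%:E); last exact: lebesgue_rV_hcube (wside_gt0 t l0).
  rewrite -EFinM; over.
under [leRHS]eq_bigr => s _ do rewrite osc_realE -!EFinM.
rewrite !sumEFin -EFinM lee_fin mulr_sumr /= big_allpairs_dep/=.
rewrite big_seq_cond [leRHS]big_seq_cond; apply: ler_sum => s; rewrite andbT mem_words => /eqP sj.
apply: (@le_trans _ _ (\sum_(e <- enum {ffun 'I_n -> bool}) scale_weight j * (jump_const * o s / v s ^+ 2 * (m s / 2 ^+ n)))).
  apply: ler_sum => e _; rewrite ler_wpM2l ?scale_weight_ge0//.
  have -> : m (e :: s) = m s / 2 ^+ n by rewrite /csize wside_cons exprMn exprVn.
  rewrite ler_wpM2r//; first by rewrite divr_ge0 ?exprn_ge0// ltW// wside_gt0.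
  exact: center_diff.
(* A parent has 2 ^ n children, each with the fraction 2 ^ (-n) of its volume. *)
rewrite big_enum/= sumr_const card_ffun card_bool card_ord -[leLHS]mulr_natr natrX.
rewrite -(scale_weight_csize sj) le_eqVlt; apply/orP; left; apply/eqP.
by field; rewrite !gt_eqF ?exprn_gt0.
Qed.

Section root_estimate.
Variables (lam : word -> R) (X : R).
Hypotheses (lam0 : forall s, 0 <= lam s)
  (lam1 : forall s, 1 <= \sum_(0 <= i < (size s).+1)
     lam (drop i s) * (m (drop i s) / m s * (v s / v (drop i s))) `^ beta)
  (lamX : (wsum (fun s => (lam s * (m s / m [::]) `^ beta)%:E) <= X%:E)%E).
Hypothesis lusin : forall A : set E, mu A = 0%E -> mu (psi @^-1` A) = 0%E.

(** Both values are compared with the centre of the common cell of level [k], through the centres of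
    the finer cells around each point. These centres converge to [f \o psi] off [M]: convergence is
    first known off the null set [Z] on the side of [f], and [lusin] carries [Z] over to the side of
    the cells. *)
Lemma root_majorant : exists H : nat -> L -> \bar R,
  [/\ forall k, measurable_fun [set: L] (H k), forall k x, (0 <= H k x)%E,
    forall k x y, hcube a l x -> hcube a l y -> wcode a l k x = wcode a l k y ->
      ((`|f (psi x) - f (psi y)| ^+ 2)%:E <= H k x + H k y)%E &
    (\sum_(k <oo) (scale_weight k)%:E * \int[mu]_(x in hcube a l) H k x <=
      (2 * tauA * tauA * (jump_const * (suff_const * N ^+ 2 * m [::] `^ beta * X)))%:E)%E].
Proof.
have mcs k : measurable_fun [set: L] (cstep k).
  by apply: (@measurable_step _ L) => s; exact: measurable_pcell.
have [Z [mZ Z0 cvgZ]] := @summable_sq_diff_cvg _ L R mu f mf (V [::]) cstep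
  (measurable_pcell cphi a l [::]) mcs cstep_summable.
pose M : set L := psi @^-1` Z.
have M0 : mu M = 0%E by exact: lusin.
have mM : measurable M.
  exact: outer_null_measurable.
have mds j : measurable_fun [set: L] (dstep j).
  by apply: (@measurable_step _ L) => s; exact: measurable_hcube.
have ds0 j (x : L) : 0 <= dstep j x.
  by apply: step_ge0 => s; rewrite exprn_ge0.
have A2 : 0 <= 2 * tauA by rewrite mulr_ge0 ?tauA_ge0.
exists (@majorant R _ L M dstep tau (2 * tauA)); split.
- by move=> k; apply: measurable_majorant => //; exact: tau_gt1.
- by move=> k x; apply: majorant_ge0 => //; exact: tau_gt1.
- move=> k x y ax ay xyk.
  have key (z : E) : hcube a l z -> ~ M z ->
      ((2 * `|f (psi z) - c (wcode a l k z)| ^+ 2)%:E <= @majorant R _ L M dstep tau (2 * tauA) k z)%E.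
    move=> az Mz; rewrite /majorant indicE memNset// mul0e adde0.
    set S := majorant_sum _ _ _ _.
    have tau0 : 0 <= tau by rewrite powR_ge0.
    have trm i : (0 <= (if (k <= i)%N then tau ^+ (i - k) * dstep i z else 0)%:E)%E.
      by case: ifP => // _; rewrite lee_fin mulr_ge0// exprn_ge0.
    have S0 : (0 <= S)%E by apply: nneseries_ge0 => i _ _; exact: trm.
    (* The chain of centres at [z] from level [k] on, to which [chain_sq_le] applies. *)
    pose q i := c (wcode a l (i + k) z).
    have part i : ((\sum_(0 <= j < i) tau ^+ j * (q j.+1 - q j) ^+ 2)%:E <= S)%E.
      apply: le_trans (nneseries_lim_ge (k + i) (fun i _ _ => trm i)).
      rewrite sumEFin lee_fin (@big_cat_nat _ _ _ k 0 (k + i))//= ?leq_addr//.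
      rewrite -[leLHS]add0r; apply: lerD.
        by apply: sumr_ge0 => j _; rewrite -lee_fin; exact: trm.
      rewrite -{1}(add0n k) big_addn addKn; apply: ler_sum => j _.
      by rewrite leq_addl addnK dstepE// -normrX ger0_norm ?sqr_ge0// /q addSn.
    have [Soo|Sfin] := eqVneq S +oo%E.
      rewrite Soo mulr_infty gtr0_sg ?mul1e ?leey// mulr_gt0// divr_gt0 ?subr_gt0 ?tau_gt1//.
      exact: lt_trans tau_gt1.
    have SE : S = (fine S)%:E by rewrite fineK// ge0_fin_numE// ltey.
    rewrite SE -EFinM lee_fin -mulrA ler_pM2l//.
    have qz : q i @[i --> \oo] --> f (psi z).
      have Vz : V [::] (psi z) by rewrite /pcell /= Kp cell_nil.
      have := cvgZ _ Vz Mz; rewrite -(cvg_shiftn k).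
      rewrite (_ : (fun i => cstep (i + k) (psi z)) = q)//.
      by apply/funext => i; rewrite /q cstepE// Kp.
    rewrite -normrX ger0_norm ?sqr_ge0//.
    have q2 : (q i - q 0%N) ^+ 2 @[i --> \oo] --> (f (psi z) - c (wcode a l k z)) ^+ 2.
      rewrite expr2; under eq_fun do rewrite expr2.
      by apply: cvgM; apply: cvgB => //; exact: cvg_cst.
    rewrite -(cvg_lim _ q2)//; apply: limr_le; first by apply/cvg_ex; eexists; exact: q2.
    apply: nearW => i; apply: le_trans (chain_sq_le q i tau_gt1) _.
    by apply: ler_wpM2l tauA_ge0 _ _ _; rewrite -lee_fin -SE.
  have majp (z : E) : M z -> @majorant R _ L M dstep tau (2 * tauA) k z = +oo%E.
    move=> Mz; rewrite /majorant indicE mem_set//= mul1e addey// gt_eqF//.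
    rewrite (@lt_le_trans _ _ 0%E)// mule_ge0//; apply: majorant_sum_ge0 => //; exact: tau_gt1.
  have majn (z : E) : (0 <= @majorant R _ L M dstep tau (2 * tauA) k z)%E.
    by apply: majorant_ge0 => //; exact: tau_gt1.
  have [Mx|Mx] := pselect (M x).
    by rewrite (majp _ Mx) addye ?leey// gt_eqF// (@lt_le_trans _ _ 0%E).
  have [My|My] := pselect (M y).
    by rewrite (majp _ My) addey ?leey// gt_eqF// (@lt_le_trans _ _ 0%E).
  apply: le_trans (leeD (key _ ax Mx) (key _ ay My)); rewrite -EFinD lee_fin xyk.
  set cc := c _; rewrite -!normrX !ger0_norm ?sqr_ge0//.
  have := sqr_ge0 ((f (psi x) - cc) + (f (psi y) - cc)); nra.
- apply: le_trans (sum_majorant_le mM M0 (measurable_hcube a l) mds ds0 tau_gt1 A2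
    scale_weight_ge0 scale_weight_sum) _.
  rewrite [leRHS]EFinM; apply: lee_wpmul2l.
    by rewrite lee_fin; apply: mulr_ge0 => //; exact: tauA_ge0.
  apply: le_trans dstep_sum _.
  have j0 : 0 <= jump_const.
    have dc0 : 0 < dc by exact: (@doubling_const_gt0 R n up dn updn 4 (ltr0n R 4)).
    by rewrite !mulr_ge0 ?addr_ge0 ?(ltW dc0).
  rewrite [leRHS]EFinM; apply: lee_wpmul2l; first by rewrite lee_fin.
  exact: (weighted_osc_sum lam0 lam1 lamX).
Qed.

End root_estimate.
End centers.
End sufficiency.

(** * Dyadic cubes of all types *)

Section typed_cells.
Context {R : realType} {n : nat}.
Hypothesis n_gt0 : (0 < n)%N.
Local Notation E := 'rV[R]_n.
Local Notation mu := (@lebesgue_rV R n).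
Local Notation word := (seq {ffun 'I_n -> bool}).

Lemma wpos_lt (s : word) i : (wpos s i < 2 ^ size s)%N.
Proof.
elim: s => //= e s IH; rewrite expnS mul2n; case: (e i) => /=; last by rewrite addn0 ltn_double.
by rewrite addn1 ltn_Sdouble.
Qed.

Lemma wpos_surj k (z : 'I_n -> nat) : (forall i, (z i < 2 ^ k)%N) ->
  exists s : word, size s = k /\ forall i, wpos s i = z i.
Proof.
elim: k z => [|k IH] z zk.
  by exists [::]; split => // i; have := zk i; rewrite expn0 ltnS leqn0 => /eqP ->.
have [|s [sk sz]] := IH (fun i => (z i)./2).
  by move=> i; rewrite ltn_half_double -mul2n -expnS.
exists ([ffun i => odd (z i)] :: s); split; first by rewrite /= sk.
by move=> i; rewrite /= sz ffunE addnC odd_double_half.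
Qed.

Variable Q : @cube R n.
Local Notation a := (corner Q).
Local Notation l := (side Q).
Let l0 : 0 < l. Proof. exact: side_gt0. Qed.

Definition wcube (s : word) : cube :=
  Cube (wcorner a l s) (wside_gt0 s (side_gt0 Q)) (left_closed Q) (right_closed Q).
Definition tcell (s : word) : set E := cube_set (wcube s).

Lemma dyadic_range : dyadic Q = range tcell.
Proof.
apply/seteqP; split => [_ [k _ [j _ <-]]|_ [s _ <-]].
  have [s [sk sj]] := @wpos_surj k (fun i => j i) (fun i => ltn_ord (j i)).
  exists s => //; rewrite /tcell /cube_set /= /wcorner /wside sk.
  by rewrite (_ : \row_i (wpos s i)%:R = \row_i (j i)%:R)//; apply/rowP => i; rewrite !mxE sj.
exists (size s) => //; exists (fun i => Ordinal (wpos_lt s i)) => //.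
Qed.

Lemma ball_sub_tcell s x : `|x - wcenter a l s| < wside l s / 2 -> tcell s x.
Proof.
have s0 := wside_gt0 s l0.
move/normr_lt_rV => H i; have := H ltac:(lra) i; rewrite rowB wcenterE ltr_norml in_itv/=.
by case: (left_closed Q); case: (right_closed Q) => /=; lra.
Qed.

Lemma tcell_closed s x i : tcell s x ->
  wcorner a l s ord0 i <= x ord0 i <= wcorner a l s ord0 i + wside l s.
Proof.
move=> /(_ i); rewrite in_itv/=.
by case: (left_closed Q); case: (right_closed Q) => /=; lra.
Qed.

Lemma tcell_sub_ball s x : tcell s x -> `|x - wcenter a l s| <= wside l s / 2.
Proof.
have s0 := wside_gt0 s l0; move=> sx; apply/normr_le_rV; first lra.
by move=> i; have := tcell_closed i sx; rewrite rowB wcenterE ler_norml; lra.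
Qed.

Lemma tcell_cons e s : tcell (e :: s) `<=` tcell s.
Proof.
move=> x ex i; have := ex i; have s0 := wside_gt0 s l0.
rewrite !in_itv /= wcorner_cons wside_cons.
by case: (e i); case: (left_closed Q); case: (right_closed Q) => /=; lra.
Qed.

Lemma tcell_cat w s : tcell (w ++ s) `<=` tcell s.
Proof. by elim: w => // e w IH; apply: subset_trans IH; exact: tcell_cons. Qed.

Lemma tcell_drop i s : tcell s `<=` tcell (drop i s).
Proof. by rewrite -{1}(cat_take_drop i s); exact: tcell_cat. Qed.

(** Two points on the diagonal, 3/4 of the way from the centre to the corners, lie in [tcell s]
    whatever faces belong to it. A cell at most half as large cannot contain both, so [t] is not
    finer than [s]; as it contains the centre of [s], it is an ancestor. *)
Lemma tcell_sub s t : tcell s `<=` tcell t -> exists2 i, (i <= size s)%N & t = drop i s.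
Proof.
move=> st; have s0 := wside_gt0 s l0; have t0 := wside_gt0 t l0.
pose x := wcenter a l s; pose d := 3 / 4 * (wside l s / 2).
have B (b : R) : `|b| <= 1 -> tcell t (x + const_mx (b * d)).
  move=> b1; apply: st; apply: ball_sub_tcell; rewrite addrAC subrr add0r.
  apply: (@le_lt_trans _ _ d); last by rewrite /d; lra.
  apply/normr_le_rV; first by rewrite /d; lra.
  by move=> i; rewrite mxE normrM [`|d|]ger0_norm ?ler_piMl// /d; lra.
have B1 i : wcorner a l t ord0 i <= x ord0 i - d /\ x ord0 i + d <= wcorner a l t ord0 i + wside l t.
  have := tcell_closed i (B 1 _); have := tcell_closed i (B (-1) _).
  rewrite normrN normr1 lexx => /(_ isT) + /(_ isT); rewrite !mxE; lra.
have xs : cell a l s x by apply: ball_sub_cell => //; rewrite subrr normr0; lra.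
have xt : cell a l t x by move=> i; have := B1 i; rewrite /d in B1 *; lra.
have ts : (size t <= size s)%N.
  rewrite leqNgt; apply/negP => ts.
  have := B1 (Ordinal n_gt0); rewrite /d => H.
  have : wside l t <= wside l s / 2.
    rewrite /wside -mulrA -invfM -exprSr ler_pM2l// lef_pV2 ?posrE ?exprn_gt0//.
    by rewrite ler_weXn2l// ler1n.
  lra.
have ax := cell_sub_nil l0 xs.
have [w wj] := code_add (size s - size t) (size t) l0 ax.
rewrite subnK// (code_cell l0 xs) (code_cell l0 xt) => ->.
by exists (size w); rewrite ?size_cat ?leq_addr// drop_size_cat.
Qed.

(** The gauge sums over sets while the proof sums over words, so different words have to give
    different sets. *)
Lemma tcell_inj : injective tcell.
Proof.
move=> s t st; have [|i si ti] := @tcell_sub s t; first by rewrite st.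
have [|j _ sj] := @tcell_sub t s; first by rewrite st.
have : size s = size t.
  apply/eqP; rewrite eqn_leq; apply/andP; split; first by rewrite sj size_drop leq_subr.
  by rewrite ti size_drop leq_subr.
rewrite ti size_drop => H; suff -> : i = 0%N by rewrite drop0.
by lia.
Qed.

Lemma esum_dyadic (F : set E -> \bar R) : (forall I, dyadic Q I -> 0 <= F I)%E ->
  (\esum_(I in dyadic Q) F I = wsum (fun s => F (tcell s)))%E.
Proof.
move=> F0; rewrite wsum_esum; last by move=> s; apply: F0; rewrite dyadic_range; exists s.
rewrite dyadic_range esum_image// => s t _ _; exact: tcell_inj.
Qed.

Lemma esum_dyadic_sup (F : set E -> \bar R) (s : word) : (forall I, dyadic Q I -> 0 <= F I)%E ->
  (\esum_(I in [set I | dyadic Q I /\ tcell s `<=` I]) F I =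
   \sum_(0 <= i < (size s).+1) F (tcell (drop i s)))%E.
Proof.
move=> F0.
have -> : [set I | dyadic Q I /\ tcell s `<=` I] =
    [set tcell (drop i s) | i in [set` index_iota 0 (size s).+1]].
  apply/seteqP; split => I /=.
    rewrite dyadic_range => -[[t _ <-]] /tcell_sub[i si ->].
    by exists i => //=; rewrite mem_index_iota.
  case=> i _ <-; split; first by rewrite dyadic_range; exists (drop i s).
  exact: tcell_drop.
rewrite esum_image; last first.
  move=> i j; rewrite !inE /= !mem_index_iota /= !ltnS => si sj /tcell_inj /(congr1 size).
  by rewrite !size_drop; lia.
rewrite esum_fset; [|exact: finite_seq|]; last first.
  by move=> i _; apply: F0; rewrite dyadic_range; exists (drop i s).
by rewrite (fsbig_seq _ _ (iota_uniq _ _)).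
Qed.

Lemma volume_tcell s : volume (tcell s) = wside l s ^+ n.
Proof. exact: volume_cube. Qed.

End typed_cells.

(** * Sufficiency *)

Section one_third_trick.
Context {R : realType} {n : nat}.
Local Notation E := 'rV[R]_n.

(** The bisecting hyperplanes of all coarser levels belong to the grid of level [k], so the
    comparisons with that grid determine all digits. *)
Lemma wcode_eq (a : E) (l : R) (k : nat) (x y : E) :
  (forall (i : 'I_n) (z : nat), (a ord0 i + l / 2 ^+ k * z%:R <= x ord0 i) =
                   (a ord0 i + l / 2 ^+ k * z%:R <= y ord0 i)) ->
  wcode a l k x = wcode a l k y.
Proof.
elim: k => // k IH H /=.
have -> : wcode a l k x = wcode a l k y.
  apply: IH => i z; have := H i z.*2; rewrite -mul2n natrM.
  by rewrite (_ : l / 2 ^+ k.+1 * _ = l / 2 ^+ k * z%:R)// exprS; field; rewrite expf_neq0.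
congr (_ :: _); apply/ffunP => i; rewrite !ffunE; set s := wcode a l k y.
have := H i (wpos s i).*2.+1.
rewrite (_ : a ord0 i + l / 2 ^+ k.+1 * _ = wcorner a l s ord0 i + wside l s / 2)//.
rewrite (_ : (wpos s i).*2.+1%:R = 2 * (wpos s i)%:R + 1 :> R); last by rewrite -addn1 natrD -mul2n natrM.
rewrite !mxE /wside size_code exprS; field; rewrite expf_neq0//.
Qed.

(* The grids of step [h] shifted by [0] and by [2 ^ k * h / 3] have no two
   points at distance less than [h / 3]. *)
Lemma shifted_grid (a h x y : R) (k : nat) : 0 < h -> `|x - y| < h / 3 ->
  exists t : bool, forall z : nat, (a - t%:R * (2 ^+ k * h / 3) + h * z%:R <= x) =
                                  (a - t%:R * (2 ^+ k * h / 3) + h * z%:R <= y).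
Proof.
move=> h0; rewrite ltr_norml => xy; apply: contrapT => /forallNP H.
have /existsNP[z0 /eqP Z0] := H false; have /existsNP[z1 /eqP Z1] := H true.
pose d := h * (3 * z0%:R + 2 ^+ k - 3 * z1%:R) / 3.
have D : - (h / 3) < d < h / 3.
  rewrite (_ : d = (a - false%:R * (2 ^+ k * h / 3) + h * z0%:R) -
     (a - true%:R * (2 ^+ k * h / 3) + h * z1%:R)); last by rewrite /d /=; field.
  move: Z0 Z1; set p := _ + h * z0%:R; set q := _ + h * z1%:R.
  by have [] := leP p x; have [] := leP p y; have [] := leP q x; have [] := leP q y => //; lra.
have : `|((3 * z0 + 2 ^ k)%N%:R - (3 * z1)%N%:R : R)| < 1.
  rewrite natrD natrX !natrM ltr_norml; move: D; rewrite /d.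
  set q := 3 * _ + _ - _ => D.
  have : h * (-1) < h * q < h * 1 by lra.
  by rewrite !ltr_pM2l.
set p := (3 * z0 + 2 ^ k)%N; set q := (3 * z1)%N; rewrite ltr_norml => pq.
have A : (p < q.+1)%N by rewrite -(ltr_nat R) -natr1; lra.
have B : (q < p.+1)%N by rewrite -(ltr_nat R) -natr1; lra.
(* A point of each grid separates [x] from [y]. The two points differ by an integer multiple of
   [h / 3] that is smaller than [h / 3], so they coincide. *)
have : (3 %| 2 ^ k)%N.
  rewrite -(dvdn_addr _ (dvdn_mulr z0 (dvdnn 3))) -/p (_ : p = q) ?dvdn_mulr//.
  by apply/eqP; rewrite eqn_leq -ltnS A -ltnS B.
by rewrite Euclid_dvdX.
Qed.

(** The level [k] is the last one at which the step of the grid exceeds three times the distance,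
    hence the factor 6. With roots of side [4 * r] this holds at level 0, as the distance is at most
    [r]. Each coordinate chooses its own shift. *)
Lemma one_third (a : E) (r : R) (x y : E) : 0 < r -> x != y ->
  (forall i, a ord0 i <= x ord0 i <= a ord0 i + r) ->
  (forall i, a ord0 i <= y ord0 i <= a ord0 i + r) ->
  exists (t : {ffun 'I_n -> bool}) (k : nat),
    let a' := a - \row_i ((t i)%:R * (4 * r / 3)) in
    [/\ wcode a' (4 * r) k x = wcode a' (4 * r) k y &
     4 * r / 2 ^+ k <= 6 * `|x - y|].
Proof.
move=> r0 xy ax ay.
have d0 : 0 < `|x - y| by rewrite normr_gt0 subr_eq0.
have dr : `|x - y| <= r.
  apply/normr_le_rV; first exact: ltW.
  by move=> i; have := ax i; have := ay i; rewrite rowB ler_norml; lra.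
have ex : exists j, 4 * r / 2 ^+ j / 3 <= `|x - y|.
  pose j := Num.truncn (4 * r / `|x - y|).
  exists j; have : 4 * r / `|x - y| < 2 ^+ j.
    apply: lt_le_trans (truncnS_gt _) _.
    by rewrite -natrX ler_nat ltn_expl.
  rewrite ltr_pdivrMr// => H; rewrite ler_pdivrMr// ler_pdivrMr ?exprn_gt0//.
  have : 0 < 2 ^+ j * `|x - y| by rewrite mulr_gt0 ?exprn_gt0.
  move: H; set p := 2 ^+ j * _; rewrite (_ : _ * 3 * _ = p * 3); first lra.
  by rewrite /p mulrAC [_ * 2 ^+ j]mulrC.
case: (ex_minnP ex) => -[|k] jP jm.
  by move: jP; rewrite expr0 divr1; lra.
have kP : `|x - y| < 4 * r / 2 ^+ k / 3.
  by rewrite ltNge; apply/negP => /jm; rewrite ltnn.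
have h0 : 0 < 4 * r / 2 ^+ k by rewrite divr_gt0 ?exprn_gt0// mulr_gt0.
have H i : exists t : bool, forall z : nat,
    (a ord0 i - t%:R * (2 ^+ k * (4 * r / 2 ^+ k) / 3) + 4 * r / 2 ^+ k * z%:R <= x ord0 i) =
    (a ord0 i - t%:R * (2 ^+ k * (4 * r / 2 ^+ k) / 3) + 4 * r / 2 ^+ k * z%:R <= y ord0 i).
  by apply: shifted_grid => //; rewrite -rowB; apply: le_lt_trans kP; exact: coord_le_normr.
have [t tP] := choice H.
exists [ffun i => t i], k; split.
  apply: wcode_eq => i z; rewrite !mxE ffunE; have := tP i z.
  by rewrite [2 ^+ k * _]mulrC divfK ?expf_neq0.
move: jP; rewrite exprS invfM => jP.
have -> : 4 * r / 2 ^+ k = 6 * (4 * r * (2^-1 / 2 ^+ k) / 3) by field; rewrite expf_neq0.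
by rewrite ler_pM2l.
Qed.
End one_third_trick.

(** * Double integrals over pairs in a common cell *)

Section pair_sums.
Context d (T : measurableType d) (R : realType) (m : {sigma_finite_measure set T -> \bar R}).
Local Open Scope ereal_scope.

Lemma integral_pair (A : set T) (K : T -> \bar R) (c : R) : measurable A ->
  measurable_fun setT K -> (forall x, 0 <= K x) -> (0 <= c)%R ->
  \int[m \x m]_z ((c * \1_A z.1 * \1_A z.2)%:E * (K z.1 + K z.2)) =
  (2 * c)%:E * (m A * \int[m]_(x in A) K x).
Proof.
move=> mA mKT K0 c0.
have mK B : measurable_fun B K by apply: measurable_funTS.
have IK0 : 0 <= \int[m]_(x in A) K x by apply: integral_ge0.
pose h (z : T * T) := (c * \1_A z.1 * \1_A z.2)%:E * (K z.1 + K z.2).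
have h0 z : 0 <= h z by rewrite mule_ge0 ?adde_ge0// lee_fin !mulr_ge0// indicE.
have mh : measurable_fun setT h.
  apply: emeasurable_funM.
    apply/measurable_EFinP; apply: measurable_funM.
      apply: measurable_funM => //; apply: (measurableT_comp _ measurable_fst).
      exact: measurable_indic.
    apply: (measurableT_comp _ measurable_snd); exact: measurable_indic.
  apply: emeasurable_funD.
    exact: (measurableT_comp mKT measurable_fst).
  exact: (measurableT_comp mKT measurable_snd).
rewrite fubini_tonelli2//.
transitivity (\int[m]_(y in A) (c%:E * (\int[m]_(x in A) K x + K y * m A))).
  rewrite [RHS]integral_mkcond; apply: eq_integral => y _.
  rewrite /fubini_G /patch; case: ifPn => yA; last first.
    by apply: integral0_eq => x _; rewrite /= !indicE (negbTE yA) mulr0 mul0e.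
  transitivity (\int[m]_(x in A) (c%:E * (K x + K y))).
    rewrite [RHS]integral_mkcond; apply: eq_integral => x _.
    rewrite /h /patch /= !indicE yA mulr1; case: ifPn => xA; first by rewrite mulr1.
    by rewrite mulr0 mul0e.
  rewrite ge0_integralZl_EFin//; last 2 first.
  - by move=> x _; rewrite adde_ge0.
  - by apply: emeasurable_funD => //; exact: measurable_cst.
  rewrite ge0_integralD//.
  by congr (_ * (_ + _)); exact: (integral_cst m (mA)).
rewrite ge0_integralZl_EFin//; last 2 first.
- by move=> y _; rewrite adde_ge0// mule_ge0.
- apply: emeasurable_funD; first exact: measurable_cst.
  by apply: emeasurable_funM => //; exact: measurable_cst.
rewrite ge0_integralD//; last 2 first.
- by move=> y _; rewrite mule_ge0.
- by apply: emeasurable_funM => //; exact: measurable_cst.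
rewrite (_ : \int[m]_(x in A) (K x * m A) = m A * \int[m]_(x in A) K x); last first.
  by under eq_integral do rewrite muleC; rewrite ge0_integralZl.
rewrite (_ : \int[m]_(y in A) (\int[m]_(x in A) K x) = m A * \int[m]_(x in A) K x); last first.
  by rewrite muleC; exact: (integral_cst m (mA)).
by rewrite -mule2n -mule_natl muleA -EFinM mulrC.
Qed.

Local Close Scope ereal_scope.
Context (J I : eqType) (ts : seq J) (ws : nat -> seq I) (V : J -> I -> set T)
  (H : J -> nat -> T -> \bar R) (w : nat -> R).
Hypotheses (mV : forall t s, measurable (V t s)) (mH : forall t k, measurable_fun setT (H t k))
  (H0 : forall t k x, (0 <= H t k x)%E) (w0 : forall k, 0 <= w k).
Local Open Scope ereal_scope.

Let h t k s (z : T * T) : \bar R :=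
  (w k * \1_(V t s) z.1 * \1_(V t s) z.2)%:E * (H t k z.1 + H t k z.2).

Let h0 t k s z : 0 <= h t k s z.
Proof. by rewrite mule_ge0 ?adde_ge0// lee_fin !mulr_ge0// indicE. Qed.

Let mh t k s : measurable_fun setT (h t k s).
Proof.
apply: emeasurable_funM.
  apply/measurable_EFinP; apply: measurable_funM.
    apply: measurable_funM => //; apply: (measurableT_comp _ measurable_fst).
    exact: measurable_indic.
  apply: (measurableT_comp _ measurable_snd); exact: measurable_indic.
apply: emeasurable_funD.
  exact: (measurableT_comp (mH t k) measurable_fst).
exact: (measurableT_comp (mH t k) measurable_snd).
Qed.

(** [F] may fail to be measurable: it is first replaced by its measurable majorant, and Tonelli is
    applied to the latter only. *)
Lemma pair_sum_le (D : set T) (F : T * T -> \bar R) : measurable D ->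
  (forall z, 0 <= F z) ->
  (forall x y, D x -> D y -> F (x, y) <= \sum_(t <- ts) \sum_(k <oo) \sum_(s <- ws k)
     (w k * \1_(V t s) x * \1_(V t s) y)%:E * (H t k x + H t k y)) ->
  \int[m]_(y in D) \int[m]_(x in D) F (x, y) <=
  \sum_(t <- ts) \sum_(k <oo) \sum_(s <- ws k)
     (2 * w k)%:E * (m (V t s) * \int[m]_(x in V t s) H t k x).
Proof.
move=> mD F0 FG.
pose G z := \sum_(t <- ts) \sum_(k <oo) \sum_(s <- ws k) h t k s z.
have mG1 t k : measurable_fun setT (fun z => \sum_(s <- ws k) h t k s z).
  by apply: emeasurable_sum.
have mG2 t : measurable_fun setT (fun z => \sum_(k <oo) \sum_(s <- ws k) h t k s z).
  apply: (@ge0_emeasurable_sum _ _ _ _ _ xpredT) => [k z _ _|k _]; last exact: mG1.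
  by apply: sume_ge0.
have mG : measurable_fun setT G by apply: emeasurable_sum.
have G0 z : 0 <= G z.
  by apply: sume_ge0 => t _; apply: nneseries_ge0 => k _ _; apply: sume_ge0.
apply: (@le_trans _ _ (\int[m]_(y in D) \int[m]_(x in D) G (x, y))).
  apply: le_integral_lower => y Dy; first by apply: integral_ge0 => x _.
  by apply: le_integral_lower => x Dx //; exact: FG.
rewrite (iterated_integral_prod m mD mD mG G0).
apply: (@le_trans _ _ (\int[m \x m]_z G z)).
  apply: ge0_subset_integral => //; exact: measurableX.
rewrite /G ge0_integral_sum//; last first.
  by move=> t z _; apply: nneseries_ge0 => k _ _; apply: sume_ge0.
apply: lee_sum => t _; rewrite integral_nneseries//; last first.
  by move=> k z _; apply: sume_ge0.
rewrite le_eqVlt; apply/orP; left; apply/eqP; apply: eq_eseriesr => k _.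
by rewrite ge0_integral_sum//; apply: eq_bigr => s _; exact: integral_pair.
Qed.

End pair_sums.

Section grids.
Context {R : realType} {n : nat}.
Hypothesis n_gt0 : (0 < n)%N.
Local Notation E := 'rV[R]_n.
Local Notation L := (caratheodory_type (@lebesgue_outer_rV R n)).
Local Notation mu := (@lebesgue_rV R n).
Local Notation word := (seq {ffun 'I_n -> bool}).
Variable alpha : R.
Hypothesis alpha_gt0 : 0 < alpha.
Local Notation p := (@Qexp R n alpha).

Definition grid_corner (a : E) (r : R) (t : {ffun 'I_n -> bool}) : E :=
  a - \row_i ((t i)%:R * (4 * r / 3)).

Lemma nneseries_ge_term (u : nat -> \bar R) k : (forall k, 0 <= u k)%E -> (u k <= \sum_(j <oo) u j)%E.
Proof.
move=> u0; apply: le_trans (nneseries_lim_ge k.+1 (fun i _ _ => u0 i)).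
by rewrite big_nat_recr//= leeDr// sume_ge0.
Qed.

Lemma sume_ge_term (I : eqType) (s : seq I) (F : I -> \bar R) (x : I) : x \in s -> uniq s ->
  (forall i, 0 <= F i)%E -> (F x <= \sum_(i <- s) F i)%E.
Proof. by move=> xs us F0; rewrite (bigD1_seq x)//= leeDl// sume_ge0. Qed.

(** Any two distinct points of the cube share a cell of one of the 2 ^ n shifted grids whose side
    [h] is at most six times their distance, so the kernel is at most (6 / h)^p there. Integrating
    one of the variables over the cell gives h^n h^-p = h^(-2 alpha), the scale weight. *)
Lemma Qenergy_le_grids (Q : @cube R n) (g : E -> R)
    (H : {ffun 'I_n -> bool} -> nat -> L -> \bar R) (B : R) :
  let hc t := hcube (grid_corner (corner Q) (side Q) t) (4 * side Q) in
  let wc t := wcode (grid_corner (corner Q) (side Q) t) (4 * side Q) in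
  (forall t k, measurable_fun [set: L] (H t k)) -> (forall t k x, (0 <= H t k x)%E) ->
  (forall t k (x y : E), hc t x -> hc t y -> wc t k x = wc t k y ->
     ((`|g x - g y| ^+ 2)%:E <= H t k x + H t k y)%E) ->
  (forall t, \sum_(k <oo) (scale_weight alpha (4 * side Q) k)%:E *
     \int[mu]_(x in hc t) H t k x <= B%:E)%E ->
  (Qenergy alpha g (cube_set Q) <= (2 ^+ n * (2 * 6 `^ p * B))%:E)%E.
Proof.
move=> hc wc mH H0 HH HB; rewrite /hc /wc in HH HB *.
set r := side Q in HH HB *; set a := corner Q in HH HB *.
have r0 : 0 < r by exact: side_gt0.
have L0 : 0 < 4 * r by rewrite mulr_gt0.
have Qt t x : cube_set Q x -> hcube (grid_corner a r t) (4 * r) x.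
  move=> Qx i; have := Qx i; rewrite /grid_corner !mxE in_itv/= -/r -/a.
  by case: (t i); case: (left_closed Q); case: (right_closed Q) => /=; lra.
have Qcl x i : cube_set Q x -> a ord0 i <= x ord0 i <= a ord0 i + r.
  move=> /(_ i); rewrite in_itv/= -/r -/a.
  by case: (left_closed Q); case: (right_closed Q) => /=; lra.
pose h (k : nat) : R := 4 * r / 2 ^+ k.
have h0 k : 0 < h k by rewrite divr_gt0 ?exprn_gt0.
pose w (k : nat) : R := 6 `^ p / h k `^ p.
have w0 k : 0 <= w k by rewrite mulr_ge0 ?invr_ge0 ?powR_ge0.
have p0 : 0 < p by rewrite addr_gt0 ?ltr0n// mulr_gt0.
pose V (t : {ffun 'I_n -> bool}) (s : word) : set L := cell (grid_corner a r t) (4 * r) s.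
have mV t s : measurable (V t s) by exact: measurable_hcube.
have T0 t k s (x y : E) : (0 <= (w k * \1_(V t s) x * \1_(V t s) y)%:E * (H t k x + H t k y))%E.
  apply: mule_ge0; last by apply: adde_ge0; exact: H0.
  by rewrite lee_fin !indicE mulr_ge0 ?ler0n// mulr_ge0 ?ler0n.
have bnd (x y : L) : cube_set Q x -> cube_set Q y ->
  (Qker alpha g (x, y) <= \sum_(t <- enum {ffun 'I_n -> bool}) \sum_(k <oo) \sum_(s <- @words n k)
     (w k * \1_(V t s) x * \1_(V t s) y)%:E * (H t k x + H t k y))%E.
  move=> Qx Qy; have [->|xy] := eqVneq x y.
    rewrite /Qker /= subrr normr0 expr0n mul0r; apply: sume_ge0 => t _.
    by apply: nneseries_ge0 => k _ _; apply: sume_ge0.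
  have [t [k [xyk hk]]] := one_third r0 xy (fun i => Qcl _ i Qx) (fun i => Qcl _ i Qy).
  apply: le_trans (sume_ge_term (x := t) _ _ _); last 3 first.
  - by rewrite mem_enum.
  - exact: enum_uniq.
  - by move=> t'; apply: nneseries_ge0 => j _ _; apply: sume_ge0.
  apply: le_trans (nneseries_ge_term k _); last by move=> j; apply: sume_ge0.
  apply: le_trans (sume_ge_term (x := wcode (grid_corner a r t) (4 * r) k x) _ _ _); last 3 first.
  - exact: code_words.
  - exact: uniq_words.
  - by move=> s.
  rewrite !indicE !mem_set; last 2 first.
  - rewrite /V /grid_corner xyk; apply: cell_code => //; exact: Qt.
  - by apply: cell_code => //; exact: Qt.
  rewrite !mulr1.
  apply: le_trans (lee_wpmul2l _ (HH t k x y (Qt _ _ Qx) (Qt _ _ Qy) xyk)); last by rewrite lee_fin.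
  rewrite -EFinM lee_fin /= mulrC ler_wpM2r ?exprn_ge0//.
  rewrite /w -powR_div ?(ltW (h0 k)) ?h0// -invf_div powRV ?divr_gt0//.
  apply: powR_inv_le; [by rewrite divr_gt0|exact: ltW|].
  by apply: le_trans (enorm_ge _); rewrite ler_pdivrMr// mulrC.
apply: le_trans (@pair_sum_le _ L R mu _ _ (enum {ffun 'I_n -> bool}) (@words n) V H w
  mV mH H0 w0 (cube_set Q) (Qker alpha g) (measurable_cube_set Q) _ bnd) _.
  by move=> z; exact: Qker_ge0.
apply: (@le_trans _ _ (\sum_(t <- enum {ffun 'I_n -> bool}) (2 * 6 `^ p * B)%:E)%E).
  apply: lee_sum => t _.
  rewrite [leRHS]EFinM; apply: le_trans (lee_wpmul2l _ (HB t)); last by rewrite lee_fin mulr_ge0 ?powR_ge0.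
  rewrite -nneseriesZl; last first.
    move=> k _; rewrite mule_ge0 ?lee_fin ?invr_ge0 ?powR_ge0//; exact: integral_ge0.
  rewrite le_eqVlt; apply/orP; left; apply/eqP; apply: eq_eseriesr => k _.
  rewrite (integral_hcube_words (grid_corner a r t) L0 k (mH t k) (H0 t k)).
  rewrite muleA ge0_sume_distrr; last by move=> s _; exact: integral_ge0.
  rewrite big_seq_cond [RHS]big_seq_cond; apply: eq_bigr => s; rewrite andbT mem_words => /eqP sk.
  rewrite muleA; congr (_ * _)%E.
  rewrite [X in (_ * X)%E](_ : _ = (h k ^+ n)%:E); last first.
    transitivity ((wside (4 * r) s ^+ n)%:E); last by rewrite /wside sk.
    exact: (lebesgue_rV_hcube (wcorner (grid_corner a r t) (4 * r) s) (wside_gt0 s L0)).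
  rewrite -!EFinM; congr _%:E; rewrite /w /scale_weight -/(h k).
  have -> : h k `^ p = h k ^+ n * h k `^ (2 * alpha).
    by rewrite -(powR_mulrn _ (ltW (h0 k))) -powRD//; apply/implyP => _; rewrite gt_eqF.
  by field; rewrite !gt_eqF ?powR_gt0 ?exprn_gt0.
rewrite (sumEFin _ xpredT (fun=> 2 * 6 `^ p * B)) big_enum/= sumr_const card_ffun card_bool card_ord.
by rewrite -[X in X%:E]mulr_natl natrX.
Qed.

End grids.

Section sufficiency_bound.
Context {R : realType} {n : nat}.
Hypothesis n_gt0 : (0 < n)%N.
Local Notation E := 'rV[R]_n.
Local Notation L := (caratheodory_type (@lebesgue_outer_rV R n)).
Local Notation mu := (@lebesgue_rV R n).
Local Notation word := (seq {ffun 'I_n -> bool}).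
Variable alpha : R.
Hypotheses (alpha_gt0 : 0 < alpha) (alpha_lt : alpha < n%:R / 2).
Variables (up dn : R -> R) (phi psi : E -> E).
Hypotheses (updn : distortion up dn) (pK : cancel phi psi) (Kp : cancel psi phi)
  (cphi : continuous phi) (cpsi : ratio_control up dn psi).
Hypothesis lusin : forall A : set E, mu A = 0%E -> mu (psi @^-1` A) = 0%E.

Local Notation beta := (@Qbeta R n alpha).
Local Notation p := (@Qexp R n alpha).

Lemma volume_hcube (a : E) (l : R) : 0 < l -> volume (hcube a l) = l ^+ n.
Proof. by move=> l0; rewrite -[RHS]/(fine (l ^+ n)%:E) -(lebesgue_rV_hcube a l0). Qed.

(** Strictness of the inequality yields an actual test family below the bound. For a half-open root
    the sets of the family are the cells themselves. *)
Lemma word_weights (a : E) (l : R) (l0 : 0 < l) (X : R) :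
  (local_gauge beta phi (Cube a l0 true false) < X%:E)%E ->
  exists lam : word -> R, [/\ forall s, 0 <= lam s,
    forall s, 1 <= \sum_(0 <= i < (size s).+1) lam (drop i s) *
      (@csize R n l (drop i s) / @csize R n l s *
       (pvol phi a l s / pvol phi a l (drop i s))) `^ beta &
    (wsum (fun s => (lam s * (@csize R n l s / @csize R n l [::]) `^ beta)%:E) <= X%:E)%E].
Proof.
move=> /ereal_inf_lt[_ [lam [lam0 lam1] <-] /ltW lamX].
set Q := Cube a l0 true false in lam0 lam1 lamX.
have tE s : tcell Q s = cell a l s.
  by apply/seteqP; split => x /= h i; have := h i; rewrite in_itv.
have D s : dyadic Q (cell a l s) by rewrite dyadic_range -tE; exists s.
have vE s : volume (cell a l s) = csize l s by rewrite volume_hcube// wside_gt0.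
exists (fun s => lam (cell a l s)); split.
- by move=> s; apply: lam0.
- move=> s; have := lam1 _ (D s); rewrite -tE esum_dyadic_sup//; last first.
    by move=> I /lam0 lI; rewrite lee_fin mulr_ge0// powR_ge0.
  rewrite sumEFin lee_fin => /le_trans; apply; rewrite le_eqVlt; apply/orP; left; apply/eqP.
  by apply: eq_bigr => i _; rewrite !tE !vE.
- apply: le_trans lamX; rewrite esum_dyadic//; last first.
    by move=> I /lam0 lI; rewrite lee_fin mulr_ge0// powR_ge0.
  rewrite le_eqVlt; apply/orP; left; apply/eqP; apply: eq_wsum => s.
  rewrite tE vE; congr (_ * (_ / _) `^ _)%:E.
  by rewrite -vE cell_nil -cell_nil -tE /tcell volume_cube volume_cube /= /wside expr0 divr1.
Qed.

(** The factors are, in this order, the number of grids, the kernel on a cell, the majorant, the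
    jumps of the centres and the oscillation sum; the last one pays for roots four times as large as
    the cube. *)
Definition sufficiency_const : R :=
  2 ^+ n * (2 * 6 `^ p * (2 * tauA alpha * tauA alpha * (@jump_const R n up * @suff_const R n alpha up)))
    * (4 ^+ n) `^ beta.

Lemma sufficiency_const_ge0 : 0 <= sufficiency_const.
Proof.
have d0 : 0 < @doubling_const R n up 4 by exact: (@doubling_const_gt0 R n up dn updn 4 (ltr0n R 4)).
have J : 0 <= @jump_const R n up.
  by rewrite /jump_const mulr_ge0 ?mulr_ge0 ?addr_ge0 ?(ltW d0).
have S : 0 <= @suff_const R n alpha up.
  exact: (suff_const_ge0 n_gt0 alpha_gt0 updn pK Kp cphi cpsi).
have T := tauA_ge0 alpha_gt0.
rewrite /sufficiency_const; move: J S T; move: (jump_const _) (suff_const _ _) (tauA _) => j q t j0 q0 t0.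
by rewrite !mulr_ge0 ?exprn_ge0 ?powR_ge0.
Qed.

Theorem sufficiency_bound (f : E -> R) (N X : R) : measurable_fun [set: L] f ->
  0 <= N -> (Qnorm alpha f <= N%:E)%E -> 0 <= X ->
  (forall Q : @cube R n, (local_gauge beta phi Q < X%:E)%E) ->
  (Qnorm alpha (f \o psi) <= (Num.sqrt (sufficiency_const * X) * N)%:E)%E.
Proof.
move=> mf N0 fN X0 GX.
have CX0 : 0 <= sufficiency_const * X by rewrite mulr_ge0// sufficiency_const_ge0.
apply: Qnorm_le; first by rewrite mulr_ge0// sqrtr_ge0.
move=> Q; set r := side Q; set a := corner Q.
have r0 : 0 < r by exact: side_gt0.
have L0 : 0 < 4 * r by rewrite mulr_gt0.
pose B : R := 2 * tauA alpha * tauA alpha *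
  (@jump_const R n up * (@suff_const R n alpha up * N ^+ 2 * @csize R n (4 * r) [::] `^ beta * X)).
have /choice[H HP] : forall t, exists H : nat -> L -> \bar R,
  [/\ forall k, measurable_fun [set: L] (H k), forall k x, (0 <= H k x)%E,
    forall k (x y : E), hcube (grid_corner a r t) (4 * r) x -> hcube (grid_corner a r t) (4 * r) y ->
      wcode (grid_corner a r t) (4 * r) k x = wcode (grid_corner a r t) (4 * r) k y ->
      ((`|f (psi x) - f (psi y)| ^+ 2)%:E <= H k x + H k y)%E &
    (\sum_(k <oo) (scale_weight alpha (4 * r) k)%:E * \int[mu]_(x in hcube (grid_corner a r t) (4 * r)) H k x <= B%:E)%E].
  move=> t; have [lam [lam0 lam1 lamX]] := word_weights (GX (Cube (grid_corner a r t) L0 true false)).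
  have [c cP] := centers_exist n_gt0 alpha_gt0 alpha_lt updn pK Kp cphi cpsi mf (grid_corner a r t) L0 N0 fN.
  exact: (root_majorant n_gt0 alpha_gt0 alpha_lt updn pK Kp cphi cpsi mf L0 N0 fN cP lam0 lam1 lamX lusin).
apply: le_trans (Qenergy_le_grids (H := H) (B := B) n_gt0 alpha_gt0 _ _ _ _) _.
- by move=> t k; have [] := HP t.
- by move=> t k x; have [_ + _ _] := HP t; exact.
- by move=> t; have [_ _ + _] := HP t; exact.
- by move=> t; have [_ _ _ +] := HP t; exact.
rewrite lee_fin exprMn sqr_sqrtr// /B /sufficiency_const.
have -> : @csize R n (4 * r) [::] `^ beta = (4 ^+ n) `^ beta * (r ^+ n) `^ beta.
  by rewrite /csize /wside expr0 divr1 exprMn powRM ?exprn_ge0// ltW.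
rewrite le_eqVlt; apply/orP; left; apply/eqP; ring.
Qed.

End sufficiency_bound.

(** * Null sets *)

Section rows.
Context {n : nat} (i0 : 'I_n).
Local Notation word := (seq {ffun 'I_n -> bool}).

Definition set_digit (e : {ffun 'I_n -> bool}) (b : bool) : {ffun 'I_n -> bool} :=
  [ffun i => if i == i0 then b else e i].

(** The cells in the row through [r] in direction [i0]: all digits in this direction vary, the
    others are those of [r]. *)
Fixpoint row_words (r : word) : seq word :=
  if r is e :: r' then [seq set_digit e false :: w | w <- row_words r'] ++
    [seq set_digit e true :: w | w <- row_words r']
  else [:: [::]].

Lemma mem_row_words r w : w \in row_words r ->
  size w = size r /\ forall j, j != i0 -> wpos w j = wpos r j.
Proof.
elim: r w => [|e r IH] w /=; first by rewrite inE => /eqP ->.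
by rewrite mem_cat => /orP[] /mapP[w' /IH[sw H] ->]; rewrite /= sw; split => // j ji;
  rewrite ffunE (negbTE ji) H.
Qed.

(** When [r] runs over all words, every row occurs once for each of its 2 ^ k members; this is the
    multiplicity. *)
Lemma sum_row_words {V : nmodType} (F : word -> V) k :
  \sum_(r <- @words n k) \sum_(w <- row_words r) F w = (\sum_(w <- @words n k) F w) *+ 2 ^ k.
Proof.
elim: k F => [|k IH] F; first by rewrite /= !big_seq1 mulr1n.
rewrite /= !big_allpairs_dep /=.
pose G w := \sum_(e <- enum {ffun 'I_n -> bool}) (F (set_digit e false :: w) + F (set_digit e true :: w)).
transitivity (\sum_(r <- @words n k) \sum_(w <- row_words r) G w).
  apply: eq_bigr => r _; rewrite /G exchange_big /=; apply: eq_bigr => e _.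
  by rewrite big_cat !big_map /= -big_split.
rewrite IH expnS mulrnA; congr (_ *+ _).
rewrite -sumrMnl; apply: eq_bigr => w _; rewrite /G big_split /= mulr2n.
pose flip (e : {ffun 'I_n -> bool}) := set_digit e (~~ e i0).
have fK : involutive flip.
  by move=> e; apply/ffunP => i; rewrite !ffunE eqxx; case: eqP => // ->; rewrite negbK.
have E e : F (set_digit e false :: w) + F (set_digit e true :: w) = F (e :: w) + F (flip e :: w).
  have H : set_digit e (e i0) = e by apply/ffunP => i; rewrite ffunE; case: eqP => // ->.
  by rewrite /flip -{3}H; case: (e i0) => //=; rewrite addrC.
rewrite -big_split /= (eq_bigr _ (fun e _ => E e)) big_split /=; congr (_ + _).
rewrite !big_enum /= (reindex_inj (inv_inj fK)) /=; apply: eq_bigr => e _; by rewrite fK.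
Qed.

End rows.

Section row_length.
Context {R : realType} {n : nat}.
Hypothesis n_gt0 : (0 < n)%N.
Local Notation E := 'rV[R]_n.
Local Notation L := (caratheodory_type (@lebesgue_outer_rV R n)).
Local Notation mu := (@lebesgue_rV R n).
Local Notation word := (seq {ffun 'I_n -> bool}).
Variables (up dn : R -> R) (phi psi : E -> E).
Hypotheses (updn : distortion up dn) (pK : cancel phi psi) (Kp : cancel psi phi)
  (cphi : continuous phi) (cpsi : ratio_control up dn psi).
Variables (a : E) (l : R).
Hypothesis l0 : 0 < l.
Local Notation v := (pvol phi a l).

Let i0 := Ordinal n_gt0.
Let u1 : 0 < up 1. Proof. exact: updn.1. Qed.

Let vdiam s := v s `^ n%:R^-1.

Let vdiam_gt0 s : 0 < vdiam s.
Proof. by apply: powR_gt0; exact: (pvol_gt0 n_gt0 updn pK Kp cpsi). Qed.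

Let vdiamX s : vdiam s ^+ n = v s.
Proof.
rewrite -powR_mulrn ?ltW// -powRrM mulVf ?pnatr_eq0 ?gt_eqF// powRr1// ltW//.
exact: (pvol_gt0 n_gt0 updn pK Kp cpsi).
Qed.

Let slide (y : E) (t : R) : E := \row_j (if j == i0 then t else y ord0 j).

(** The distance between the images of the points at which the line through [y] in direction [i0]
    enters and leaves the slab of [w]. *)
Let len y (w : word) :=
  `|psi (slide y (wcorner a l w ord0 i0)) - psi (slide y (wcorner a l w ord0 i0 + wside l w))|.

Let len_row (y : E) r : len y [::] <= \sum_(w <- row_words i0 r) len y w.
Proof.
elim: r => [|e r IH]; first by rewrite /= big_seq1.
apply: le_trans IH _; rewrite /= big_cat !big_map /= -big_split /=; apply: ler_sum => w _.
rewrite /len !wcorner_cons !wside_cons !ffunE eqxx mulr0 addr0 mulr1.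
have -> : wcorner a l w ord0 i0 + wside l w / 2 + wside l w / 2 = wcorner a l w ord0 i0 + wside l w.
  by lra.
exact: ler_distD.
Qed.

Let len_le (y : E) w : (forall j, j != i0 -> y ord0 j = wcorner a l w ord0 j) ->
  len y w <= up 1 ^+ 2 * vdiam w.
Proof.
move=> yw; have s0 := wside_gt0 w l0; have h0 : 0 < wside l w / 2 by lra.
set c := wcenter a l w.
have rho_le : image_radius psi c (wside l w / 2) <= up 1 / 2 * vdiam w.
  have r0 : 0 <= image_radius psi c (wside l w / 2) by exact: normr_ge0.
  have r1 : 0 <= up 1 / 2 * vdiam w by rewrite mulr_ge0 ?divr_ge0 ?(ltW u1) ?(ltW (vdiam_gt0 w)).
  rewrite -(ler_pXn2r n_gt0) ?nnegrE// exprMn vdiamX.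
  have H : (2 * ((up 1)^-1 * image_radius psi c (wside l w / 2))) ^+ n <= v w.
    rewrite -lee_fin -(pvol_fin n_gt0 updn pK cpsi a l0).
    exact: (preimage_volume_ge n_gt0 updn pK Kp cpsi h0 (@ball_sub_cell _ _ a l w ^~ l0)).
  apply: le_trans (ler_wpM2l _ H); last by rewrite exprn_ge0 ?divr_ge0 ?(ltW u1).
  rewrite -exprMn le_eqVlt; apply/orP; left; apply/eqP; congr (_ ^+ _).
  by field; rewrite gt_eqF.
have near t : `|t - (wcorner a l w ord0 i0 + wside l w / 2)| <= wside l w / 2 ->
    `|psi (slide y t) - psi c| <= up 1 * image_radius psi c (wside l w / 2).
  move=> ht; apply: (image_dist_le n_gt0 cpsi ltr01 h0); rewrite mul1r; apply/normr_le_rV; first exact: ltW.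
  move=> j; rewrite rowB wcenterE mxE; case: eqVneq => [->//|/yw ->].
  by rewrite ler_norml; lra.
apply: (@le_trans _ _ (up 1 * image_radius psi c (wside l w / 2) + up 1 * image_radius psi c (wside l w / 2))).
  apply: le_trans (ler_distD (psi c) _ _) _; apply: lerD; last rewrite distrC; apply: near; rewrite ler_norml; lra.
have -> : up 1 ^+ 2 * vdiam w = up 1 * (up 1 / 2 * vdiam w) + up 1 * (up 1 / 2 * vdiam w) by lra.
by apply: lerD; rewrite ler_wpM2l// ltW.
Qed.

(** With [x] and [z] the ends of the segment, every point of the root is within [l = |x - z|] of
    [x], so the preimage of the root lies in the ball of radius [up 1 * |psi x - psi z|] about
    [psi x]. *)
Let len_ge (y : E) : (forall j, j != i0 -> a ord0 j <= y ord0 j <= a ord0 j + l) ->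
  vdiam [::] <= 2 * up 1 * len y [::].
Proof.
move=> ya; rewrite /len /wside /= divr1.
have -> : wcorner a l [::] ord0 i0 = a ord0 i0 by rewrite !mxE/= mulr0 addr0.
set x := slide y _; set z := slide y _.
have xz : `|x - z| = l.
  apply/eqP; rewrite eq_le; apply/andP; split.
    apply/normr_le_rV; first exact: ltW.
    move=> j; rewrite rowB !mxE; case: eqP => _; last by rewrite subrr normr0 ltW.
    by rewrite opprD addNKr normrN gtr0_norm.
  by have := coord_le_normr (x - z) i0; rewrite rowB !mxE eqxx opprD addNKr normrN gtr0_norm.
have D0 : 0 <= up 1 * `|psi x - psi z| by rewrite mulr_ge0// ltW.
rewrite -mulrA -(ler_pXn2r n_gt0) ?nnegrE ?(ltW (vdiam_gt0 _)) ?(mulr_ge0 _ D0)// vdiamX.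
rewrite -lee_fin -(pvol_fin n_gt0 updn pK cpsi a l0) -(lebesgue_rV_closed_ball (psi x) D0).
apply: le_lebesgue_rV => u; rewrite /pcell /= cell_nil => hu.
rewrite -(pK u) distrC; apply: cpsi.1 => //; rewrite mul1r xz.
apply/normr_le_rV; first exact: ltW.
by move=> j; have := hu j; rewrite rowB mxE; case: eqVneq => [->|/ya]; rewrite ler_norml; lra.
Qed.

Let row_const := 2 * up 1 ^+ 3.

Let vdiam_sum k : vdiam [::] * 2 ^+ k ^+ n <= row_const * 2 ^+ k * \sum_(w <- @words n k) vdiam w.
Proof.
have -> : (2 ^+ k : R) ^+ n = \sum_(r <- @words n k) 1.
  by rewrite big_const_seq count_predT size_words iter_addr_0 -natrX -natrX -expnM -expnM mulnC.
rewrite mulr_sumr -mulrA -[2 ^+ k](natrX R 2) mulr_natl -(sum_row_words i0) mulr_sumr !big_seq.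
apply: ler_sum => r _; rewrite mulr1.
have yr (j : 'I_n) : j != i0 -> a ord0 j <= wcorner a l r ord0 j <= a ord0 j + l.
  move=> _; have H : cell a l r (wcorner a l r).
    by move=> i; have := wside_gt0 r l0; lra.
  by have := cell_sub_nil l0 H j; lra.
apply: le_trans (len_ge yr) _.
have -> : row_const = 2 * up 1 * up 1 ^+ 2 by rewrite /row_const; ring.
rewrite -[leRHS]mulrA; apply: ler_wpM2l; first by rewrite mulr_ge0 ?(ltW u1).
apply: le_trans (len_row _ r) _.
rewrite mulr_sumr !big_seq; apply: ler_sum => w /mem_row_words[sw wr].
by apply: len_le => j /wr E; rewrite !mxE sw E.
Qed.

(** Young's inequality in a form where the parameter [t] can be taken large on few cells and small
    on cells of little total mass. *)
Let young (t x : R) : 0 < t -> 0 <= x -> x <= t + x ^+ n / t ^+ n.-1.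
Proof.
move=> t0 x0; have [xt|tx] := leP x t.
  by rewrite ler_wpDr// divr_ge0 ?exprn_ge0// ltW.
rewrite ler_wpDl ?(ltW t0)// ler_pdivlMr ?exprn_gt0// -[in leRHS](prednK n_gt0) exprS.
by rewrite ler_pM2l ?(lt_trans t0)//= lerXn2r ?nnegrE ?(ltW t0) ?(ltW tx).
Qed.

Let vdiam_sum_le (P : pred word) k (T c g : R) : 0 < T ->
  \sum_(w <- @words n k | P w) 1 <= c * 2 ^+ k ^+ n ->
  \sum_(w <- @words n k | P w) v w <= g * v [::] ->
  \sum_(w <- @words n k | P w) vdiam w <= (c * T + g / T ^+ n.-1) * (vdiam [::] * 2 ^+ k ^+ n / 2 ^+ k).
Proof.
move=> T0 Pc Pg; set h : R := 2 ^+ k; set d := vdiam [::].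
have h0 : 0 < h by rewrite exprn_gt0.
have d0 : 0 < d by exact: vdiam_gt0.
have t0 : 0 < T * d / h by rewrite divr_gt0// mulr_gt0.
apply: (@le_trans _ _ (T * d / h * \sum_(w <- @words n k | P w) 1
    + (\sum_(w <- @words n k | P w) v w) / (T * d / h) ^+ n.-1)).
  rewrite mulr_sumr mulr_suml -big_split /=; apply: ler_sum => w _.
  by rewrite mulr1 -vdiamX; exact: (young t0 (ltW (vdiam_gt0 w))).
apply: (@le_trans _ _ (T * d / h * (c * h ^+ n) + (g * v [::]) / (T * d / h) ^+ n.-1)).
  by apply: lerD; [rewrite ler_pM2l|rewrite ler_pM2r// invr_gt0 exprn_gt0].
rewrite -vdiamX -/d -(prednK n_gt0) /= !exprS !exprMn exprVn le_eqVlt; apply/orP; left; apply/eqP.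
have := exprn_gt0 n.-1 T0; have := exprn_gt0 n.-1 h0; have := exprn_gt0 n.-1 d0.
move: (T ^+ _) (h ^+ _) (d ^+ _) => A B C C0 B0 A0.
by field; rewrite !gt_eqF.
Qed.

Lemma measure_preimage_words k (A : set E) : measurable (A : set L) ->
  mu (A `&` phi @^-1` hcube a l) = (\sum_(w <- @words n k) mu (A `&` pcell phi a l w))%E.
Proof.
move=> mA.
have mI : measurable_fun [set: L] (fun x : L => (\1_(A : set L) x : R)%:E).
  by apply/measurable_EFinP; exact: measurable_indic.
have := @integral_preimage_words R n phi cphi a l l0 k _ mI (fun x => ltac:(by rewrite lee_fin indicE)).
rewrite (@integral_indic _ L R mu)//; last first.
  rewrite -cell_nil; exact: (measurable_pcell cphi a l [::]).
move=> ->; apply: eq_bigr => s _; rewrite (@integral_indic _ L R mu)//.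
exact: measurable_pcell.
Qed.

Lemma pvol_words k : \sum_(w <- @words n k) v w = v [::].
Proof.
apply: EFin_inj; rewrite -sumEFin -(pvol_fin n_gt0 updn pK cpsi a l0 [::]).
have := measure_preimage_words k (@measurableT _ L); rewrite -cell_nil setTI => ->.
by apply: eq_bigr => s _; rewrite setTI (pvol_fin n_gt0 updn pK cpsi a l0).
Qed.

(** With K = row_const + 1, both thresholds are calibrated for the parameter 5 K on the few cells
    and 1 / (5 K) on the others: in units of the normalised row sum the two parts then contribute at
    most 2 / (5 K) and 3 / (5 K), together 1 / K, less than the required 1 / row_const. *)
Definition small_count : R := (25 * (row_const + 1) ^+ 2)^-1.
Definition small_mass : R := 1 - 2 / (5 * (row_const + 1)) ^+ n.

(* Each row of cells joins two opposite faces, so its diameters add up to at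
   least the diameter of the cube; by Young's inequality this fails if few cells
   carry almost all of the mass. *)
Lemma mass_concentration (P : pred word) k : (1 < n)%N ->
  \sum_(w <- @words n k | P w) 1 <= small_count * 2 ^+ k ^+ n ->
  \sum_(w <- @words n k | P w) v w <= small_mass * v [::].
Proof.
move=> n1 Pc; rewrite leNgt; apply/negP => Pm.
set K := row_const + 1; have K0 : 0 < K by rewrite ltr_wpDl// mulr_ge0// exprn_ge0 ?ltW.
have T0 : 0 < 5 * K by rewrite mulr_gt0.
have vT : \sum_(w <- @words n k) v w = v [::] by exact: pvol_words.
have v0 := pvol_gt0 n_gt0 updn pK Kp cpsi a l0.
have vP : \sum_(w <- @words n k | P w) v w <= 1 * v [::].
  by rewrite mul1r -vT [leRHS](bigID P)/= lerDl sumr_ge0// => w _; exact/ltW.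
have vN : \sum_(w <- @words n k | ~~ P w) v w <= (1 - small_mass) * v [::].
  by rewrite mulrBl mul1r -{1}vT [in leRHS](bigID P)/=; lra.
have cN : \sum_(w <- @words n k | ~~ P w) (1 : R) <= 1 * 2 ^+ k ^+ n.
  rewrite mul1r; apply: (@le_trans _ _ (\sum_(w <- @words n k) 1)).
    by rewrite [leRHS](bigID P)/= lerDr sumr_ge0.
  by rewrite big_const_seq count_predT size_words iter_addr_0 -natrX -natrX -expnM -expnM mulnC.
have H1 := vdiam_sum_le T0 Pc vP.
have Ti0 : 0 < (5 * K)^-1 by rewrite invr_gt0.
have H2 := vdiam_sum_le Ti0 cN vN.
have := vdiam_sum k; rewrite (bigID P) /=.
have M0 : 0 < vdiam [::] * 2 ^+ k ^+ n / 2 ^+ k by rewrite divr_gt0 ?mulr_gt0 ?vdiam_gt0 ?exprn_gt0.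
rewrite mulrAC -ler_pdivrMr ?exprn_gt0//.
move: H1 H2 M0; set M := vdiam [::] * _ / _ => H1 H2 M0; apply/negP; rewrite -ltNge.
apply: le_lt_trans (ler_wpM2l _ (lerD H1 H2)) _; first by rewrite mulr_ge0 ?exprn_ge0 ?(ltW u1).
have K1 : 1 <= 5 * K.
  by have : 0 <= row_const by [rewrite mulr_ge0 ?exprn_ge0 ?(ltW u1)]; rewrite /K; lra.
(* This is where n > 1 enters: the exponent n - 1 is at least 1. *)
have P1 : 1 / (5 * K) ^+ n.-1 <= (5 * K)^-1.
  rewrite div1r lef_pV2 ?posrE ?exprn_gt0// -[n.-1]prednK; last by rewrite -subn1 subn_gt0.
  by rewrite exprS ler_peMr ?(ltW T0)// exprn_ege1.
have E1 : small_count * (5 * K) = (5 * K)^-1.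
  by rewrite /small_count -/K; field; rewrite gt_eqF.
have E2 : (1 - small_mass) / (5 * K)^-1 ^+ n.-1 = 2 / (5 * K).
  rewrite /small_mass -/K -{1}(prednK n_gt0) exprS exprVn.
  by have := exprn_gt0 n.-1 T0; move: (_ ^+ _) => t t0; field; rewrite !gt_eqF.
rewrite mul1r E1 E2 -mulrDl mulrA -[ltRHS]mul1r ltr_pM2r//.
apply: (@le_lt_trans _ _ (row_const * (5 / (5 * K)))).
  apply: ler_wpM2l; first by rewrite mulr_ge0 ?exprn_ge0 ?(ltW u1).
  by move: P1; lra.
rewrite (_ : 5 / (5 * K) = K^-1); last by field; rewrite gt_eqF.
by rewrite ltr_pdivrMr// mul1r ltrDl.
Qed.

End row_length.

(** * Preservation of null sets *)

Section lusin.
Context {R : realType} {n : nat}.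
Hypothesis n_gt0 : (0 < n)%N.
Local Notation E := 'rV[R]_n.
Local Notation L := (caratheodory_type (@lebesgue_outer_rV R n)).
Local Notation mu := (@lebesgue_rV R n).
Local Notation word := (seq {ffun 'I_n -> bool}).

Lemma measure_hcube_words (a : E) (l : R) (l0 : 0 < l) k (A : set E) : measurable (A : set L) ->
  mu (A `&` hcube a l) = (\sum_(w <- @words n k) mu (A `&` cell a l w))%E.
Proof.
move=> mA.
have mI : measurable_fun [set: L] (fun x : L => (\1_(A : set L) x : R)%:E).
  by apply/measurable_EFinP; exact: measurable_indic.
have := @integral_hcube_words R n a l l0 k _ mI (fun x => ltac:(by rewrite lee_fin indicE)).
rewrite (@integral_indic _ L R mu)//; last exact: measurable_hcube.
move=> ->; apply: eq_bigr => s _; rewrite (@integral_indic _ L R mu)//.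
exact: measurable_hcube.
Qed.

Variables (up dn : R -> R) (phi psi : E -> E).
Hypotheses (updn : distortion up dn) (pK : cancel phi psi) (Kp : cancel psi phi)
  (cphi : continuous phi) (psi_cont : continuous psi) (cpsi : ratio_control up dn psi).

Lemma small_count_gt0 : 0 < @small_count R up.
Proof. by rewrite invr_gt0 mulr_gt0// exprn_gt0// ltr_wpDl// mulr_ge0// exprn_ge0// ltW// updn.1. Qed.

Lemma small_mass_lt1 : 0 <= @small_mass R n up /\ @small_mass R n up < 1.
Proof.
have K1 : 5 <= 5 * (2 * up 1 ^+ 3 + 1) :> R.
  have : 0 <= up 1 ^+ 3 by rewrite exprn_ge0// ltW// updn.1.
  by lra.
rewrite /small_mass; set K := 5 * _ in K1 *; have K0 : 0 < K by lra.
split; last by rewrite ltrBlDr ltrDl divr_gt0// exprn_gt0.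
rewrite subr_ge0 ler_pdivrMr ?exprn_gt0// mul1r -(prednK n_gt0) exprS.
apply: (@le_trans _ _ (K * 1)); first lra.
by rewrite ler_pM2l// exprn_ege1//; lra.
Qed.

Section exhaustion.
Variables (a : E) (l : R).
Hypothesis l0 : 0 < l.
Variables (A U : set E).
Hypotheses (mA : measurable (A : set L)) (oU : open U).

Let P (w : word) := `[< cell a l w `<=` U >].
Let F k : set L := A `&` \big[setU/set0]_(w <- @words n k | P w) pcell phi a l w.

Let memF k u : F k u <-> [/\ A u, hcube a l (phi u) & cell a l (wcode a l k (phi u)) `<=` U].
Proof.
rewrite /F -bigcup_seq_cond; split.
  case=> Au [w /= /andP[]]; rewrite mem_words => /eqP wk /asboolP wU uw; split => //.
    exact: cell_sub_nil uw.
  by rewrite -wk (code_cell l0 uw).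
case=> Au Hu cU; split=> //; exists (wcode a l k (phi u)) => /=.
  by rewrite code_words /=; apply/asboolP.
exact: cell_code.
Qed.

(** Inside the root, an open set is the increasing union of the cells it contains, so continuity
    from below reduces the bound to single levels. *)
Lemma exhaustion_le (B : \bar R) :
  (forall k, (\sum_(w <- @words n k | `[< cell a l w `<=` U >]) mu (A `&` pcell phi a l w) <= B)%E) ->
  (mu (A `&` phi @^-1` (hcube a l `&` U)) <= B)%E.
Proof.
move=> HB.
have mF k : measurable (F k).
  apply: measurableI => //; apply: bigsetU_measurable => w _; exact: measurable_pcell.
have homoF : {homo F : j k / (j <= k)%N >-> (j <= k)%O}.
  apply: homo_leq => [s|s t u|k]; [exact: lexx|exact: le_trans|].
  apply/subsetPset => u /memF[Au Hu cU]; apply/memF; split => //.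
  apply: subset_trans cU; exact: (@cell_sub _ _ a l [:: _]).
have FU : A `&` phi @^-1` (hcube a l `&` U) = \bigcup_k F k.
  apply/seteqP; split => u.
    case=> Au [Hu /= Uu]; have [e e0 eU] := (open_rVP U).1 oU _ Uu.
    have [k hk] : exists k, l / 2 ^+ k < e.
      exists (Num.truncn (l / e)).+1; rewrite ltr_pdivrMr ?exprn_gt0// -ltr_pdivrMl// mulrC.
      apply: lt_le_trans (truncnS_gt _) _; rewrite -natrX ler_nat; exact/ltnW/ltn_expl.
    exists k => //; apply/memF; split => // x cx; apply: eU.
    have := cell_code k l0 Hu => cu.
    apply: le_lt_trans hk; apply/normr_le_rV; first by rewrite divr_ge0 ?exprn_ge0 ?ltW.
    move=> i; have := cx i; have := cu i; rewrite /wside size_code rowB ler_norml; lra.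
  case=> k _ /memF[Au Hu cU]; split => //; split => //=.
  exact: cU (cell_code k l0 Hu).
rewrite FU.
have mUF : measurable (\bigcup_k F k) by exact: bigcupT_measurable.
have cv := @nondecreasing_cvg_mu _ L R mu F mF mUF homoF.
rewrite -(cvg_lim _ cv)//; apply: lime_le; first by apply/cvg_ex; eexists; exact: cv.
apply: nearW => k /=; apply: le_trans (HB k); rewrite big_mkcond /=.
have -> : mu (F k) = mu (F k `&` phi @^-1` hcube a l).
  by congr (mu _); apply/seteqP; split => [u Fu|u []//]; split => //; case/memF: Fu.
rewrite (measure_preimage_words cphi a l0 k (mF k)) big_seq [leRHS]big_seq.
apply: lee_sum => w; rewrite mem_words => /eqP wk.
case: asboolP => [_|nU]; first by apply: le_lebesgue_rV => u [/memF[]].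
rewrite (_ : F k `&` _ = set0) ?(@measure0 _ L)//; apply/seteqP; split => // u [/memF[_ _ cU] uw].
by apply: nU; move: cU; rewrite -{1}wk (code_cell l0 uw).
Qed.
End exhaustion.

(** An open neighbourhood of [N] of measure at most [small_count * l ^+ n] contains at most the
    fraction [small_count] of the cells of any level, so [mass_concentration] applies uniformly in
    the level. *)
Lemma null_preimage_fraction (a : E) (l : R) (N : set E) : (1 < n)%N -> 0 < l ->
  mu N = 0%E -> measurable (phi @^-1` N : set L) ->
  (mu (phi @^-1` N `&` pcell phi a l [::]) <= (@small_mass R n up * pvol phi a l [::])%:E)%E.
Proof.
move=> n1 l0 N0 mN.
have c0 : 0 < @small_count R up by exact: small_count_gt0.
have e0 : 0 < @small_count R up * l ^+ n by rewrite mulr_gt0 ?exprn_gt0.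
have Noo : (mu N < +oo)%E by rewrite N0.
have [U [oU NU]] := lebesgue_rV_outer_regular e0 Noo; rewrite N0 add0e => Ue.
apply: (@le_trans _ _ (mu (phi @^-1` N `&` phi @^-1` (hcube a l `&` U)))).
  apply: le_lebesgue_rV => u [Nu]; rewrite /pcell cell_nil => au; split => //; split => //=; exact: NU.
apply: exhaustion_le => // k.
apply: (@le_trans _ _ (\sum_(w <- @words n k | `[< cell a l w `<=` U >]) (pvol phi a l w)%:E)%E).
  apply: lee_sum => w _; rewrite -(pvol_fin n_gt0 updn pK cpsi a l0).
  by apply: le_lebesgue_rV; exact: subIsetr.
rewrite sumEFin lee_fin; apply: (mass_concentration n_gt0 updn pK Kp cphi cpsi a l0 n1).
have ln0 : 0 < l ^+ n by rewrite exprn_gt0.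
rewrite -(ler_pM2r ln0) mulrAC -ler_pdivrMr ?exprn_gt0//.
rewrite -mulrA -expr_div_n mulr_suml -lee_fin -sumEFin.
apply: le_trans Ue.
have mU : measurable (U : set L) by exact: open_lebesgue_measurable.
apply: (@le_trans _ _ (mu (U `&` hcube a l))); last by apply: le_lebesgue_rV; exact: subIsetl.
rewrite (measure_hcube_words a l0 k mU) big_seq_cond big_mkcondr /= [leRHS]big_seq.
apply: lee_sum => w; rewrite mem_words => /eqP wk; case: asboolP => [wU|_] //.
rewrite mul1r -wk -/(wside l w) -(lebesgue_rV_hcube (wcorner a l w) (wside_gt0 w l0)).
by apply: le_lebesgue_rV => x xw; split => //; exact: wU.
Qed.

Lemma null_preimage_cube (a : E) (l : R) (N : set E) : (1 < n)%N -> 0 < l ->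
  mu N = 0%E -> measurable (phi @^-1` N : set L) ->
  mu (phi @^-1` N `&` phi @^-1` hcube a l) = 0%E.
Proof.
move=> n1 l0 N0 mN; set A := phi @^-1` N.
have [q0 q1] : 0 <= @small_mass R n up /\ @small_mass R n up < 1 by exact: small_mass_lt1.
set m := mu _; have m0 : (0 <= m)%E by exact: lebesgue_outer_rV_ge0.
have mfin : m \is a fin_num.
  rewrite ge0_fin_numE//; apply: (@le_lt_trans _ _ (mu (pcell phi a l [::]))).
    by apply: le_lebesgue_rV; rewrite /pcell cell_nil; exact: subIsetr.
  by rewrite (pvol_fin n_gt0 updn pK cpsi a l0) ltry.
have key e : 0 < e -> fine m <= @small_mass R n up * (fine m + e).
  move=> e0; have moo : (m < +oo)%E by rewrite ltey_eq mfin.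
  have [W [oW AW mW]] := lebesgue_rV_outer_regular e0 moo.
  have psiW : open (psi @^-1` W) by move/continuousP : psi_cont; exact.
  have mmW : measurable (W : set L) by exact: open_lebesgue_measurable.
  rewrite -lee_fin [leRHS]EFinM (EFinD (fine m) e) fineK//.
  apply: le_trans (lee_wpmul2l _ mW); last by rewrite lee_fin.
  apply: (@le_trans _ _ (mu (A `&` phi @^-1` (hcube a l `&` psi @^-1` W)))).
    apply: le_lebesgue_rV => u [Au Hu]; split => //; split => //=; rewrite pK; exact: AW.
  apply: exhaustion_le => // k.
  apply: (@le_trans _ _ (\sum_(w <- @words n k | `[< cell a l w `<=` psi @^-1` W >])
      (@small_mass R n up * pvol phi a l w)%:E)%E).
    apply: lee_sum => w _.
    have := null_preimage_fraction (wcorner a l w) n1 (wside_gt0 w l0) N0 mN.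
    by rewrite -pcell_cat -pvol_cat.
  under eq_bigr do rewrite EFinM.
  rewrite -ge0_sume_distrr; last by move=> w _; rewrite lee_fin (ltW (pvol_gt0 n_gt0 updn pK Kp cpsi a l0 w)).
  apply: (@lee_wpmul2l _ (@small_mass R n up)%:E); first by rewrite lee_fin.
  apply: (@le_trans _ _ (mu (W `&` phi @^-1` hcube a l))); last by apply: le_lebesgue_rV; exact: subIsetl.
  rewrite (measure_preimage_words cphi a l0 k mmW) big_mkcond; apply: lee_sum => w _.
  case: asboolP => [wU|_]; last exact: lebesgue_outer_rV_ge0.
  rewrite -(pvol_fin n_gt0 updn pK cpsi a l0); apply: le_lebesgue_rV => u uw; split => //.
  by have := wU _ uw; rewrite /= pK.
have f0 : 0 <= fine m by exact: fine_ge0.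
suff : fine m <= 0.
  by move=> f1; rewrite -(fineK mfin); congr _%:E; apply/le_anti/andP.
have {}key : fine m <= @small_mass R n up * fine m.
  apply/ler_addgt0Pr => e e0; apply: le_trans (key _ e0) _.
  by rewrite mulrDr lerD2l ler_piMl// ltW.
by move: key q0 q1 f0; move: (fine m) (@small_mass R n up) => x q; nra.
Qed.

(* A null set fills at most a fixed fraction [q < 1] of the image of any cube;
   applied inside the cells of an almost optimal open neighbourhood of the image
   this gives [m <= q * m] for its measure. *)
Lemma lusin_of_quasisymmetric (N : set E) : (1 < n)%N -> mu N = 0%E -> mu (phi @^-1` N) = 0%E.
Proof.
move=> n1 N0.
have Noo : (mu N < +oo)%E by rewrite N0.
have /choice[U HU] : forall k, exists U : set E, [/\ open U, N `<=` U & (mu U <= (k.+1%:R^-1)%:E)%E].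
  move=> k; have e0 : (0 : R) < k.+1%:R^-1 by rewrite invr_gt0.
  by have [U] := lebesgue_rV_outer_regular e0 Noo; rewrite N0 add0e; exists U.
(* A null G-delta set containing [N]: its preimage is measurable by continuity, which is not clear
   for the preimage of [N]. *)
pose G := \bigcap_k U k.
have NG : N `<=` G by move=> x Nx k _; have [_ h _] := HU k; exact: h.
have G0 : mu G = 0%E.
  apply/eqP; rewrite eq_le lebesgue_outer_rV_ge0 andbT; apply/lee_addgt0Pr => e e0; rewrite add0e.
  have [_ _ Uk] := HU (Num.truncn e^-1).
  apply: (@le_trans _ _ (mu (U (Num.truncn e^-1)))).
    by apply: le_lebesgue_rV; exact: bigcap_inf.
  apply: le_trans Uk _; rewrite lee_fin -[leRHS]invrK lef_pV2 ?posrE ?invr_gt0 ?ltr0n//.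
  by apply/ltW/truncnS_gt.
have mG : measurable (phi @^-1` G : set L).
  rewrite /G preimage_bigcap; apply: bigcapT_measurable => k; apply: open_lebesgue_measurable.
  by have [oU _ _] := HU k; move/continuousP : cphi; exact.
apply/eqP; rewrite eq_le lebesgue_outer_rV_ge0 andbT.
pose H (k : nat) := phi @^-1` G `&` phi @^-1` hcube (const_mx (- k.+1%:R)) (2 * k.+1%:R).
apply: (@le_trans _ _ (mu (\bigcup_k H k))).
  apply: le_lebesgue_rV => u Nu; exists (Num.truncn `|phi u|) => //; split; first exact: NG.
  have : `|phi u| < (Num.truncn `|phi u|).+1%:R by exact: truncnS_gt.
  move=> h i; rewrite mxE; have := le_lt_trans (coord_le_normr (phi u) i) h.
  by rewrite ltr_norml; lra.
apply: le_trans (lebesgue_outer_rV_sigma_subadditive H) _.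
rewrite eseries0// => k _ _; apply: null_preimage_cube => //; by rewrite mulr_gt0.
Qed.

End lusin.

Lemma lusin_of_jacobian {R : realType} (n : nat) (phi psi : 'rV[R]_n -> 'rV[R]_n) (N : set 'rV[R]_n) :
  cancel phi psi -> cancel psi phi -> Ainfty_jacobian phi ->
  @lebesgue_rV R n N = 0%E -> @lebesgue_rV R n (psi @^-1` N) = 0%E.
Proof.
move=> pK Kp [[J0 [mJ _] _] HJ] N0.
have -> : psi @^-1` N = phi @` N.
  apply/seteqP; split => [x Nx|_ [u Nu <-]]; last by rewrite /= pK.
  by exists (psi x).
rewrite HJ; last exact: outer_null_measurable.
apply: (@null_set_integral _ _ R (@lebesgue_rV R n)) => //.
- exact: outer_null_measurable.
- by apply/measurable_funTS/measurable_EFinP.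
Qed.

(** * Duality on trees *)

Section packing_duality.
Context {R : realFieldType} {T : eqType} (D : seq T) (le : rel T).
Hypotheses (D_uniq : uniq D) (le_refl : reflexive le) (le_tr : transitive le)
  (le_anti : antisymmetric le)
  (le_laminar : forall J I I', le J I -> le J I' -> le I I' || le I' I).
Variables (w h : T -> R).
Hypotheses (w0 : forall I, 0 <= w I) (h0 : forall J, 0 <= h J).

Lemma exists_argmin (F : T -> R) (P : pred T) (s : seq T) : has P s ->
  exists I, [/\ I \in s, P I & forall I', I' \in s -> P I' -> F I <= F I'].
Proof.
elim: s => // x s IH /=; have [/IH[I [Is PI Imin]] _|ns] := boolP (has P s); last first.
  rewrite orbF => Px; exists x; rewrite inE eqxx; split => // I'; rewrite inE => /predU1P[->//|Is PI'].
  by case/hasP: ns; exists I'.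
have [Px|nPx] := boolP (P x); last first.
  exists I; rewrite inE Is orbT; split => // I'; rewrite inE => /predU1P[->|]; last exact: Imin.
  by rewrite (negbTE nPx).
have [xI|/ltW Ix] := leP (F x) (F I).
  exists x; rewrite inE eqxx; split => // I'; rewrite inE => /predU1P[->//|Is' PI'].
  exact: le_trans xI (Imin _ Is' PI').
by exists I; rewrite inE Is orbT; split => // I'; rewrite inE => /predU1P[->//|]; exact: Imin.
Qed.

Let load (sg : T -> R) I := \sum_(J <- D | le J I) sg J.
Let tight sg I := (I \in D) && (load sg I == w I).
(** Maximal tight elements: every tight element lies below one of them, and by laminarity no element
    lies below two. *)
Let maxt sg I := tight sg I && all (fun I' => tight sg I' && le I I' ==> (I' == I)) D.

Let maxt_above sg I : tight sg I -> exists2 I', maxt sg I' & le I I'.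
Proof.
move=> tI; have ID : I \in D by case/andP: tI.
pose above I := [seq I' <- D | tight sg I' && le I I'].
have H : has (fun I' => tight sg I' && le I I') D.
  by apply/hasP; exists I => //; rewrite tI le_refl.
have [I' [I'D /andP[tI' II'] Imin]] := exists_argmin (fun I' => (size (above I'))%:R) H.
exists I' => //; rewrite /maxt tI'; apply/allP => X XD; apply/implyP => /andP[tX IX].
have := Imin X XD; rewrite tX (le_tr II' IX) ler_nat => /(_ isT) HX.
have sub : {subset above X <= above I'}.
  move=> Y; rewrite !mem_filter => /andP[/andP[tY XY] ->]; by rewrite tY (le_tr IX XY).
have uX : uniq (above X) by exact: filter_uniq.
have [_ eq_mem] := uniq_min_size uX sub HX.
have : I' \in above X by rewrite eq_mem mem_filter tI' le_refl I'D.
by rewrite mem_filter => /andP[/andP[_ XI'] _]; apply/eqP/le_anti; rewrite XI' IX.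
Qed.

Let maxt_weight sg : (forall J, 0 <= sg J) -> \sum_(I <- D | maxt sg I) w I <= \sum_(J <- D) sg J.
Proof.
move=> sg0.
have -> : \sum_(I <- D | maxt sg I) w I = \sum_(I <- D | maxt sg I) load sg I.
  by apply: eq_bigr => I /andP[/andP[_ /eqP ->]].
rewrite /load (exchange_big_dep predT)//=; apply: ler_sum => J _.
have [/hasP[I ID /andP[mI JI]]|/hasPn nh] := boolP (has (fun I => maxt sg I && le J I) D); last first.
  by rewrite big_seq_cond big_pred0 // => I; case: (boolP (I \in D)) => //= /nh /negbTE.
rewrite big_seq_cond big_mkcond (bigD1_seq I)//= ID mI JI big1 ?addr0//= => X /eqP XI.
case: ifP => // /and3P[XD mX JX]; case: XI; apply/eqP.
have /orP[XI|IX] := le_laminar JX JI.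
  case/andP: mX => tX /allP /(_ I ID); case/andP: mI => tI _.
  by rewrite tI XI /= eq_sym.
case/andP: mI => tI /allP /(_ X XD); case/andP: mX => tX _.
by rewrite tX IX.
Qed.

(** Invariant of the algorithm: [sg] is a feasible packing, every processed element lies below a
    tight one, and [Lam] is a dual solution for the costs lowered by [t], with no duality gap. *)
Let sums (s : seq T) (t : R) := exists sg Lam : T -> R,
  [/\ (forall J, 0 <= sg J) /\ (forall I, 0 <= Lam I),
      (forall I, I \in D -> load sg I <= w I),
      (forall J, J \in s -> exists2 I, tight sg I & le J I),
      (forall J, J \in s -> h J - t <= \sum_(I <- D | le J I) Lam I) &
      \sum_(I <- D) Lam I * w I <= \sum_(J <- D) sg J * (h J - t)].

(** Lowering the threshold raises all reduced costs by the same amount. Adding this amount to [Lam]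
    on the maximal tight elements covers the processed ones, and its price is the total load there,
    at most the sum of [sg], which is the rate at which the primal value grows. *)
Let lower s t t' : t' <= t -> sums s t -> sums s t'.
Proof.
move=> tt [sg [Lam [[sg0 Lam0] cap cov dual obj]]].
have d0 : 0 <= t - t' by rewrite subr_ge0.
exists sg, (fun I => Lam I + (t - t') * (maxt sg I)%:R); split=> //.
- by split => // I; rewrite addr_ge0 ?mulr_ge0.
- move=> J Js; have [I tI JI] := cov J Js; have [I' mI' II'] := maxt_above tI.
  rewrite big_split /= -mulr_sumr; have := dual J Js.
  have I'D : I' \in D by case/andP: mI' => /andP[].
  suff : 1 <= \sum_(i <- D | le J i) (maxt sg i)%:R :> R.
    by move=> /(ler_wpM2l d0); rewrite mulr1; lra.
  rewrite big_mkcond (bigD1_seq I')//= mI' (le_tr JI II') lerDl sumr_ge0// => X _.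
  by case: ifP.
- under eq_bigr do rewrite mulrDl -mulrA.
  rewrite [leRHS](eq_bigr (fun J => sg J * (h J - t) + sg J * (t - t'))); last by move=> J _; ring.
  rewrite !big_split /= -mulr_suml -mulr_sumr; apply: lerD => //.
  rewrite mulrC; apply: ler_wpM2r => //; apply: le_trans (maxt_weight sg0).
  by rewrite [leRHS]big_mkcond; apply: ler_sum => I _; case: maxt; rewrite ?mul1r ?mul0r.
Qed.

(** At its own threshold [J] has reduced cost 0, so [sg J] can be raised without changing the
    objective until some element above [J] becomes tight. *)
Let greedy (s : seq T) J : J \in D -> sums s (h J) -> sums (J :: s) (h J).
Proof.
move=> JD [sg [Lam [[sg0 Lam0] cap cov dual obj]]].
have [I0 [ID JI0 Imin]] := exists_argmin (fun I => w I - load sg I) (P := le J) (s := D)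
  ltac:(by apply/hasP; exists J).
pose d := w I0 - load sg I0.
have d0 : 0 <= d by rewrite subr_ge0 cap.
pose sg' X := sg X + d * (X == J)%:R.
have loadE I : load sg' I = load sg I + d * (le J I)%:R.
  rewrite /load big_split /= -mulr_sumr; congr (_ + d * _).
  have [JI|nJI] := boolP (le J I).
    rewrite big_mkcond (bigD1_seq J)//= eqxx JI big1 ?addr0// => X /negbTE ->.
    by rewrite if_same.
  by rewrite big1// => X XI; case: eqP => // XJ; rewrite -XJ XI in nJI.
exists sg', Lam; split.
- by split => // X; rewrite addr_ge0 ?mulr_ge0.
- move=> I ID'; rewrite loadE; have [JI|_] := boolP (le J I); last by rewrite mulr0 addr0 cap.
  by rewrite mulr1 -lerBrDl; exact: Imin.
- move=> X; rewrite inE => /predU1P[->|Xs].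
    by exists I0 => //; rewrite /tight ID loadE JI0 mulr1 /d addrC subrK eqxx.
  have [I tI XI] := cov X Xs; exists I => //; case/andP: tI => ID' /eqP lI.
  rewrite /tight ID' loadE; have [JI|_] := boolP (le J I); last by rewrite mulr0 addr0 lI eqxx.
  have -> : d = 0 by have := Imin I ID' JI; rewrite lI -/d; lra.
  by rewrite mul0r addr0 lI eqxx.
- move=> X; rewrite inE => /predU1P[->|]; last exact: dual.
  by rewrite subrr sumr_ge0.
- apply: le_trans obj _; apply: ler_sum => X _; rewrite mulrDl lerDl -mulrA.
  by case: eqP => [->|_]; rewrite ?subrr ?mulr0 ?mul0r ?mulr0.
Qed.

(* Greedy packing in decreasing order of [h]; the dual variables grow on the
   maximal saturated sets while the threshold [t] decreases. *)
Theorem packing_duality : exists sg Lam : T -> R,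
  [/\ forall J, 0 <= sg J, forall I, 0 <= Lam I,
      forall I, I \in D -> \sum_(J <- D | le J I) sg J <= w I,
      forall J, J \in D -> h J <= \sum_(I <- D | le J I) Lam I &
      \sum_(I <- D) Lam I * w I <= \sum_(J <- D) sg J * h J].
Proof.
pose r x y := h x <= h y.
have rtot : total r by move=> x y; exact: le_total.
have rtr : transitive r by move=> y x z; exact: le_trans.
have main (s : seq T) t : {subset s <= D} -> sorted r s -> (forall J, J \in s -> t <= h J) -> sums s t.
  elim: s t => [|J s IH] t sD rs st.
    exists (fun=> 0), (fun=> 0); split => //.
      by move=> I _; rewrite /load big1.
    by rewrite !big1// => I _; rewrite mul0r.
  apply: (lower (t := h J)); first by apply: st; rewrite inE eqxx.
  apply: greedy; first by apply: sD; rewrite inE eqxx.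
  apply: IH.
  - by move=> X Xs; apply: sD; rewrite inE Xs orbT.
  - exact: path_sorted rs.
  - move=> X Xs; have /allP := order_path_min rtr rs; exact.
have [sg [Lam [[sg0 Lam0] cap _ dual obj]]] := main (sort r D) 0
  (fun X => ltac:(by rewrite mem_sort)) (sort_sorted rtot D) (fun J _ => h0 J).
exists sg, Lam; split => //.
- by move=> J JD; have := dual J; rewrite mem_sort subr0; exact.
- by under [leRHS]eq_bigr do rewrite -[h _]subr0.
Qed.

End packing_duality.

(** * Norm of functions with Carleson coefficients *)

Lemma weighted_Cauchy_Schwarz {R : realFieldType} {I : Type} (s : seq I) (a k : I -> R) :
  (forall i, 0 <= k i) ->
  (\sum_(i <- s) a i * k i) ^+ 2 <= (\sum_(i <- s) a i ^+ 2 * k i) * \sum_(i <- s) k i.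
Proof.
move=> k0; elim: s => [|i s IH]; first by rewrite !big_nil expr0n mul0r.
rewrite !big_cons.
have A0 : 0 <= \sum_(j <- s) a j ^+ 2 * k j by apply: sumr_ge0 => j _; rewrite mulr_ge0// sqr_ge0.
have K0 : 0 <= \sum_(j <- s) k j by apply: sumr_ge0.
move: (\sum_(j <- s) a j * k j) (\sum_(j <- s) a j ^+ 2 * k j) (\sum_(j <- s) k j) IH A0 K0.
move=> B A K BAK A0 K0.
have H : 2 * a i * B <= A + a i ^+ 2 * K.
  have [K00|Kn0] := eqVneq K 0.
    have /eqP : B ^+ 2 = 0 by apply/le_anti; rewrite sqr_ge0 andbT -[leRHS](mulr0 A) -K00.
    by rewrite sqrf_eq0 => /eqP ->; rewrite mulr0 K00 mulr0 addr0.
  have Kp : 0 < K by rewrite lt_neqAle eq_sym Kn0.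
  rewrite -(ler_pM2r Kp); apply: le_trans (_ : B ^+ 2 + (a i * K) ^+ 2 <= _); last first.
    by rewrite mulrDl exprMn lerD// expr2 mulrA.
  by have := sqr_ge0 (B - a i * K); nra.
have := ler_wpM2l (k0 i) H; nra.
Qed.

Section kappa.
Context {R : realType}.
Variable alpha : R.
Hypotheses (alpha_gt0 : 0 < alpha) (alpha_lt1 : alpha < 1).

(** With x = h / d, a bump of height 1 and width d varies by at most a multiple of min(x, 1) =
    x^alpha [kap x] over distance h. Since [kap] behaves like x^(1 - alpha) near 0 and x^(-alpha) at
    infinity, its sums over scales converge in both directions; this needs 0 < alpha < 1. *)
Definition kap (x : R) : R := (x `^ alpha)^-1 * Num.min x 1.

Lemma kapE (x : R) : kap x = (x `^ alpha)^-1 * Num.min x 1.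
Proof. by []. Qed.

Lemma kap_ge0 x : 0 <= x -> 0 <= kap x.
Proof. by move=> x0; rewrite mulr_ge0 ?invr_ge0 ?powR_ge0// le_min x0/=. Qed.

Lemma kap_small (x : R) : 0 < x -> x <= 1 -> kap x = x `^ (1 - alpha).
Proof.
move=> x0 x1; rewrite /kap min_l// powRD; last by rewrite (gt_eqF x0) implybT.
by rewrite powRr1 ?ltW// powRN mulrC.
Qed.

Lemma kap_large (x : R) : 1 <= x -> kap x = (x `^ alpha)^-1.
Proof. by move=> x1; rewrite /kap min_r// mulr1. Qed.

Let A1 : 0 < 1 - alpha. Proof. by rewrite subr_gt0. Qed.

(* Sums of [kap] along a lacunary sequence telescope: [kap] is dominated by an
   increment of this bounded function. *)
Definition potential (t x : R) : R :=
  (Num.min x t) `^ (1 - alpha) / (t `^ (1 - alpha) - 1)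
  - ((Num.max x 1) `^ alpha)^-1 / (1 - (t `^ alpha)^-1).

Let up_gt1 (t p : R) : 1 < t -> 0 < p -> 1 < t `^ p.
Proof.
move=> t1 p0; have {1}<- : (1 : R) `^ p = 1 by rewrite powR1.
by apply: gt0_ltr_powR; rewrite ?nnegrE; lra. Qed.

Let g0 (t : R) : 1 < t -> 0 < t `^ (1 - alpha) - 1.
Proof. by move=> t1; rewrite subr_gt0 up_gt1. Qed.

Let h0 (t : R) : 1 < t -> 0 < 1 - (t `^ alpha)^-1.
Proof. by move=> t1; rewrite subr_gt0 invf_lt1 ?up_gt1// (lt_trans _ (up_gt1 t1 alpha_gt0)). Qed.

Let pow_le (p x y : R) : 0 < p -> 0 <= x -> x <= y -> x `^ p <= y `^ p.
Proof. by move=> p0 x0 xy; rewrite ge0_ler_powR ?nnegrE// ?(ltW p0)//; lra. Qed.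

Lemma kap_le_potential (t x y : R) : 1 < t -> 0 < x -> t * x <= y ->
  kap x <= potential t y - potential t x.
Proof.
move=> t1 x0 txy.
have xy : x <= y by nra.
have t0 : 0 < t by lra.
have Gm : (Num.min x t) `^ (1 - alpha) <= (Num.min y t) `^ (1 - alpha).
  by apply: pow_le; rewrite // ?le_min ?ge_min ?xy ?lexx ?orbT ?(ltW x0) ?(ltW t0).
have Hm : ((Num.max y 1) `^ alpha)^-1 <= ((Num.max x 1) `^ alpha)^-1.
  rewrite lef_pV2 ?posrE ?powR_gt0 ?lt_max ?ltr01 ?orbT//; apply: pow_le => //.
    by rewrite le_max ler01 orbT.
  by rewrite ge_max !le_max xy lexx ?orbT.
have -> : potential t y - potential t x =
    ((Num.min y t) `^ (1 - alpha) - (Num.min x t) `^ (1 - alpha)) / (t `^ (1 - alpha) - 1) +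
    (((Num.max x 1) `^ alpha)^-1 - ((Num.max y 1) `^ alpha)^-1) / (1 - (t `^ alpha)^-1).
  by rewrite /potential; ring.
have /orP[x1|x1] := le_total x 1.
  rewrite kap_small//; apply: ler_wpDr.
    by apply: divr_ge0; [rewrite subr_ge0|exact: ltW (h0 t1)].
  rewrite ler_pdivlMr ?g0// mulrBr mulr1.
  have -> : Num.min x t = x by apply: min_l; lra.
  rewrite lerD2r mulrC -powRM ?(ltW x0) ?(ltW t0)//; apply: pow_le => //; first by nra.
  by rewrite le_min txy; nra.
rewrite kap_large//; apply: ler_wpDl.
  by apply: divr_ge0; [rewrite subr_ge0|exact: ltW (g0 t1)].
rewrite ler_pdivlMr ?h0// mulrBr mulr1.
have -> : Num.max x 1 = x by exact: max_l.
rewrite lerD2l lerN2 -invfM lef_pV2 ?posrE ?mulr_gt0 ?powR_gt0 ?lt_max ?x0 ?ltr01 ?orbT//.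
rewrite -powRM ?(ltW x0) ?(ltW t0)//; apply: pow_le => //; first by nra.
rewrite max_l; nra.
Qed.

Definition kap_const (t : R) : R :=
  t `^ (1 - alpha) / (t `^ (1 - alpha) - 1) + (1 - (t `^ alpha)^-1)^-1.

Lemma kap_const_ge0 (t : R) : 1 < t -> 0 <= kap_const t.
Proof. by move=> t1; rewrite addr_ge0 ?divr_ge0 ?powR_ge0 ?invr_ge0 ?(ltW (g0 t1)) ?(ltW (h0 t1)). Qed.

Let potential_diff (t x y : R) : 1 < t -> 0 < x -> 0 < y -> potential t y - potential t x <= kap_const t.
Proof.
move=> t1 x0 y0; have t0 : 0 < t by lra.
rewrite /potential /kap_const opprB.
have P1 : (Num.min y t) `^ (1 - alpha) / (t `^ (1 - alpha) - 1) <= t `^ (1 - alpha) / (t `^ (1 - alpha) - 1).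
  by rewrite ler_pM2r ?invr_gt0 ?g0// pow_le ?le_min ?ge_min ?(ltW y0) ?(ltW t0) ?lexx ?orbT.
have P2 : ((Num.max x 1) `^ alpha)^-1 / (1 - (t `^ alpha)^-1) <= (1 - (t `^ alpha)^-1)^-1.
  rewrite ler_piMl ?invr_ge0 ?(ltW (h0 t1))// invf_le1 ?powR_gt0 ?lt_max ?ltr01 ?orbT//.
  have {1}<- : (1 : R) `^ alpha = 1 by rewrite powR1.
  by apply: pow_le; rewrite // le_max lexx orbT.
have P3 : 0 <= (Num.min x t) `^ (1 - alpha) / (t `^ (1 - alpha) - 1).
  by rewrite divr_ge0 ?powR_ge0 ?(ltW (g0 t1)).
have P4 : 0 <= ((Num.max y 1) `^ alpha)^-1 / (1 - (t `^ alpha)^-1).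
  by rewrite divr_ge0 ?invr_ge0 ?powR_ge0 ?(ltW (h0 t1)).
by lra.
Qed.

Lemma kap_sum_growing (t : R) (x : nat -> R) m : 1 < t -> (forall j, 0 < x j) ->
  (forall j, t * x j <= x j.+1) -> \sum_(0 <= j < m) kap (x j) <= kap_const t.
Proof.
move=> t1 x0 xS; apply: le_trans (potential_diff t1 (x0 0) (x0 m)).
rewrite -(telescope_sumr (fun j => potential t (x j)) (leq0n m)); apply: ler_sum => j _; exact: kap_le_potential.
Qed.

Definition halving_const : R := kap_const 2 + (1 - 2 `^ (alpha - 1))^-1.

Let q1 : 0 < 2 `^ (alpha - 1) /\ 2 `^ (alpha - 1) < 1.
Proof.
have := up_gt1 (_ : 1 < 2) A1; rewrite ltr1n => /(_ isT) h.
have h' : 0 < 2 `^ (1 - alpha) by rewrite powR_gt0.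
by rewrite -opprB powRN invr_gt0 h' invf_lt1.
Qed.

Lemma halving_const_ge0 : 0 <= halving_const.
Proof.
have [_ q] := q1.
by rewrite addr_ge0 ?kap_const_ge0 ?ltr1n// invr_ge0 subr_ge0 ltW.
Qed.

(** In general the telescoping potential bounds the sum; if y is at most 1, all terms are in the
    power regime and form a geometric series dominated by the first. *)
Lemma kap_sum_halving (y : R) m : 0 < y ->
  \sum_(0 <= k < m) kap (y / 2 ^+ k) <= halving_const /\
  (y <= 1 -> \sum_(0 <= k < m) kap (y / 2 ^+ k) <= halving_const * kap y).
Proof.
move=> y0; have [q0 q] := q1.
have i0 : 0 <= (1 - 2 `^ (alpha - 1))^-1 by rewrite invr_ge0 subr_ge0 ltW.
have k20 : 0 <= kap_const 2 by rewrite kap_const_ge0 ?ltr1n.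
split.
  pose z k := y * 2 / 2 ^+ k; have z0 k : 0 < z k by rewrite divr_gt0 ?mulr_gt0 ?exprn_gt0.
  apply: (@le_trans _ _ (kap_const 2)); last by rewrite lerDl.
  apply: le_trans (potential_diff (ltr1n _ 2 : 1 < 2) (z0 m) (z0 0)).
  rewrite -opprB -(telescope_sumr (fun k => potential 2 (z k)) (leq0n m)) -sumrN; apply: ler_sum => k _.
  rewrite opprB; have -> : y / 2 ^+ k = z k.+1.
    by rewrite /z exprS; field; rewrite expf_eq0 pnatr_eq0 andbF.
  apply: kap_le_potential; rewrite ?ltr1n// le_eqVlt; apply/orP; left; apply/eqP.
  by rewrite /z exprS; field; rewrite expf_eq0 pnatr_eq0 andbF.
move=> y1; apply: (@le_trans _ _ ((1 - 2 `^ (alpha - 1))^-1 * kap y)); last first.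
  by rewrite ler_wpM2r ?kap_ge0 ?(ltW y0)// lerDr.
rewrite (eq_bigr (fun k => kap y * (2 `^ (alpha - 1)) ^+ k)); last first.
  move=> k _; have k0 : 0 < 2 ^+ k :> R by rewrite exprn_gt0.
  rewrite !kap_small ?divr_gt0//; last by rewrite ler_pdivrMr// mul1r (le_trans y1)// exprn_ege1// ler1n.
  rewrite powR_div ?exprn_gt0 ?(ltW y0)//; congr (_ * _).
  by rewrite -powR_mulrn// -powR_mulrn ?powR_ge0// -!powRrM -powRN; congr (_ `^ _); ring.
rewrite -mulr_sumr mulrC; apply: ler_wpM2r; first by rewrite kap_ge0// ltW.
rewrite big_mkord -div1r ler_pdivlMr ?subr_gt0// mulrC -opprB mulNr -subrX1 opprB gerBl.
by rewrite exprn_ge0// ltW.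
Qed.

End kappa.

Global Opaque kap.

(** * Diameters of preimages and their overlap *)

Section cell_diameters.
Context {R : realType} {n : nat}.
Hypothesis n_gt0 : (0 < n)%N.
Local Notation E := 'rV[R]_n.
Local Notation L := (caratheodory_type (@lebesgue_outer_rV R n)).
Local Notation mu := (@lebesgue_rV R n).
Local Notation word := (seq {ffun 'I_n -> bool}).

Fixpoint words_upto (K : nat) : seq word :=
  if K is K'.+1 then words_upto K' ++ @words n K else @words n 0.

Lemma sum_words_upto {V : nmodType} K (F : word -> V) :
  \sum_(s <- words_upto K) F s = \sum_(0 <= k < K.+1) \sum_(s <- @words n k) F s.
Proof. by elim: K => [|K IH]; [rewrite big_nat1|rewrite big_nat_recr// -IH big_cat]. Qed.

Lemma mem_words_upto K (s : word) : (s \in words_upto K) = (size s <= K)%N.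
Proof.
elim: K => [|K IH]; first by rewrite mem_words leqn0.
by rewrite mem_cat IH mem_words [RHS]leq_eqVlt orbC.
Qed.

Lemma uniq_words_upto K : uniq (words_upto K).
Proof.
elim: K => // K IH; rewrite cat_uniq IH uniq_words andbT.
apply/hasPn => s; rewrite mem_words mem_words_upto => /eqP ->; by rewrite ltnn.
Qed.

Variable alpha : R.
Hypotheses (alpha_gt0 : 0 < alpha) (alpha_lt1 : alpha < 1).
Variables (up dn : R -> R) (phi psi : E -> E).
Hypotheses (updn : distortion up dn) (pK : cancel phi psi) (Kp : cancel psi phi)
  (cphi : continuous phi) (cpsi : ratio_control up dn psi).

Definition pdiam (a : E) (l : R) (s : word) : R := pvol phi a l s `^ n%:R^-1.

Let dc := @doubling_const R n up 4.

(** The n-th root of the least factor by which the volume drops from parent to child, a ratio of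
    diameters. *)
Definition diam_ratio : R := ((1 - dc^-1)^-1) `^ n%:R^-1.

Let n0 : (n%:R : R) != 0. Proof. by rewrite pnatr_eq0 gt_eqF. Qed.

Section fixed_cube.
Variables (a : E) (l : R).
Hypothesis l0 : 0 < l.
Local Notation V := (pcell phi a l).
Local Notation v := (pvol phi a l).
Local Notation d := (pdiam a l).

Let v0 s : 0 < v s. Proof. exact: (pvol_gt0 n_gt0 updn pK Kp cpsi a l0 s). Qed.

Lemma pdiam_gt0 s : 0 < d s. Proof. by rewrite powR_gt0. Qed.

Lemma pdiamX s : d s ^+ n = v s.
Proof. by rewrite -powR_mulrn ?powR_ge0// -powRrM mulVf// powRr1// ltW. Qed.

Let rootn_le (x y : R) : 0 <= x -> x <= y -> x `^ n%:R^-1 <= y `^ n%:R^-1.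
Proof. by move=> x0 xy; rewrite ge0_ler_powR ?nnegrE ?invr_ge0//; lra. Qed.

Let dc0 : 0 < dc. Proof. exact: (doubling_const_gt0 updn). Qed.
Let q0 : 0 < 1 - dc^-1.
Proof.
have := pvol_child n_gt0 updn pK Kp cphi cpsi a l0 [ffun=> true] [::].
by have := v0 [:: [ffun=> true]]; have := v0 [::]; rewrite -/dc; move: (v _) (v _) => x y; nra.
Qed.
Let dci0 : 0 < dc^-1. Proof. by rewrite invr_gt0. Qed.

Lemma diam_ratio_gt1 : 1 < diam_ratio.
Proof.
have {1}<- : (1 : R) `^ n%:R^-1 = 1 by rewrite powR1.
rewrite gt0_ltr_powR ?nnegrE ?invr_gt0 ?ltr0n// ?invr_ge0 ?(ltW q0)//.
by rewrite invf_gt1// ltrBlDr ltrDl.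
Qed.

Lemma pdiam_child e s : diam_ratio * d (e :: s) <= d s.
Proof.
rewrite /diam_ratio /pdiam -powRM ?invr_ge0 ?(ltW q0) ?(ltW (v0 _))//.
apply: rootn_le; first by rewrite mulr_ge0 ?invr_ge0 ?(ltW q0) ?(ltW (v0 _)).
by rewrite ler_pdivrMl//; exact: (pvol_child n_gt0 updn pK Kp cphi cpsi a l0).
Qed.

Lemma pdiam_parent e s : d s <= dc `^ n%:R^-1 * d (e :: s).
Proof.
rewrite /pdiam -powRM ?(ltW dc0) ?(ltW (v0 _))//; apply: rootn_le; first exact: ltW.
exact: (pvol_parent n_gt0 updn pK Kp cpsi a l0).
Qed.

Lemma pdiam_dist s u w : V s u -> V s w -> `|u - w| <= up 1 ^+ 2 * d s.
Proof.
move=> su sw; have u1 : 0 <= up 1 ^+ 2 by rewrite exprn_ge0// ltW// updn.1.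
have ud0 : 0 <= up 1 ^+ 2 * d s by rewrite mulr_ge0// ltW// pdiam_gt0.
rewrite -(ler_pXn2r n_gt0) ?nnegrE// exprMn pdiamX.
exact: (pvol_diam n_gt0 updn pK Kp cpsi l0).
Qed.

Lemma sum_words_indic k (F : word -> R) u :
  \sum_(s <- @words n k) F s * \1_(V s) u =
  if `[< hcube a l (phi u) >] then F (wcode a l k (phi u)) else 0.
Proof.
case: asboolP => [hu|nu]; last first.
  rewrite big1// => s _; rewrite indicE memNset ?mulr0// => /(cell_sub_nil l0); exact: nu.
rewrite (bigD1_seq (wcode a l k (phi u))) ?code_words ?uniq_words//=.
rewrite indicE mem_set ?mulr1; last exact: cell_code.
rewrite big_seq_cond big1 ?addr0// => s /andP[]; rewrite mem_words => /eqP sk sne.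
rewrite indicE memNset ?mulr0// => us; case/eqP: sne.
by rewrite -sk (code_cell l0 us).
Qed.

(** The cells whose preimages contain [u] form a chain with geometrically decreasing diameters, so
    only the scales near [t] matter. *)
Lemma kap_chain K t u : 0 < t ->
  \sum_(s <- words_upto K) kap alpha (t / d s) * \1_(V s) u <= kap_const alpha diam_ratio.
Proof.
move=> t0; rewrite sum_words_upto; under eq_bigr do rewrite sum_words_indic.
have C0 : 0 <= kap_const alpha diam_ratio by exact: kap_const_ge0 diam_ratio_gt1.
case: asboolP => _; last by rewrite big1.
apply: (@kap_sum_growing R alpha alpha_gt0 alpha_lt1 diam_ratio
  (fun j => t / d (wcode a l j (phi u))) K.+1 diam_ratio_gt1).
  by move=> j; rewrite divr_gt0// pdiam_gt0.
move=> j; set s := wcode a l j (phi u); set s' := wcode a l j.+1 (phi u).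
have := pdiam_child [ffun i => wcorner a l s ord0 i + wside l s / 2 <= phi u ord0 i] s.
rewrite -[_ :: _]/s'; have := pdiam_gt0 s; have := pdiam_gt0 s'.
move: (d s) (d s') (diam_ratio) => x y q y0 x0 qyx.
rewrite ler_pdivlMr// (_ : q * (t / x) * y = t * (q * y / x)); last by ring.
by rewrite ger_pMr// ler_pdivrMr// mul1r.
Qed.

Definition trace_vol (b : E) (h : R) (s : word) : R := volume (V s `&` hcube b h).

Lemma trace_vol_fin b h s : mu (V s `&` hcube b h) = (trace_vol b h s)%:E.
Proof.
rewrite fineK// ge0_fin_numE; last exact: lebesgue_outer_rV_ge0.
apply: (@le_lt_trans _ _ (mu (V s))); first by apply: le_lebesgue_rV; exact: subIsetl.
by rewrite (pvol_fin n_gt0 updn pK cpsi a l0) ltry.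
Qed.

Lemma trace_vol_ge0 b h s : 0 <= trace_vol b h s.
Proof. by rewrite fine_ge0//; exact: lebesgue_outer_rV_ge0. Qed.

Lemma trace_vol_le b h s : trace_vol b h s <= v s.
Proof.
rewrite -lee_fin -trace_vol_fin -(pvol_fin n_gt0 updn pK cpsi a l0).
by apply: le_lebesgue_rV; exact: subIsetl.
Qed.

Lemma trace_vol_sub b h s : V s `<=` hcube b h -> trace_vol b h s = v s.
Proof. by move=> sb; rewrite /trace_vol (setIidl sb). Qed.

Lemma integral_sum_indic (b : E) (h : R) (D : seq word) (c : word -> R) : (forall s, 0 <= c s) ->
  (\int[mu]_(x in hcube b h) (\sum_(s <- D) c s * \1_(V s) x)%:E =
   (\sum_(s <- D) c s * trace_vol b h s)%:E)%E.
Proof.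
move=> c0; under eq_integral do rewrite -sumEFin.
rewrite (@ge0_integral_sum _ L R mu _ (measurable_hcube b h) _ (fun s x => (c s * \1_(V s) x)%:E)).
- rewrite -sumEFin; apply: eq_bigr => s _.
  under eq_integral do rewrite EFinM.
  rewrite (@ge0_integralZl _ L R mu _ (measurable_hcube b h)) ?lee_fin//.
  + rewrite (@integral_indic _ L R mu _ (measurable_hcube b h))//; last exact: measurable_pcell.
    by transitivity ((c s)%:E * (trace_vol b h s)%:E)%E; [congr (_ * _)%E; exact: trace_vol_fin|rewrite -EFinM].
  + apply/measurable_funTS/measurable_EFinP; apply: measurable_indic; exact: measurable_pcell.
- move=> s; apply/measurable_funTS/measurable_EFinP; apply: measurable_funM => //.
  apply: measurable_indic; exact: measurable_pcell.
- by move=> s x _; rewrite lee_fin mulr_ge0// indicE.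
Qed.

Lemma kap_overlap K t (b : E) h : 0 < t -> 0 < h ->
  \sum_(s <- words_upto K) kap alpha (t / d s) * trace_vol b h s <= kap_const alpha diam_ratio * h ^+ n.
Proof.
move=> t0 hh0.
have k0 s : 0 <= kap alpha (t / d s) by rewrite kap_ge0// divr_ge0 ?(ltW t0) ?(ltW (pdiam_gt0 s)).
rewrite -lee_fin -integral_sum_indic// [leRHS]EFinM -(lebesgue_rV_hcube b hh0).
rewrite -(@integral_cst _ L R mu _ (measurable_hcube b h)).
apply: (@le_integral_lower _ L R mu) => x _.
  by rewrite lee_fin sumr_ge0// => s _; rewrite mulr_ge0// indicE.
by rewrite lee_fin; exact: kap_chain.
Qed.

End fixed_cube.
End cell_diameters.

Section real_estimates.
Context {R : realType}.

(** If x is comparable to h, it may be replaced by h. The constant has exponent 3 alpha: 2 alpha for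
    this exchange and alpha for the inserted factor, which is [kap (h / x)]. *)
Lemma powR_ratio_le (alpha h x T w : R) : 0 < alpha -> 0 < h -> 0 < x -> 1 <= h / x -> h / x <= T ->
  0 < w -> w / x `^ (2 * alpha) <= (h `^ (2 * alpha))^-1 * T `^ (3 * alpha) * (((h / x) `^ alpha)^-1 * w).
Proof.
move=> alpha0 h0 x0; set y := h / x => y1 yT w0.
have y0 : 0 < y by lra.
have {1}-> : x = h / y by rewrite /y; field; rewrite !gt_eqF.
rewrite powR_div ?(ltW h0)// invf_div.
have -> : (h `^ (2 * alpha))^-1 * T `^ (3 * alpha) * ((y `^ alpha)^-1 * w) =
  w * (T `^ (3 * alpha) / y `^ alpha / h `^ (2 * alpha)) by ring.
rewrite ler_pM2l// ler_pM2r ?invr_gt0 ?powR_gt0// ler_pdivlMr ?powR_gt0//.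
rewrite -powRD; last by rewrite (gt_eqF y0) implybT.
have -> : 2 * alpha + alpha = 3 * alpha by ring.
by apply: ge0_ler_powR; rewrite ?nnegrE; lra.
Qed.

Lemma scale_exchange_le (c x t H k y : R) : 0 <= c <= 1 -> 0 < y -> y <= x ->
  0 <= t -> 0 <= H -> 0 <= k -> c / x * t * (H * k) <= H * (0 + y^-1 * (k * t)).
Proof.
move=> /andP[c0 c1] y0 yx t0 H0 k0.
have -> : c / x * t * (H * k) = H * (c / x * (k * t)) by ring.
rewrite add0r ler_wpM2l// ler_wpM2r ?mulr_ge0//; apply: (@le_trans _ _ x^-1).
  by rewrite ler_piMl// invr_ge0; lra.
by rewrite lef_pV2// posrE; lra.
Qed.

Lemma powR_sqr (x p : R) : (x `^ p) ^+ 2 = x `^ (2 * p).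
Proof. by rewrite -powR_mulrn ?powR_ge0// -powRrM mulrC. Qed.

End real_estimates.

Section carleson.
Context {R : realType} {n : nat}.
Hypothesis n_gt0 : (0 < n)%N.
Local Notation E := 'rV[R]_n.
Local Notation L := (caratheodory_type (@lebesgue_outer_rV R n)).
Local Notation mu := (@lebesgue_rV R n).
Local Notation word := (seq {ffun 'I_n -> bool}).
Variable alpha : R.
Hypotheses (alpha_gt0 : 0 < alpha) (alpha_lt1 : alpha < 1) (alpha_lt : alpha < n%:R / 2).
Variables (up dn : R -> R) (phi psi : E -> E).
Hypotheses (updn : distortion up dn) (pK : cancel phi psi) (Kp : cancel psi phi)
  (cphi : continuous phi) (cpsi : ratio_control up dn psi).
Variables (a : E) (l : R).
Hypothesis l0 : 0 < l.
Local Notation V := (pcell phi a l).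
Local Notation v := (pvol phi a l).
Local Notation d := (pdiam phi a l).
Local Notation beta := (@Qbeta R n alpha).
Local Notation Ck := (kap_const alpha (@diam_ratio R n up)).

Let v0 s : 0 < v s. Proof. exact: (pvol_gt0 n_gt0 updn pK Kp cpsi a l0 s). Qed.
Let d0 s : 0 < d s. Proof. exact: (pdiam_gt0 n_gt0 updn pK Kp cpsi a l0 s). Qed.
Let dX s : d s ^+ n = v s. Proof. exact: (pdiamX n_gt0 updn pK Kp cpsi a l0 s). Qed.
Let nR0 : (n%:R : R) != 0. Proof. by rewrite pnatr_eq0 gt_eqF. Qed.
Let Ck0 : 0 <= Ck.
Proof. apply: kap_const_ge0 => //; exact: (diam_ratio_gt1 n_gt0 updn pK Kp cphi cpsi a l0). Qed.

Lemma powR_Qbeta (x : R) : 0 < x -> (x ^+ n) `^ beta = x ^+ n / x `^ (2 * alpha).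
Proof.
move=> x0; rewrite -powR_mulrn ?(ltW x0)// -powRrM -powRN -powRD; last by rewrite (gt_eqF x0) implybT.
by congr (_ `^ _); rewrite /Qbeta; field.
Qed.

Let vbeta s : v s `^ beta = v s / d s `^ (2 * alpha).
Proof. by rewrite -dX powR_Qbeta. Qed.

Variables (K : nat) (c : word -> R).
Local Notation D := (@words_upto n K).
Hypotheses (c0 : forall s, 0 <= c s) (c1 : forall s, c s <= 1)
  (carleson : forall I, I \in D -> \sum_(J <- D | suffix I J) c J * v J `^ beta <= v I `^ beta).

Section localized.
Variables (b : E) (h : R).
Hypothesis h0 : 0 < h.
Local Notation tr := (trace_vol phi a l b h).

Let Th := @doubling_const R n up 4 `^ n%:R^-1.
(** A preimage of diameter at most [h] (measured by [d]) that meets the test cube stays within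
    [up 1 ^+ 2 * h] of it on each side. *)
Let spread := 1 + 2 * up 1 ^+ 2.

Definition top_const : R := 1 + Th `^ (3 * alpha) * (Ck * spread ^+ n).

(* The largest ancestors of diameter at most [h]; their overlap is bounded. *)
Let top I := (d I <= h) && (h < d (behead I)).

Let exists_top J : d J <= h -> h < d [::] -> exists I, suffix I J && top I.
Proof.
move=> + h1; elim: J => [|e J IH] Jh; first by rewrite leNgt h1 in Jh.
have [/IH[I /andP[IJ tI]]|hJ] := leP (d J) h.
  by exists I; rewrite tI andbT; apply: suffix_trans IJ (suffix_suffix [:: e] J).
by exists (e :: J); rewrite suffix_refl /top Jh.
Qed.

Let top_bound I : top I -> 0 < tr I ->
  v I `^ beta <= (h `^ (2 * alpha))^-1 * Th `^ (3 * alpha) *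
    (kap alpha (h / d I) * trace_vol phi a l (b - const_mx (up 1 ^+ 2 * h)) (spread * h) I).
Proof.
move=> /andP[Ih hI] trI.
have u1 : 0 < up 1 ^+ 2 by rewrite exprn_gt0// updn.1.
have [u [Iu bu]] : V I `&` hcube b h !=set0.
  apply/set0P/eqP => V0; move: trI.
  by rewrite -lte_fin -(trace_vol_fin n_gt0 updn pK cpsi a l0) V0 (@measure0 _ L) ltxx.
rewrite (trace_vol_sub (s := I)); last first.
  move=> w Iw i; have := bu i.
  have := le_trans (pdiam_dist n_gt0 updn pK Kp cpsi l0 Iu Iw) (_ : _ <= up 1 ^+ 2 * h).
  rewrite ler_pM2l// => /(_ Ih) /(normr_le_rV _ _).1 => /(_ _ i).
  rewrite (_ : (b - const_mx (up 1 ^+ 2 * h)) ord0 i = b ord0 i - up 1 ^+ 2 * h); last by rewrite !mxE.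
  rewrite rowB ler_norml /spread => /(_ (mulr_ge0 (ltW u1) (ltW h0))); lra.
have x1 : 1 <= h / d I by rewrite (ler_pdivlMr _ _ (d0 I)) mul1r; exact: Ih.
have xT : h / d I <= Th.
  rewrite (ler_pdivrMr _ _ (d0 I)); apply: le_trans (ltW hI) _.
  case: I {trI Iu x1} Ih hI => [|e I] Ih hI /=; first by rewrite ltNge Ih in hI.
  exact: (pdiam_parent n_gt0 updn pK Kp cpsi a l0).
rewrite kap_large// vbeta.
exact: (powR_ratio_le alpha_gt0 h0 (d0 I) x1 xT (v0 I)).
Qed.

(** The Carleson property is carried over from the tree to an arbitrary cube. Each small [J] lies
    below a top cell that also meets the cube; top cells have diameter comparable to [h], and the
    overlap bound in the enlarged cube limits the sum of their [v ^ beta]. A root of diameter at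
    most [h] is covered by the property at the root. *)
Lemma carleson_local : \sum_(J <- D | (d J <= h) && (0 < tr J)) c J * v J `^ beta
  <= top_const * (h ^+ n / h `^ (2 * alpha)).
Proof.
have t0 J : 0 <= c J * v J `^ beta by rewrite mulr_ge0 ?powR_ge0.
have hn0 : 0 < h ^+ n / h `^ (2 * alpha) by rewrite divr_gt0 ?exprn_gt0 ?powR_gt0.
have sp0 : 0 <= Th `^ (3 * alpha) * (Ck * spread ^+ n).
  by rewrite mulr_ge0 ?powR_ge0// mulr_ge0// exprn_ge0// /spread addr_ge0// mulr_ge0// sqr_ge0.
have [hroot|hroot] := leP (d [::]) h.
  apply: (@le_trans _ _ (h ^+ n / h `^ (2 * alpha))); last by rewrite ler_peMl ?(ltW hn0)// lerDl.
  have nil : [::] \in D by rewrite mem_words_upto.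
  apply: le_trans (le_trans _ (carleson nil)) _.
    rewrite [leLHS]big_mkcond [leRHS]big_mkcond; apply: ler_sum => J _.
    by rewrite suffix0s; case: ifP.
  rewrite -powR_Qbeta// -dX; have be := Qbeta_gt0 n_gt0 alpha_lt.
  by rewrite ge0_ler_powR ?nnegrE ?exprn_ge0 ?(ltW be) ?(ltW h0) ?(ltW (d0 _))// lerXn2r ?nnegrE ?(ltW h0) ?(ltW (d0 _)).
pose TD := [pred I | top I && (0 < tr I)].
apply: (@le_trans _ _ (\sum_(I <- D | TD I) v I `^ beta)).
  apply: (@le_trans _ _ (\sum_(I <- D | TD I) \sum_(J <- D | suffix I J) c J * v J `^ beta)).
    rewrite (exchange_big_dep predT)//= big_mkcond big_seq [leRHS]big_seq; apply: ler_sum => J JD.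
    case: ifP => [/andP[Jh trJ]|_]; last by apply: sumr_ge0.
    have [I /andP[IJ tI]] := exists_top Jh hroot.
    have ID : I \in D.
      move: JD; rewrite !mem_words_upto; apply: leq_trans.
      by case/suffixP: IJ => w ->; rewrite size_cat leq_addl.
    have trI : 0 < tr I.
      apply: lt_le_trans trJ _.
      rewrite -lee_fin -!(trace_vol_fin n_gt0 updn pK cpsi a l0); apply: le_lebesgue_rV.
      by case/suffixP: IJ => w ->; apply: setSI; exact: pcell_sub.
    rewrite big_mkcond (bigD1_seq I) ?uniq_words_upto//= IJ tI trI /= lerDl.
    by apply: sumr_ge0 => X _; case: ifP.
  rewrite big_seq_cond [leRHS]big_seq_cond; apply: ler_sum => I /andP[ID _]; exact: carleson.
apply: (@le_trans _ _ (\sum_(I <- D) (h `^ (2 * alpha))^-1 * Th `^ (3 * alpha) *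
    (kap alpha (h / d I) * trace_vol phi a l (b - const_mx (up 1 ^+ 2 * h)) (spread * h) I))).
  rewrite big_mkcond; apply: ler_sum => I _; case: ifP => [/andP[tI trI]|_]; first exact: top_bound.
  apply: mulr_ge0; first by rewrite mulr_ge0 ?invr_ge0 ?powR_ge0.
  apply: mulr_ge0; last exact: trace_vol_ge0.
  by apply: kap_ge0; rewrite divr_ge0 ?(ltW h0) ?(ltW (d0 _)).
have sph : 0 < spread * h by rewrite mulr_gt0// ltr_wpDr// mulr_ge0// sqr_ge0.
rewrite -mulr_sumr; apply: le_trans (ler_wpM2l _ (kap_overlap n_gt0 alpha_gt0 alpha_lt1 updn pK Kp cphi cpsi a l0 K _ h0 sph)) _.
  by rewrite mulr_ge0 ?invr_ge0 ?powR_ge0.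
rewrite /top_const [leRHS]mulrDl mul1r; apply: ler_wpDl; first exact: ltW.
by rewrite exprMn le_eqVlt; apply/orP; left; apply/eqP; ring.
Qed.

End localized.

Definition local_const : R := halving_const alpha * (top_const + Ck).

Let hv0 : 0 <= halving_const alpha. Proof. exact: halving_const_ge0. Qed.

(** Summed over the scales h / 2^k, a cell of diameter at most [h] contributes a bounded factor and
    is left to [carleson_local]; a larger one contributes a multiple of [kap (h / d J)], and as its
    coefficient is at most 1, the overlap bound takes care of it. *)
Lemma carleson_scales (b : E) (h : R) m : 0 < h ->
  \sum_(J <- D) (c J / d J `^ (2 * alpha) * trace_vol phi a l b h J *
     \sum_(0 <= k < m) kap alpha (h / d J / 2 ^+ k)) <= local_const * (h ^+ n / h `^ (2 * alpha)).
Proof.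
move=> h0; set tr := trace_vol phi a l b h.
have tr0 J : 0 <= tr J by exact: trace_vol_ge0.
have kp0 J : 0 <= kap alpha (h / d J) by rewrite kap_ge0// divr_ge0 ?(ltW h0) ?(ltW (d0 _)).
apply: (@le_trans _ _ (halving_const alpha *
   (\sum_(J <- D | (d J <= h) && (0 < tr J)) c J * v J `^ beta +
    (h `^ (2 * alpha))^-1 * \sum_(J <- D) kap alpha (h / d J) * tr J))).
  rewrite mulr_sumr [X in X + _]big_mkcond -big_split mulr_sumr; apply: ler_sum => J _ /=.
  have [K1 K2] := @kap_sum_halving R alpha alpha_gt0 alpha_lt1 (h / d J) m (divr_gt0 h0 (d0 J)).
  have [trJ|trJ] := ltP 0 (tr J); last first.
    have -> : tr J = 0 by apply/le_anti; rewrite trJ tr0.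
    by rewrite !mulr0 mul0r andbF addr0 mulr0.
  have cd0 : 0 <= c J / d J `^ (2 * alpha) * tr J by rewrite mulr_ge0 ?divr_ge0 ?powR_ge0.
  rewrite andbT; have [dh|hd] := leP (d J) h.
    apply: le_trans (ler_wpM2l cd0 K1) _; rewrite mulrC ler_wpM2l//.
    apply: ler_wpDr; first by apply: mulr_ge0; [rewrite invr_ge0 powR_ge0|apply: mulr_ge0].
    rewrite vbeta -mulrA ler_wpM2l// mulrC ler_pM2r ?invr_gt0 ?powR_gt0//.
    exact: (trace_vol_le n_gt0 updn pK cpsi).
  have x1 : h / d J <= 1 by rewrite ler_pdivrMr// mul1r ltW.
  apply: le_trans (ler_wpM2l cd0 (K2 x1)) _.
  apply: scale_exchange_le => //; first by rewrite c0 c1.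
    by rewrite powR_gt0.
  by rewrite ge0_ler_powR ?nnegrE ?(ltW h0) ?(ltW (d0 _)) ?(ltW hd)// mulr_ge0 ?(ltW alpha_gt0).
rewrite /local_const -[leRHS]mulrA; apply: ler_wpM2l; first exact: hv0.
rewrite [leRHS]mulrDl; apply: lerD; first exact: carleson_local.
apply: le_trans (ler_wpM2l _ (kap_overlap n_gt0 alpha_gt0 alpha_lt1 updn pK Kp cphi cpsi a l0 K b h0 h0)) _.
  by rewrite invr_ge0 powR_ge0.
by rewrite le_eqVlt; apply/orP; left; apply/eqP; ring.
Qed.

Variables (g : E -> R) (B : R).
Hypotheses (B0 : 0 <= B)
  (g_lip : forall u w, `|g u - g w| <= B * \sum_(s <- D)
     Num.sqrt (c s) * Num.min (`|u - w| / d s) 1 * (\1_(V s) u + \1_(V s) w)).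

Let amp (h : R) (u : E) := \sum_(s <- D) Num.sqrt (c s) * Num.min (h / d s) 1 * \1_(V s) u.

(** Cauchy-Schwarz with the weights [kap (h / d s)], whose sum over the sets containing [u] is
    bounded by [kap_chain]; the remaining sum is linear in [c]. *)
Let amp_sq h u : 0 < h ->
  amp h u ^+ 2 <= \sum_(s <- D) (Ck * h `^ (2 * alpha)) *
     (c s / d s `^ (2 * alpha) * kap alpha (h / d s)) * \1_(V s) u.
Proof.
move=> h0.
have hd0 s : 0 < h / d s by rewrite divr_gt0.
have k0 s : 0 <= kap alpha (h / d s) * \1_(V s) u.
  by rewrite mulr_ge0 ?indicE ?ler0n// kap_ge0// ltW.
have -> : amp h u = h `^ alpha * \sum_(s <- D) (Num.sqrt (c s) / d s `^ alpha) * (kap alpha (h / d s) * \1_(V s) u).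
  rewrite /amp mulr_sumr; apply: eq_bigr => s _; rewrite mulrA [RHS]mulrA; congr (_ * _).
  have -> : Num.min (h / d s) 1 = (h / d s) `^ alpha * kap alpha (h / d s).
    by rewrite kapE mulrA divff ?mul1r// gt_eqF// powR_gt0.
  by rewrite powR_div ?(ltW h0)//; ring.
rewrite exprMn powR_sqr.
apply: (@le_trans _ _ (h `^ (2 * alpha) * ((\sum_(s <- D) c s / d s `^ (2 * alpha) *
    (kap alpha (h / d s) * \1_(V s) u)) * Ck))).
  rewrite ler_wpM2l ?powR_ge0//; apply: le_trans (weighted_Cauchy_Schwarz _ _ k0) _.
  have -> : \sum_(i <- D) (Num.sqrt (c i) / d i `^ alpha) ^+ 2 * (kap alpha (h / d i) * \1_(V i) u) =
    \sum_(s <- D) c s / d s `^ (2 * alpha) * (kap alpha (h / d s) * \1_(V s) u).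
    apply: eq_bigr => s _; congr (_ * _); rewrite expr_div_n sqr_sqrtr//.
    by rewrite powR_sqr.
  apply: ler_wpM2l; last exact: (kap_chain n_gt0 alpha_gt0 alpha_lt1 updn pK Kp cphi cpsi a l0 K u h0).
  by apply: sumr_ge0 => s _; rewrite mulr_ge0// divr_ge0 ?powR_ge0.
rewrite mulrC -mulrA mulr_suml le_eqVlt; apply/orP; left; apply/eqP.
by apply: eq_bigr => s _; ring.
Qed.

Let g_sq h u w : 0 < h -> `|u - w| <= h ->
  `|g u - g w| ^+ 2 <= 2 * B ^+ 2 * amp h u ^+ 2 + 2 * B ^+ 2 * amp h w ^+ 2.
Proof.
move=> h0 uw.
have H : `|g u - g w| <= B * (amp h u + amp h w).
  apply: le_trans (g_lip u w) _; rewrite ler_wpM2l// -big_split; apply: ler_sum => s _ /=.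
  rewrite -mulrDr ler_wpM2r ?addr_ge0 ?indicE ?ler0n// ler_wpM2l ?sqrtr_ge0//.
  by rewrite le_min !ge_min lexx orbT andbT ler_pM2r ?invr_gt0 ?d0// uw.
have A0 x : 0 <= amp h x.
  by apply: sumr_ge0 => s _; rewrite !mulr_ge0 ?sqrtr_ge0 ?indicE ?ler0n// le_min divr_ge0 ?(ltW h0) ?(ltW (d0 _)) ?ler01.
apply: (@le_trans _ _ ((B * (amp h u + amp h w)) ^+ 2)).
  by rewrite lerXn2r ?nnegrE ?mulr_ge0 ?addr_ge0.
move: (amp h u) (amp h w) => x y.
have : 0 <= B ^+ 2 * (x - y) ^+ 2 by rewrite mulr_ge0 ?sqr_ge0.
move=> H0; rewrite -subr_ge0.
by rewrite (_ : _ - _ = B ^+ 2 * (x - y) ^+ 2)//; ring.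
Qed.

Definition carleson_const : R :=
  2 ^+ n * (2 * 6 `^ (@Qexp R n alpha) * (2 * Ck * local_const)) * (4 ^+ n / 4 `^ (2 * alpha)).

(** On each grid the squared differences are dominated by combinations of indicators of the [V s],
    and the sum over the levels of the grid becomes [carleson_scales]. *)
Lemma carleson_Qnorm : (Qnorm alpha g <= (Num.sqrt carleson_const * B)%:E)%E.
Proof.
have lc0 : 0 <= local_const.
  have T0 : 0 <= top_const.
    by rewrite addr_ge0// mulr_ge0 ?powR_ge0// mulr_ge0// exprn_ge0// addr_ge0// mulr_ge0// sqr_ge0.
  by rewrite mulr_ge0// addr_ge0.
have CC0 : 0 <= carleson_const.
  apply: mulr_ge0; last by rewrite divr_ge0 ?exprn_ge0 ?powR_ge0.
  apply: mulr_ge0; first by rewrite exprn_ge0.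
  apply: mulr_ge0; first by rewrite mulr_ge0 ?powR_ge0.
  by apply: mulr_ge0 => //; rewrite mulr_ge0.
apply: Qnorm_le => //; first by rewrite mulr_ge0// sqrtr_ge0.
move=> Q; set r := side Q; have r0 : 0 < r by exact: side_gt0.
have L0 : 0 < 4 * r by rewrite mulr_gt0.
pose h k := 4 * r / 2 ^+ k; have hk0 k : 0 < h k by rewrite divr_gt0 ?exprn_gt0.
pose co k s := 2 * B ^+ 2 * (Ck * h k `^ (2 * alpha)) * (c s / d s `^ (2 * alpha) * kap alpha (h k / d s)).
have co0 k s : 0 <= co k s.
  rewrite /co; apply: mulr_ge0.
    by rewrite mulr_ge0 ?mulr_ge0 ?sqr_ge0 ?powR_ge0.
  by rewrite mulr_ge0 ?divr_ge0 ?powR_ge0// kap_ge0// divr_ge0 ?(ltW (d0 _)) ?(ltW (hk0 _)).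
pose H (t : {ffun 'I_n -> bool}) k (x : L) : \bar R := (\sum_(s <- D) co k s * \1_(V s) x)%:E.
pose B' := 2 * B ^+ 2 * Ck * (local_const * ((4 * r) ^+ n / (4 * r) `^ (2 * alpha))).
apply: le_trans (Qenergy_le_grids (H := H) (B := B') n_gt0 alpha_gt0 _ _ _ _) _.
- move=> t k; apply/measurable_EFinP; apply: measurable_sum => s; apply: measurable_funM => //.
  apply: measurable_indic; exact: measurable_pcell.
- by move=> t k x; rewrite lee_fin; apply: sumr_ge0 => s _; rewrite mulr_ge0// indicE.
- move=> t k x y hx hy xy; rewrite -EFinD lee_fin.
  have xyh : `|x - y| <= h k.
    apply/normr_le_rV; first exact: ltW.
    have cx := cell_code k L0 hx; have cy := cell_code k L0 hy.
    move=> i; have := cx i; have := cy i; rewrite xy /wside size_code -/(h k) rowB ler_norml; lra.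
  apply: le_trans (g_sq (hk0 k) xyh) _.
  have A z : 2 * B ^+ 2 * amp (h k) z ^+ 2 <= \sum_(s <- D) co k s * \1_(V s) z.
    apply: le_trans (ler_wpM2l _ (amp_sq z (hk0 k))) _; first by rewrite mulr_ge0 ?sqr_ge0.
    rewrite mulr_sumr le_eqVlt; apply/orP; left; apply/eqP; apply: eq_bigr => s _.
    by rewrite /co; ring.
  exact: lerD (A x) (A y).
- move=> t; apply: nneseries_le_bound => [k|m].
    rewrite mule_ge0 ?lee_fin ?scale_weight_ge0//; apply: integral_ge0 => x _.
    by rewrite lee_fin; apply: sumr_ge0 => s _; rewrite mulr_ge0// indicE.
  set b := grid_corner _ _ t.
  under eq_bigr => k _ do rewrite /H (integral_sum_indic n_gt0 updn pK cphi cpsi a l0 b (4 * r) D (co0 k)) -EFinM.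
  rewrite sumEFin lee_fin /B'.
  have C20 : 0 <= 2 * B ^+ 2 * Ck by rewrite mulr_ge0// mulr_ge0// sqr_ge0.
  apply: le_trans (ler_wpM2l C20 (carleson_scales b m L0)).
  rewrite mulr_sumr.
  under eq_bigr do rewrite mulr_sumr.
  rewrite exchange_big /= le_eqVlt; apply/orP; left; apply/eqP; apply: eq_bigr => s _.
  rewrite mulr_sumr mulr_sumr; apply: eq_bigr => k _.
  rewrite /co /scale_weight -/(h k).
  have -> : 4 * r / d s / 2 ^+ k = h k / d s by rewrite mulrAC.
  have := powR_gt0 (2 * alpha) (hk0 k); have := powR_gt0 (2 * alpha) (d0 s).
  move: (h k `^ _) (d s `^ _) (kap _ _) (trace_vol _ _ _ _ _ _) => x y z w y0 x0.
  by field; rewrite !gt_eqF.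
rewrite lee_fin exprMn sqr_sqrtr// powR_Qbeta// /B' /carleson_const.
rewrite exprMn powRM ?(ltW r0)// le_eqVlt; apply/orP; left; apply/eqP.
have := powR_gt0 (2 * alpha) r0; have := powR_gt0 (2 * alpha) (ltr0n R 4).
move: (_ `^ _) (r `^ _) => x y x0 y0; field; rewrite !gt_eqF//.
Qed.

End carleson.

(** * Necessity *)

Section energy_below.
Context {d : measure_display} {T : measurableType d} {R : realType}.
Variable m : {measure set T -> \bar R}.
Local Open Scope ereal_scope.

Lemma iterated_integral_ge (A P P' : set T) (F : T * T -> \bar R) (k : R) :
  measurable A -> measurable P -> measurable P' -> P `<=` A -> P' `<=` A -> (0 <= k)%R ->
  (forall z, 0 <= F z) -> (forall x y, P x -> P' y -> k%:E <= F (x, y)) ->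
  k%:E * m P * m P' <= \int[m]_(y in A) \int[m]_(x in A) F (x, y).
Proof.
move=> mA mP mP' PA P'A k0 F0 kF.
have inner y : P' y -> k%:E * m P <= \int[m]_(x in A) F (x, y).
  move=> Py; apply: (@le_trans _ _ (\int[m]_(x in A) (k%:E * (\1_P x)%:E))).
    rewrite ge0_integralZl//; first by rewrite integral_indic// setIidl.
    by apply/measurable_funTS/measurable_EFinP; exact: measurable_indic.
  apply: le_integral_lower => x Ax; first by rewrite mule_ge0 ?lee_fin.
  rewrite indicE; have [/set_mem Px|_] := boolP (x \in P); last by rewrite mule0.
  by rewrite mule1; exact: kF.
have kP0 : 0 <= k%:E * m P by rewrite mule_ge0.
apply: (@le_trans _ _ (\int[m]_(y in A) (k%:E * m P * (\1_P' y)%:E))).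
  rewrite ge0_integralZl//; first by rewrite integral_indic// setIidl.
  by apply/measurable_funTS/measurable_EFinP; exact: measurable_indic.
apply: le_integral_lower => y Ay; first by rewrite mule_ge0 ?lee_fin.
rewrite indicE; have [/set_mem Py|_] := boolP (y \in P'); last first.
  by rewrite mule0 integral_ge0.
by rewrite mule1; exact: inner.
Qed.
End energy_below.

(** * Tent functions and the energy of their images *)

Section tents.
Context {R : realType} {n : nat}.
Hypothesis n_gt0 : (0 < n)%N.
Local Notation E := 'rV[R]_n.
Local Notation L := (caratheodory_type (@lebesgue_outer_rV R n)).
Local Notation mu := (@lebesgue_rV R n).
Local Notation word := (seq {ffun 'I_n -> bool}).
Variable alpha : R.
Hypotheses (alpha_gt0 : 0 < alpha) (alpha_lt1 : alpha < 1) (alpha_lt : alpha < n%:R / 2).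
Variables (up dn : R -> R) (phi psi : E -> E).
Hypotheses (updn : distortion up dn) (pK : cancel phi psi) (Kp : cancel psi phi)
  (cphi : continuous phi) (psi_cont : continuous psi) (cpsi : ratio_control up dn psi).
Variables (a : E) (l : R).
Hypothesis l0 : 0 < l.
Local Notation V := (pcell phi a l).
Local Notation v := (pvol phi a l).
Local Notation d := (pdiam phi a l).
Local Notation beta := (@Qbeta R n alpha).
Local Notation p := (@Qexp R n alpha).

Let d0 s : 0 < d s. Proof. exact: (pdiam_gt0 n_gt0 updn pK Kp cpsi a l0 s). Qed.
Let dX s : d s ^+ n = v s. Proof. exact: (pdiamX n_gt0 updn pK Kp cpsi a l0 s). Qed.
Let u1 : 0 < up 1. Proof. exact: updn.1. Qed.
Let u2 : 0 < up 2. Proof. exact: updn.1. Qed.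

(** Small enough for the support of the tent to be mapped by [phi] into the middle half of the cell:
    outside it the radius is at most [up 2] times the distance to the apex, and [d] is at most
    [2 * up 1] times the radius. *)
Definition tent_scale : R := (4 * (1 + up 1) * (1 + up 2))^-1.
Local Notation c1 := tent_scale.

Lemma tent_scale_gt0 : 0 < c1.
Proof. by rewrite invr_gt0 !mulr_gt0// addr_gt0. Qed.

Lemma tent_scale_le1 : c1 <= 1.
Proof.
have H : 1 <= 4 * (1 + up 1) * (1 + up 2) by have := mulr_gt0 u1 u2; move: u1 u2; move: (up 1) (up 2) => x y; nra.
by rewrite invf_le1// (lt_le_trans ltr01 H).
Qed.

Local Notation rho s := (image_radius psi (wcenter a l s) (wside l s / 2)).

Let h0 (s : word) : 0 < wside l s / 2. Proof. by rewrite divr_gt0// wside_gt0. Qed.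

Lemma pdiam_le_radius s : d s <= 2 * (up 1 * rho s).
Proof.
have r0 : 0 <= 2 * (up 1 * rho s) by rewrite !mulr_ge0 ?normr_ge0 ?(ltW u1).
rewrite -(ler_pXn2r n_gt0) ?nnegrE ?(ltW (d0 s))// dX -lee_fin -(pvol_fin n_gt0 updn pK cpsi a l0).
apply: (preimage_volume_le n_gt0 updn pK cpsi ltr01 (h0 s)) => y.
by rewrite mul1r; exact: cell_sub_ball.
Qed.

Lemma radius_le_pdiam s : 2 * ((up 1)^-1 * rho s) <= d s.
Proof.
have r0 : 0 <= 2 * ((up 1)^-1 * rho s) by rewrite !mulr_ge0 ?normr_ge0 ?invr_ge0 ?(ltW u1).
rewrite -(ler_pXn2r n_gt0) ?nnegrE ?(ltW (d0 s))// dX -lee_fin -(pvol_fin n_gt0 updn pK cpsi a l0).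
exact: (preimage_volume_ge n_gt0 updn pK Kp cpsi (h0 s) (@ball_sub_cell _ _ a l s ^~ l0)).
Qed.

Definition tent (s : word) (u : E) : R :=
  Num.max 0 (1 - `|u - psi (wcenter a l s)| / (c1 * d s)).

Let r0 s : 0 < c1 * d s. Proof. by rewrite mulr_gt0// tent_scale_gt0. Qed.

Lemma tent_ge0 s u : 0 <= tent s u. Proof. by rewrite le_max lexx. Qed.

Lemma tent_le1 s u : tent s u <= 1.
Proof. by rewrite ge_max ler01 gerBl divr_ge0// ltW. Qed.

Lemma continuous_tent s : continuous (tent s).
Proof.
pose t (u : E) : R := 1 - `|u - psi (wcenter a l s)| / (c1 * d s).
have -> : tent s = (fun u => 2^-1 * (t u + `|t u|)).
  apply/funext => u; rewrite /tent -/(t u).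
  have [t0|t0] := leP 0 (t u); [rewrite ger0_norm//|rewrite ltr0_norm//]; lra.
have ct : continuous t.
  move=> u; apply: (@continuousB R R E (fun=> 1)); first exact: cst_continuous.
  apply: (@continuousM R E (fun x : E => `|x - psi (wcenter a l s)|) (fun=> _)); last exact: cst_continuous.
  apply: (continuous_comp (f := fun x : E => x - psi (wcenter a l s))); last exact: norm_continuous.
  by apply: continuousB; [exact: cvg_id|exact: cst_continuous].
move=> u; apply: (@continuousM R E (fun=> _)); first exact: cst_continuous.
apply: (@continuousD R R E t); first exact: ct.
by apply: (continuous_comp (f := t)); [exact: ct|exact: norm_continuous].
Qed.

Lemma tent_far s u : wside l s / 4 <= `|phi u - wcenter a l s| -> tent s u = 0.
Proof.
move=> far; apply/max_idPl; rewrite subr_le0 ler_pdivlMr// mul1r.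
have H : wside l s / 2 <= 2 * `|phi u - wcenter a l s| by lra.
have := image_dist_ge n_gt0 cpsi (ltr0n R 2) (h0 s) H; rewrite pK => ru.
have := pdiam_le_radius s; rewrite /c1; set x := `|u - _| in ru * => dr.
rewrite mulrC ler_pdivrMr ?mulr_gt0 ?addr_gt0//.
have x0 : 0 <= x by exact: normr_ge0.
have : 2 * (up 1 * rho s) <= 2 * (up 1 * (up 2 * x)) by rewrite ler_pM2l// ler_pM2l.
move=> /(le_trans dr) /le_trans; apply.
have := mulr_ge0 x0 (ltW u1); have := mulr_ge0 x0 (ltW u2); have := mulr_ge0 x0 (mulr_ge0 (ltW u1) (ltW u2)).
by move: (up 1) (up 2) => y z; lra.
Qed.

Lemma tent_out s u : ~ V s u -> tent s u = 0.
Proof.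
move=> nV; apply: tent_far; rewrite leNgt; apply/negP => H; apply: nV.
by apply: (ball_sub_cell l0); have := wside_gt0 s l0; lra.
Qed.

Lemma tent_lip s u w :
  `|tent s u - tent s w| <= c1^-1 * (Num.min (`|u - w| / d s) 1 * (\1_(V s) u + \1_(V s) w)).
Proof.
have i1 : 1 <= c1^-1 by rewrite invf_ge1 ?tent_scale_gt0// tent_scale_le1.
have m0 : 0 <= Num.min (`|u - w| / d s) 1 by rewrite le_min ler01 divr_ge0// ltW.
have [outs|ins] := pselect (~ V s u /\ ~ V s w).
  by rewrite !tent_out ?subrr ?normr0 ?mulr_ge0 ?addr_ge0 ?indicE ?ler0n ?(le_trans ler01 i1)//; tauto.
apply: (@le_trans _ _ (c1^-1 * Num.min (`|u - w| / d s) 1)); last first.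
  rewrite mulrA ler_peMr ?mulr_ge0 ?(le_trans ler01 i1)// !indicE.
  have [uV|/negP uV] := boolP (u \in V s); first by rewrite lerDl ler0n.
  have -> : w \in V s by apply/mem_set; apply: contrapT => nw; apply: ins; split => // /mem_set.
  by rewrite add0r.
have [b0u b1u b0w b1w] := And4 (tent_ge0 s u) (tent_le1 s u) (tent_ge0 s w) (tent_le1 s w).
rewrite minr_pMr ?(le_trans ler01 i1)// mulr1 le_min; apply/andP; split; last first.
  by rewrite ler_norml; lra.
have -> : c1^-1 * (`|u - w| / d s) = `|u - w| / (c1 * d s) by rewrite invfM mulrCA.
set x := `|u - psi (wcenter a l s)| / (c1 * d s); set y := `|w - psi (wcenter a l s)| / (c1 * d s).
have xy : `|x - y| <= `|u - w| / (c1 * d s).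
  rewrite /x /y -mulrBl normrM (gtr0_norm (_ : 0 < _^-1)) ?invr_gt0// ler_pM2r ?invr_gt0//.
  apply: le_trans (ler_dist_dist _ _) _; by rewrite opprB addrA subrK.
apply: le_trans xy; rewrite /tent -/x -/y.
move: x y => x y; have := ler_norm (x - y); have := ler_norm (y - x); rewrite [`|y - x|]distrC => A B.
by have [|] := leP 0 (1 - x); have [|] := leP 0 (1 - y) => ? ?; rewrite ler_norml; lra.
Qed.

Let e1 := c1 / up 1.
(** The choice of [e1] gives [e1 * rho <= c1 * d / 2], by [radius_le_pdiam], so that on the
    corresponding ball the tent is at least 1/2. The minimum with 1 keeps that ball inside the
    cell. *)
Definition core_ratio : R := Num.min (dn e1) 1.
Let e10 : 0 < e1. Proof. by rewrite divr_gt0// tent_scale_gt0. Qed.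

Lemma core_ratio_gt0 : 0 < core_ratio.
Proof. by rewrite lt_min ltr01 andbT updn.2. Qed.

Lemma tent_core s x : `|x - wcenter a l s| < core_ratio * (wside l s / 2) -> 2^-1 <= tent s (psi x).
Proof.
move=> near; rewrite le_max; apply/orP; right.
have near' : `|wcenter a l s - x| <= dn e1 * `|wcenter a l s - (wcenter a l s + const_mx (wside l s / 2))|.
  rewrite opprD addNKr normrN normr_const_mx ?(ltW (h0 s))// distrC.
  by apply/ltW/(lt_le_trans near); rewrite ler_pM2r// ge_min lexx.
have := cpsi.2 _ _ _ _ e10 near'; rewrite -/(rho s) distrC => H.
have : `|psi x - psi (wcenter a l s)| / (c1 * d s) <= 2^-1; last by lra.
rewrite ler_pdivrMr//; apply: le_trans H _; have := radius_le_pdiam s.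
have -> : e1 * rho s = c1 / 2 * (2 * ((up 1)^-1 * rho s)) by rewrite /e1; field; rewrite gt_eqF.
by move=> /(ler_wpM2l (_ : 0 <= c1 / 2)); rewrite divr_ge0 ?(ltW tent_scale_gt0)// => /(_ isT); lra.
Qed.

Definition tent_energy_const : R :=
  4^-1 / Num.sqrt n%:R `^ p * core_ratio ^+ n * 4^-1 ^+ n.

Lemma tent_energy_const_gt0 : 0 < tent_energy_const.
Proof.
by rewrite !mulr_gt0 ?exprn_gt0 ?invr_gt0 ?powR_gt0 ?sqrtr_gt0 ?ltr0n ?core_ratio_gt0.
Qed.

Lemma tent_energy s :
  ((tent_energy_const * (wside l s ^+ n) `^ beta)%:E <= Qenergy alpha (tent s \o psi) (hcube a l))%E.
Proof.
have s0 := wside_gt0 s l0; set c := wcenter a l s; set w := wside l s.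
have cr0 : 0 < core_ratio * (w / 2) by rewrite mulr_gt0 ?core_ratio_gt0// h0.
have w80 : 0 < w / 8 by rewrite divr_gt0.
pose P := [set x : E | `|x - c| < core_ratio * (w / 2)].
(* The ball of radius w / 8 about this point lies in the cell but outside of its middle half, so the
   image of the tent vanishes there, while it is at least 1/2 on [P]. *)
pose z := c + const_mx (3 / 8 * w).
pose P' := [set x : E | `|x - z| < w / 8].
have openB (y : E) (e : R) : 0 < e -> open [set x : E | `|x - y| < e].
  move=> e0; apply/open_rVP => x /= xy; exists (e - `|x - y|); first by rewrite subr_gt0.
  move=> x' H; rewrite -(subrKA x); apply: le_lt_trans (ler_normD _ _) _; lra.
have PJ : P `<=` cell a l s.
  move=> x Px; apply: (ball_sub_cell l0); apply: lt_le_trans Px _.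
  by rewrite ler_piMl ?(ltW (h0 s))// ge_min lexx orbT.
have P'x x : P' x -> cell a l s x /\ w / 4 <= `|x - c|.
  move=> /(normr_lt_rV _ w80).1 H; have Hi i : `|x ord0 i - (c ord0 i + 3 / 8 * w)| < w / 8.
    by have := H i; rewrite rowB (_ : z ord0 i = c ord0 i + 3 / 8 * w)//; rewrite !mxE.
  split; last first.
    have := coord_le_normr (x - c) (Ordinal n_gt0); rewrite rowB; apply: le_trans.
    by have := Hi (Ordinal n_gt0); rewrite ltr_norml ler_normr; lra.
  apply: (ball_sub_cell l0); apply/normr_lt_rV; first exact: h0.
  by move=> i; have := Hi i; rewrite rowB -/c !ltr_norml -/w; lra.
have k0 : 0 <= 4^-1 / (Num.sqrt n%:R * w) `^ p by rewrite divr_ge0 ?powR_ge0.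
apply: le_trans (@iterated_integral_ge _ L R mu (hcube a l) P P' _ (4^-1 / (Num.sqrt n%:R * w) `^ p)
  (measurable_hcube a l) _ _ _ _ k0 (@Qker_ge0 _ _ alpha _) _).
- have HP := lebesgue_rV_open_ball_ge c cr0; have HP' := lebesgue_rV_open_ball_ge z w80.
  apply: le_trans (lee_pmul _ _ (lee_wpmul2l _ HP) HP'); last first.
  + by rewrite lee_fin.
  + by rewrite lee_fin exprn_ge0// mulr_ge0// ltW.
  + by rewrite -EFinM lee_fin mulr_ge0// exprn_ge0// mulr_ge0// ltW.
  rewrite -!EFinM lee_fin powR_Qbeta// /tent_energy_const.
  have -> : (Num.sqrt n%:R * w) `^ p = Num.sqrt n%:R `^ p * w `^ p by rewrite powRM ?sqrtr_ge0 ?(ltW s0).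
  rewrite le_eqVlt; apply/orP; left; apply/eqP.
  have -> : 2 * (core_ratio * (w / 2)) = core_ratio * w by field.
  have -> : 2 * (w / 8) = 4^-1 * w by field.
  have -> : (core_ratio * w) ^+ n = core_ratio ^+ n * w ^+ n by rewrite exprMn.
  have -> : (4^-1 * w) ^+ n = 4^-1 ^+ n * w ^+ n by rewrite exprMn.
  rewrite (_ : w `^ p = w ^+ n * w `^ (2 * alpha)); last first.
    by rewrite -powR_mulrn ?(ltW s0)// -powRD// (gt_eqF s0) implybT.
  have := powR_gt0 (2 * alpha) s0; have := exprn_gt0 n s0.
  have : 0 < Num.sqrt (n%:R : R) `^ p by rewrite powR_gt0// sqrtr_gt0 ltr0n.
  move: (Num.sqrt _ `^ _) (w ^+ n) (w `^ _) (core_ratio ^+ n) (_ ^+ n) => x1 x2 x3 x4 x5 y1 y2 y3.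
  by field; rewrite !gt_eqF.
- exact: open_lebesgue_measurable (openB _ _ cr0).
- exact: open_lebesgue_measurable (openB _ _ w80).
- by apply: subset_trans PJ _; exact: cell_sub_nil.
- by move=> x /P'x[/(cell_sub_nil l0)].
- move=> x y Px P'y; rewrite /Qker /= lee_fin.
  have [yJ yc] := P'x _ P'y.
  rewrite (@tent_far s (psi y)) ?Kp// subr0 ger0_norm ?tent_ge0//.
  have xy : 0 < `|x - y|.
    rewrite normr_gt0 subr_eq0; apply/eqP => xy; move: Px yc; rewrite /P /= xy => Px yc.
    have := tent_core Px; rewrite tent_far ?Kp//.
    by rewrite leNgt invr_gt0 ltr0n.
  have en0 : 0 < enorm (x - y) by apply: lt_le_trans (enorm_ge _).
  apply: ler_pM; rewrite ?invr_ge0 ?powR_ge0//.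
    by have := tent_core Px; move: (tent _ _) => t t2; nra.
  have q0 : 0 < Num.sqrt n%:R * w by rewrite mulr_gt0// sqrtr_gt0 ltr0n.
  rewrite lef_pV2 ?posrE ?powR_gt0//.
  apply: ge0_ler_powR; rewrite ?nnegrE ?(ltW q0) ?(ltW en0)//.
    by rewrite /Qexp addr_ge0 ?ler0n// mulr_ge0// ltW.
  apply: le_trans (enorm_le _) _; rewrite ler_wpM2l ?sqrtr_ge0//.
  apply/normr_le_rV; first exact: ltW.
  by move=> i; have := PJ _ Px i; have := yJ i; rewrite rowB ler_norml -/w; lra.
Qed.

End tents.

(** * Choice of signs *)

Section parallelogram.
Context {R : realType} {n : nat}.
Hypothesis n_gt0 : (0 < n)%N.
Local Notation E := 'rV[R]_n.
Local Notation L := (caratheodory_type (@lebesgue_outer_rV R n)).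
Local Notation mu := (@lebesgue_rV R n).
Variable alpha : R.

Lemma Qenergy_prod (k : E -> R) (A : set E) : measurable_fun [set: L] k -> measurable (A : set L) ->
  Qenergy alpha k A = (\int[mu \x mu]_(z in A `*` A) Qker alpha k z)%E.
Proof.
move=> mk mA; apply: (@iterated_integral_prod _ L R mu A A (Qker alpha k) mA mA).
  exact: measurable_Qkernel.
exact: Qker_ge0.
Qed.

Lemma Qenergy_parallelogram (f g : E -> R) (A : set E) :
  measurable_fun [set: L] f -> measurable_fun [set: L] g -> measurable (A : set L) ->
  (Qenergy alpha (fun x => f x + g x)%R A + Qenergy alpha (fun x => f x - g x)%R A =
   (Qenergy alpha f A + Qenergy alpha f A) + (Qenergy alpha g A + Qenergy alpha g A))%E.
Proof.
move=> mf mg mA.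
have mD : measurable_fun [set: L] (fun x => f x + g x) by exact: measurable_funD.
have mB : measurable_fun [set: L] (fun x => f x - g x) by exact: measurable_funB.
have mK (k : E -> R) : measurable_fun [set: L] k -> measurable_fun ((A : set L) `*` (A : set L)) (Qker alpha k).
  by move=> mk; apply: measurable_funTS; exact: measurable_Qkernel.
have K0 (k : E -> R) z : ((A : set L) `*` (A : set L)) z -> (0 <= Qker alpha k z)%E by move=> _; exact: Qker_ge0.
have mAA : measurable (A `*` A : set (L * L)) by exact: measurableX.
rewrite (Qenergy_prod mD mA) (Qenergy_prod mB mA) (Qenergy_prod mf mA) (Qenergy_prod mg mA).
rewrite -(ge0_integralD _ mAA (K0 _) (mK _ mD) (K0 _) (mK _ mB)).
rewrite -(ge0_integralD _ mAA (K0 _) (mK _ mf) (K0 _) (mK _ mf)).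
rewrite -(ge0_integralD _ mAA (K0 _) (mK _ mg) (K0 _) (mK _ mg)).
rewrite -ge0_integralD//.
- apply: eq_integral => z _; rewrite /Qker -!EFinD; congr _%:E.
  have sq (x : R) : `|x| ^+ 2 = x ^+ 2 by rewrite real_normK ?num_real.
  by rewrite !sq; ring.
- by move=> z Az; apply: adde_ge0; exact: K0.
- by apply: emeasurable_funD; exact: mK.
- by move=> z Az; apply: adde_ge0; exact: K0.
- by apply: emeasurable_funD; exact: mK.
Qed.

(** By the parallelogram identity the energies for the two signs have the sum of the given energies
    as their mean. *)
Lemma exists_sign (f g : E -> R) (A : set E) (x y : R) :
  measurable_fun [set: L] f -> measurable_fun [set: L] g -> measurable (A : set L) ->
  (x%:E <= Qenergy alpha f A)%E -> (y%:E <= Qenergy alpha g A)%E ->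
  exists e : bool, ((x + y)%:E <= Qenergy alpha (fun u => f u + (-1) ^+ e * g u)%R A)%E.
Proof.
move=> mf mg mA fx gy; apply: contrapT => H.
have Hf : (Qenergy alpha (fun u => f u + g u)%R A < (x + y)%:E)%E.
  rewrite ltNge; apply/negP => h; apply: H; exists false; rewrite expr0.
  by under [X in Qenergy _ X _]eq_fun do rewrite mul1r.
have Ht : (Qenergy alpha (fun u => f u - g u)%R A < (x + y)%:E)%E.
  rewrite ltNge; apply/negP => h; apply: H; exists true; rewrite expr1.
  by under [X in Qenergy _ X _]eq_fun do rewrite mulN1r.
have := lteD Hf Ht; rewrite Qenergy_parallelogram// ltNge.
rewrite -EFinD (_ : x + y + (x + y) = (x + x) + (y + y)); last by ring.
move/negP; apply; rewrite (EFinD (x + x) (y + y)) (EFinD x x) (EFinD y y).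
exact: (leeD (leeD fx fx) (leeD gy gy)).
Qed.

End parallelogram.

Section superposition.
Context {R : realType} {n : nat}.
Hypothesis n_gt0 : (0 < n)%N.
Local Notation E := 'rV[R]_n.
Local Notation L := (caratheodory_type (@lebesgue_outer_rV R n)).
Local Notation mu := (@lebesgue_rV R n).
Local Notation word := (seq {ffun 'I_n -> bool}).
Variable alpha : R.
Hypotheses (alpha_gt0 : 0 < alpha) (alpha_lt1 : alpha < 1) (alpha_lt : alpha < n%:R / 2).
Variables (up dn : R -> R) (phi psi : E -> E).
Hypotheses (updn : distortion up dn) (pK : cancel phi psi) (Kp : cancel psi phi)
  (cphi : continuous phi) (psi_cont : continuous psi) (cpsi : ratio_control up dn psi).
Variables (a : E) (l : R).
Hypothesis l0 : 0 < l.
Local Notation V := (pcell phi a l).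
Local Notation v := (pvol phi a l).
Local Notation d := (pdiam phi a l).
Local Notation beta := (@Qbeta R n alpha).
Local Notation tent := (@tent R n up phi psi a l).

Lemma sqrtZ_energy (c : R) (g : E -> R) (A : set E) : 0 <= c -> measurable_fun [set: L] g ->
  measurable (A : set L) ->
  Qenergy alpha (fun x => Num.sqrt c * g x) A = (c%:E * Qenergy alpha g A)%E.
Proof.
move=> c0 mg mA.
have mcg : measurable_fun [set: L] (fun x => Num.sqrt c * g x) by exact: measurable_funM.
rewrite (Qenergy_prod _ mcg mA) (Qenergy_prod _ mg mA).
have mAA : measurable (A `*` A : set (L * L)) by exact: measurableX.
rewrite -ge0_integralZl_EFin//.
- apply: eq_integral => z _; rewrite /Qker -EFinM; congr _%:E.
  by rewrite mulrA -mulrBr normrM exprMn ger0_norm ?sqrtr_ge0// sqr_sqrtr.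
- by move=> z _; exact: Qker_ge0.
- by apply: measurable_funTS; exact: measurable_Qkernel.
Qed.

Definition superposition (D : seq word) (c : word -> R) (e : word -> bool) (u : E) : R :=
  \sum_(s <- D) (-1) ^+ e s * (Num.sqrt (c s) * tent s u).

Lemma continuous_superposition D c e : continuous (superposition D c e).
Proof.
rewrite /superposition => u; elim: D => [|s D IH].
  under eq_fun do rewrite big_nil; exact: cst_continuous.
under eq_fun do rewrite big_cons.
apply: (@continuousD R R E (fun u => _ * (_ * tent s u))); last exact: IH.
apply: (@continuousM R E (fun=> _)); first exact: cst_continuous.
apply: (@continuousM R E (fun=> _)); first exact: cst_continuous.
exact: continuous_tent.
Qed.

Let mc (f : E -> R) : continuous f -> measurable_fun [set: L] f.
Proof. exact: continuous_lebesgue_measurable. Qed.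

Let mcpsi (f : E -> R) : continuous f -> measurable_fun [set: L] (f \o psi).
Proof.
by move=> cf; apply: mc => x; apply: (@continuous_comp _ _ _ psi f); [exact: psi_cont|exact: cf].
Qed.

(** Signs are fixed one tent at a time, so that the interaction of a new tent with the previous ones
    never lowers the bound. *)
Lemma superposition_energy D c : (forall s, 0 <= c s) -> uniq D ->
  exists e : word -> bool,
  ((\sum_(s <- D) c s * (@tent_energy_const R n alpha up dn * (wside l s ^+ n) `^ beta))%:E <=
   Qenergy alpha (superposition D c e \o psi) (hcube a l))%E.
Proof.
move=> c0; elim: D => [_|s D IH /= /andP[sD uD]].
  by exists (fun=> false); rewrite big_nil; exact: Qenergy_ge0.
have [e He] := IH uD.
have mS : measurable_fun [set: L] (superposition D c e \o psi) by apply/mcpsi/continuous_superposition.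
have mb : measurable_fun [set: L] (tent s \o psi) by apply/mcpsi/continuous_tent.
have mh : measurable (hcube a l : set L) by exact: measurable_hcube.
have Hs : ((c s * (@tent_energy_const R n alpha up dn * (wside l s ^+ n) `^ beta))%:E <=
    Qenergy alpha (fun x => Num.sqrt (c s) * (tent s \o psi) x)%R (hcube a l))%E.
  rewrite sqrtZ_energy// EFinM; apply: lee_wpmul2l; first by rewrite lee_fin.
  exact: (tent_energy n_gt0 alpha_gt0 updn pK Kp cpsi a l0).
have msb : measurable_fun [set: L] (fun x => Num.sqrt (c s) * (tent s \o psi) x) by exact: measurable_funM.
have [b Hb] := exists_sign mS msb mh He Hs.
(* As [D] has no repetitions, changing the sign at [s] leaves the earlier part of the superposition
   unchanged. *)
pose e' (t : word) := if t == s then b else e t; exists e'.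
have supE (x : E) : superposition (s :: D) c e' x = superposition D c e x + (-1) ^+ b * (Num.sqrt (c s) * tent s x).
  rewrite /superposition big_cons /e' eqxx [LHS]addrC; congr (_ + _).
  rewrite big_seq [RHS]big_seq; apply: eq_bigr => t tD; case: eqP => // ts.
  by rewrite -ts tD in sD.
have -> : superposition (s :: D) c e' \o psi =
    (fun u => (superposition D c e \o psi) u + (-1) ^+ b * (Num.sqrt (c s) * (tent s \o psi) u)).
  by apply/funext => x; exact: supE.
by rewrite big_cons addrC.
Qed.

Section carleson_weights.
Variables (K : nat) (c : word -> R).
Local Notation D := (@words_upto n K).
Hypotheses (c0 : forall s, 0 <= c s) (c1 : forall s, c s <= 1)
  (carleson : forall I, I \in D -> \sum_(J <- D | suffix I J) c J * v J `^ beta <= v I `^ beta).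

Let B := (tent_scale up)^-1.
Let B0 : 0 <= B. Proof. by rewrite invr_ge0 ltW// (tent_scale_gt0 updn). Qed.

Lemma superposition_Qnorm e : (Qnorm alpha (superposition D c e) <=
  (Num.sqrt (@carleson_const R n alpha up) * B)%:E)%E.
Proof.
apply: (carleson_Qnorm n_gt0 alpha_gt0 alpha_lt1 alpha_lt updn pK Kp cphi cpsi l0 c0 c1 carleson B0) => u w.
rewrite /superposition -sumrB; apply: le_trans (ler_norm_sum _ _ _) _.
rewrite mulr_sumr; apply: ler_sum => s _.
rewrite -mulrBr normrM normr_sign mul1r -mulrBr normrM ger0_norm ?sqrtr_ge0//.
rewrite -[X in _ <= _ * X]mulrA [leRHS]mulrCA; apply: ler_wpM2l; first exact: sqrtr_ge0.
exact: (tent_lip n_gt0 updn pK Kp cpsi a l0).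
Qed.

Lemma superposition_Qspace e : Qspace alpha (superposition D c e).
Proof.
split; last by apply: le_lt_trans (superposition_Qnorm e) _; rewrite ltry.
split; first by apply/mc/continuous_superposition.
move=> A cA.
have [M HM] : exists M : R, A `<=` box (Some (const_mx (- M), const_mx M)).
  have [M [_ HM]] := compact_bounded cA.
  exists (M + 1) => x Ax i; rewrite !mxE -ler_norml; apply: le_trans (coord_le_normr x i) _.
  by apply: HM => //; rewrite ltrDl.
pose S := \sum_(s <- D) Num.sqrt (c s).
have bd x : `|superposition D c e x| <= S.
  apply: le_trans (ler_norm_sum _ _ _) _; apply: ler_sum => s _.
  rewrite normrM normr_sign mul1r normrM ger0_norm ?sqrtr_ge0// ler_piMr ?sqrtr_ge0//.
  by rewrite ger0_norm ?tent_ge0//; exact: (tent_le1 n_gt0 updn pK Kp cpsi a l0).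
have mA : measurable (A : set L).
  rewrite -(setCK A); apply: measurableC; apply: open_lebesgue_measurable; apply: closed_openC.
  by apply: compact_closed => //; exact: norm_hausdorff.
apply: (@le_lt_trans _ _ (\int[mu]_(x in A) (S ^+ 2)%:E)%E).
  apply: (@le_integral_lower _ L R mu) => x _; rewrite lee_fin ?exprn_ge0// lerXn2r ?nnegrE//.
  exact: le_trans (bd x).
rewrite (@integral_cst _ L R mu _ mA).
apply: lte_mul_pinfty; rewrite ?lee_fin ?sqr_ge0//.
by apply: le_lt_trans (le_lebesgue_rV HM) _; rewrite lebesgue_rV_box ltry.
Qed.

(* The energies of the images of the tents add up, for suitable signs, while
   the superposition has bounded norm. *)
Lemma carleson_packing (M : R) : 0 <= M ->
  (forall f, Qspace alpha f -> (Qnorm alpha (f \o psi) <= M%:E * Qnorm alpha f)%E) ->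
  \sum_(s <- D) c s * (wside l s ^+ n) `^ beta <=
  (@tent_energy_const R n alpha up dn)^-1 * (M * (Num.sqrt (@carleson_const R n alpha up) * B)) ^+ 2
    * (l ^+ n) `^ beta.
Proof.
move=> M0 HM; have [e He] := superposition_energy c0 (uniq_words_upto K).
have b0 : 0 < @tent_energy_const R n alpha up dn by exact: tent_energy_const_gt0.
have N0 : 0 <= M * (Num.sqrt (@carleson_const R n alpha up) * B).
  by rewrite !mulr_ge0// sqrtr_ge0.
have HN : (Qnorm alpha (superposition D c e \o psi) <= (M * (Num.sqrt (@carleson_const R n alpha up) * B))%:E)%E.
  apply: le_trans (HM _ (superposition_Qspace e)) _; rewrite [leRHS]EFinM.
  by apply: lee_wpmul2l (superposition_Qnorm e); rewrite lee_fin.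
pose Q := Cube a l0 true false.
have QE : hcube a l = cube_set Q by rewrite hcube_itv.
have := Qenergy_le Q HN N0; rewrite -QE => /(le_trans He); rewrite lee_fin /=.
rewrite -mulrA ler_pdivlMl// mulr_sumr [leRHS]mulrC; apply: le_trans.
by rewrite le_eqVlt; apply/orP; left; apply/eqP; apply: eq_bigr => s _; rewrite mulrCA.
Qed.

End carleson_weights.
End superposition.

(** A cluster point of an ultrafilter is a limit, and a segment is compact. Convergence along one
    ultrafilter for all words at once replaces a diagonal sequence. *)
Lemma ultrafilter_bounded_cvg {R : realType} (U : set_system nat) (f : nat -> R) (b : R) :
  UltraFilter U -> U [set k | 0 <= f k <= b] -> exists p : R, f @ U --> p.
Proof.
move=> ultraU Uf; have pU : ProperFilter U by exact: ultra_proper.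
have [p [_ clp]] : exists p, `[0, b]%classic p /\ cluster (f @ U) p.
  have [|p [p1 p2]] := @segment_compact R 0 b (f @ U) _; last by exists p.
  by apply: (@filterS _ U _ _ _ _ Uf) => k; rewrite /= in_itv.
exists p => A nA; have [//|nUA] := in_ultra_setVsetC (f @^-1` A) ultraU.
by have [x [nAx Ax]] := clp (~` A) A nUA nA.
Qed.

Lemma cvg_finite_sum {R : realType} {I : Type} (U : set_system nat) (s : seq I) (c : I -> R)
    (f : nat -> I -> R) (p : I -> R) : ProperFilter U -> (forall i, f ^~ i @ U --> p i) ->
  (fun k => \sum_(i <- s) f k i * c i) @ U --> \sum_(i <- s) p i * c i.
Proof.
move=> pU fp; elim: s => [|i s IH].
  rewrite big_nil; under eq_fun do rewrite big_nil; exact: cvg_cst.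
rewrite big_cons; under eq_fun do rewrite big_cons.
by apply: cvgD => //; apply: cvgM => //; exact: cvg_cst.
Qed.

(** * Test families from duality *)

Section dual_weights.
Context {R : realType} {n : nat}.
Hypothesis n_gt0 : (0 < n)%N.
Local Notation E := 'rV[R]_n.
Local Notation L := (caratheodory_type (@lebesgue_outer_rV R n)).
Local Notation mu := (@lebesgue_rV R n).
Local Notation word := (seq {ffun 'I_n -> bool}).

Lemma sum_suffix {V : nmodType} (K : nat) (F : word -> V) (s : word) : (size s <= K)%N ->
  \sum_(I <- words_upto K | suffix I s) F I = \sum_(0 <= i < (size s).+1) F (drop i s).
Proof.
move=> sK; rewrite -big_filter /index_iota subn0 -[RHS](big_map (fun i => drop i s) xpredT F).
apply: perm_big; apply: uniq_perm.
- by rewrite filter_uniq// uniq_words_upto.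
- rewrite map_inj_in_uniq ?iota_uniq// => i j; rewrite !mem_iota /= !add0n !ltnS => si sj /(congr1 size).
  by rewrite !size_drop; lia.
- move=> I; rewrite mem_filter mem_words_upto; apply/andP/mapP.
    case=> /suffixP[w ->] _; exists (size w); last by rewrite drop_size_cat.
    by rewrite mem_iota leq0n add0n ltnS size_cat leq_addr.
  case=> i _ ->; split; last by rewrite size_drop; lia.
  by apply/suffixP; exists (take i s); rewrite cat_take_drop.
Qed.

Lemma suffix_anti : antisymmetric (fun J I : word => suffix I J).
Proof.
move=> s t /andP[/suffixP[w E1] /suffixP[w' E2]].
have := congr1 size E1; rewrite {1}E2 !size_cat => H.
by case: w' E2 H => [-> //|x w'] _; case: (w) => [|y z] /=; lia.
Qed.

Lemma suffix_laminar (J I I' : word) : suffix I J -> suffix I' J -> suffix I' I || suffix I I'.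
Proof.
rewrite 2!suffixE => /eqP <- /eqP <-.
set i := (_ - _)%N; set j := (_ - _)%N; have [ij|/ltnW ji] := leqP i j.
  have -> : drop j J = drop (j - i) (drop i J) by rewrite drop_drop subnK.
  by rewrite suffix_drop orbT.
have -> : drop i J = drop (i - j) (drop j J) by rewrite drop_drop subnK.
by rewrite suffix_drop.
Qed.

Variable alpha : R.
Hypotheses (alpha_gt0 : 0 < alpha) (alpha_lt1 : alpha < 1) (alpha_lt : alpha < n%:R / 2).
Variables (up dn : R -> R) (phi psi : E -> E).
Hypotheses (updn : distortion up dn) (pK : cancel phi psi) (Kp : cancel psi phi)
  (cphi : continuous phi) (psi_cont : continuous psi) (cpsi : ratio_control up dn psi).
Variables (a : E) (l : R).
Hypothesis l0 : 0 < l.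
Local Notation v := (pvol phi a l).
Local Notation beta := (@Qbeta R n alpha).
Local Notation sz := (@csize R n l).

Let v0 s : 0 < v s. Proof. exact: (pvol_gt0 n_gt0 updn pK Kp cpsi a l0 s). Qed.
Let sz0 s : 0 < sz s. Proof. by rewrite exprn_gt0// wside_gt0. Qed.

Definition necessity_const : R :=
  (@tent_energy_const R n alpha up dn)^-1 *
  (Num.sqrt (@carleson_const R n alpha up) * (tent_scale up)^-1) ^+ 2.

Variable M : R.
Hypotheses (M0 : 0 <= M)
  (HM : forall f, Qspace alpha f -> (Qnorm alpha (f \o psi) <= M%:E * Qnorm alpha f)%E).
Local Notation X := (necessity_const * M ^+ 2).

(** Duality on the tree cut at level [K], with capacities [v ^ beta] and profits (sz / v)^beta.
    Dividing the optimal packing by [v ^ beta] gives Carleson coefficients, so [carleson_packing]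
    bounds its value; the dual variables times (v / sz)^beta form the test family. *)
Lemma dual_weights (K : nat) : exists lam : word -> R, [/\ forall s, 0 <= lam s,
  forall s, (size s <= K)%N -> 1 <= \sum_(0 <= i < (size s).+1) lam (drop i s) *
    (sz (drop i s) / sz s * (v s / v (drop i s))) `^ beta &
  \sum_(s <- @words_upto n K) lam s * (sz s / sz [::]) `^ beta <= X].
Proof.
set D := @words_upto n K.
have [sg [Lam [sg0 Lam0 cap cov obj]]] := packing_duality (D := D) (le := fun J I => suffix I J)
  (w := fun s => v s `^ beta) (h := fun s => (sz s / v s) `^ beta)
  (uniq_words_upto K) (@suffix_refl _) (fun y x z yx zy => suffix_trans zy yx) suffix_anti
  suffix_laminar (fun s => powR_ge0 _ _) (fun s => powR_ge0 _ _).
pose c s := if s \in D then sg s / v s `^ beta else 0.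
have c0 s : 0 <= c s by rewrite /c; case: ifP => // _; rewrite divr_ge0 ?powR_ge0.
have cv s : s \in D -> c s * v s `^ beta = sg s.
  by move=> sD; rewrite /c sD divfK// gt_eqF// powR_gt0.
have c1 s : c s <= 1.
  rewrite /c; case: ifP => // sD; rewrite ler_pdivrMr ?powR_gt0// mul1r.
  apply: le_trans (cap s sD); rewrite big_mkcond (bigD1_seq s) ?uniq_words_upto//= suffix_refl lerDl.
  by apply: sumr_ge0 => J _; case: ifP.
have carl I : I \in D -> \sum_(J <- D | suffix I J) c J * v J `^ beta <= v I `^ beta.
  move=> ID; apply: le_trans (cap I ID); rewrite big_seq_cond [leRHS]big_seq_cond.
  by apply: ler_sum => J /andP[JD _]; rewrite cv.
have pack := carleson_packing n_gt0 alpha_gt0 alpha_lt1 alpha_lt updn pK Kp cphi psi_cont cpsi l0 c0 c1 carl M0 HM.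
exists (fun s => Lam s * (v s / sz s) `^ beta); split.
- by move=> s; rewrite mulr_ge0 ?powR_ge0.
- move=> s sK; have sD : s \in D by rewrite mem_words_upto.
  have := cov s sD; rewrite sum_suffix// => /(ler_wpM2r (powR_ge0 (v s / sz s) beta)).
  rewrite -powRM ?divr_ge0 ?(ltW (v0 _)) ?(ltW (sz0 _))//.
  rewrite (_ : sz s / v s * (v s / sz s) = 1); last by field; rewrite !gt_eqF.
  rewrite powR1; move=> /le_trans; apply; rewrite mulr_suml le_eqVlt; apply/orP; left; apply/eqP.
  apply: eq_bigr => i _; set I := drop i s; rewrite -[RHS]mulrA; congr (_ * _).
  transitivity ((v I / sz I * (sz I / sz s * (v s / v I))) `^ beta).
    congr (_ `^ _); have := v0 I; have := sz0 I; have := sz0 s.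
    by move: (v I) (v s) (sz I) (sz s) => x y z t t0 z0 x0; field; rewrite !gt_eqF.
  by rewrite powRM ?mulr_ge0 ?invr_ge0 ?(ltW (v0 _)) ?(ltW (sz0 _)).
- have szb : 0 < sz [::] `^ beta by rewrite powR_gt0.
  have -> : X = (@tent_energy_const R n alpha up dn)^-1 *
      (M * (Num.sqrt (@carleson_const R n alpha up) * (tent_scale up)^-1)) ^+ 2.
    by rewrite /necessity_const [in RHS]exprMn; ring.
  rewrite -(ler_pM2r szb); have -> : sz [::] = l ^+ n by rewrite /csize /wside expr0 divr1.
  apply: le_trans pack; apply: (@le_trans _ _ (\sum_(J <- D) sg J * (sz J / v J) `^ beta)).
    apply: le_trans obj; rewrite mulr_suml le_eqVlt; apply/orP; left; apply/eqP; apply: eq_bigr => s _.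
    rewrite -!mulrA; congr (_ * _); have -> : l ^+ n = sz [::] by rewrite /csize /wside expr0 divr1.
    have B0 := powR_gt0 beta (sz0 s).
    rewrite !powR_div ?(ltW (v0 _)) ?(ltW (sz0 _)) ?sz0//.
    by move: B0 szb; move: (sz s `^ _) (sz [::] `^ _) (v s `^ _) => x y z x0 y0; field; rewrite !gt_eqF.
  rewrite big_seq [leRHS]big_seq le_eqVlt; apply/orP; left; apply/eqP; apply: eq_bigr => s sD.
  rewrite -(cv s sD) -mulrA -powRM ?divr_ge0 ?(ltW (v0 _)) ?(ltW (sz0 _))//.
  by congr (_ * _ `^ _); rewrite mulrC divfK// gt_eqF.
Qed.

(* The weights of the finite trees are bounded cube by cube, hence converge along
   an ultrafilter. *)
Lemma limit_weights : exists lam : word -> R, [/\ forall s, 0 <= lam s,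
  forall s, 1 <= \sum_(0 <= i < (size s).+1) lam (drop i s) *
    (sz (drop i s) / sz s * (v s / v (drop i s))) `^ beta &
  (wsum (fun s => (lam s * (sz s / sz [::]) `^ beta)%:E) <= X%:E)%E].
Proof.
have /choice[f Hf] := dual_weights.
have [U [ultraU Uoo]] := ultraFilterLemma (eventually_filter : ProperFilter \oo).
have pU : ProperFilter U by exact: ultra_proper.
have lim_ge (g : nat -> R) (x y : R) : g @ U --> y -> U [set k | x <= g k] -> x <= y.
  move=> gy Ug; rewrite -(cvg_lim (@Rhausdorff R) gy); apply: limr_ge => //.
  by apply/cvg_ex; exists y.
have lim_le (g : nat -> R) (x y : R) : g @ U --> y -> U [set k | g k <= x] -> y <= x.
  move=> gy Ug; rewrite -(cvg_lim (@Rhausdorff R) gy); apply: limr_le => //.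
  by apply/cvg_ex; exists y.
have mono (P Q : set nat) : P `<=` Q -> U P -> U Q by exact: filterS.
have q0 s : 0 < (sz s / sz [::]) `^ beta by rewrite powR_gt0// divr_gt0.
have Uge (s : word) : U [set k | (size s <= k)%N] by apply: Uoo; exact: nbhs_infty_ge.
have /choice[lam Hlam] : forall s, exists p : R, f ^~ s @ U --> p.
  move=> s; apply: (@ultrafilter_bounded_cvg _ _ _ (X / (sz s / sz [::]) `^ beta)) => //.
  apply: mono (Uge s) => k /= sk; have [f0 _ fX] := Hf k; rewrite f0 /=.
  rewrite ler_pdivlMr//; apply: le_trans fX.
  rewrite (bigD1_seq s) ?uniq_words_upto ?mem_words_upto//= lerDl sumr_ge0// => t _.
  by rewrite mulr_ge0 ?f0// ltW.
have lam0 s : 0 <= lam s.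
  apply: lim_ge (Hlam s) _; apply: mono (@filterT _ U _) => k _ /=.
  by have [f0 _ _] := Hf k; exact: f0.
exists lam; split => //.
- move=> s.
  apply: (lim_ge (fun k => \sum_(0 <= i < (size s).+1) f k (drop i s) *
    (sz (drop i s) / sz s * (v s / v (drop i s))) `^ beta)).
    exact: (@cvg_finite_sum R nat U _
      (fun i => (sz (drop i s) / sz s * (v s / v (drop i s))) `^ beta)
      (fun k i => f k (drop i s)) (fun i => lam (drop i s)) pU (fun i => Hlam (drop i s))).
  by apply: mono (Uge s) => k /= sk; have [_ + _] := Hf k; apply.
- apply: nneseries_le_bound => [k|m].
    by apply: sume_ge0 => s _; rewrite lee_fin mulr_ge0// ltW.
  case: m => [|m].
    rewrite big_nil lee_fin; have [f0 _ fX] := Hf 0%N; apply: le_trans fX.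
    by apply: sumr_ge0 => s _; rewrite mulr_ge0 ?f0// ltW.
  rewrite -sum_words_upto sumEFin lee_fin.
  apply: (lim_le (fun k => \sum_(s <- words_upto m) f k s * (sz s / sz [::]) `^ beta)).
    exact: cvg_finite_sum.
  have Um : U [set k | (m <= k)%N] by apply: Uoo; exact: nbhs_infty_ge.
  apply: mono Um => k /= mk; have [f0 _ fX] := Hf k; apply: le_trans fX.
  rewrite !sum_words_upto [leRHS](big_cat_nat (n := m.+1))//= lerDl.
  by apply: sumr_ge0 => j _; apply: sumr_ge0 => s _; rewrite mulr_ge0 ?f0// ltW.
Qed.

End dual_weights.

(** * Test families for cubes of all types *)

Section necessity.
Context {R : realType} {n : nat}.
Hypothesis n_gt0 : (0 < n)%N.
Local Notation E := 'rV[R]_n.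
Local Notation L := (caratheodory_type (@lebesgue_outer_rV R n)).
Local Notation mu := (@lebesgue_rV R n).
Local Notation word := (seq {ffun 'I_n -> bool}).
Variable alpha : R.
Hypotheses (alpha_gt0 : 0 < alpha) (alpha_lt1 : alpha < 1) (alpha_lt : alpha < n%:R / 2).
Variables (up dn : R -> R) (phi psi : E -> E).
Hypotheses (updn : distortion up dn) (pK : cancel phi psi) (Kp : cancel psi phi)
  (cphi : continuous phi) (psi_cont : continuous psi) (cpsi : ratio_control up dn psi).
Local Notation beta := (@Qbeta R n alpha).

Let kp : R := @doubling_const R n up 1.
Let kp0 : 0 < kp. Proof. exact: (doubling_const_gt0 updn). Qed.

Section typed_volumes.
Variable Q : @cube R n.
Local Notation a := (corner Q).
Local Notation l := (side Q).
Local Notation v := (pvol phi a l).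
Let l0 : 0 < l. Proof. exact: side_gt0. Qed.
Let h0 (s : word) : 0 < wside l s / 2. Proof. by rewrite divr_gt0// wside_gt0. Qed.

(** Boundary faces are dealt with by comparison: typed and half-open cells with the same word lie
    between the same balls, so doubling relates the volumes of their preimages. *)
Definition tvol (s : word) : R := volume (phi @^-1` tcell Q s).

Let tvol_fin s : mu (phi @^-1` tcell Q s) = (tvol s)%:E.
Proof.
rewrite fineK//; apply: (preimage_volume_fin n_gt0 updn pK cpsi ltr01 (h0 s)) => y.
by rewrite mul1r; exact: tcell_sub_ball.
Qed.

Lemma tvol_le s : tvol s <= kp * v s.
Proof.
rewrite -lee_fin [leRHS]EFinM -(pvol_fin n_gt0 updn pK cpsi a l0) -tvol_fin.
apply: (preimage_volume_doubling n_gt0 updn pK Kp cpsi ltr01 (h0 s)) => y.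
  exact: ball_sub_cell.
by rewrite mul1r; exact: tcell_sub_ball.
Qed.

Lemma tvol_ge s : v s <= kp * tvol s.
Proof.
rewrite -lee_fin [leRHS]EFinM -(pvol_fin n_gt0 updn pK cpsi a l0) -tvol_fin.
apply: (preimage_volume_doubling n_gt0 updn pK Kp cpsi ltr01 (h0 s)) => y.
  exact: ball_sub_tcell.
by rewrite mul1r; exact: cell_sub_ball.
Qed.

Lemma tvol_ratio s t : 0 < tvol t /\ v s / v t <= kp ^+ 2 * (tvol s / tvol t).
Proof.
have vt := pvol_gt0 n_gt0 updn pK Kp cpsi a l0 t.
have vs := pvol_gt0 n_gt0 updn pK Kp cpsi a l0 s.
have := tvol_le t; have := tvol_ge t; have := tvol_ge s; move: kp kp0 (v s) (v t) vt vs => k k0 x y y0 x0.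
move: (tvol s) (tvol t) => x' y' h1 h2 h3.
have y'0 : 0 < y' by rewrite -(pmulr_rgt0 _ k0); apply: lt_le_trans h2.
split=> //; rewrite ler_pdivrMr// (_ : k ^+ 2 * (x' / y') * y = k * x' * (k * y / y')); last by ring.
apply: (le_trans h1); rewrite ler_peMr//; first by apply: le_trans h1; exact: ltW.
by rewrite ler_pdivlMr// mul1r.
Qed.
End typed_volumes.

(** The first factor pays for replacing ratios of [v] by ratios of [tvol] in the test inequality. *)
Definition gauge_const : R := (kp ^+ 2) `^ beta * @necessity_const R n alpha up dn.

Theorem necessity_bound (M : R) (Q : @cube R n) : 0 <= M ->
  (forall f, Qspace alpha f -> (Qnorm alpha (f \o psi) <= M%:E * Qnorm alpha f)%E) ->
  (local_gauge beta phi Q <= (gauge_const * M ^+ 2)%:E)%E.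
Proof.
move=> M0 HM; have l0 := side_gt0 Q.
have [lam [lam0 lam1 lamX]] := limit_weights n_gt0 alpha_gt0 alpha_lt1 alpha_lt updn pK Kp
  cphi psi_cont cpsi (corner Q) l0 M0 HM.
have k20 : 0 <= (kp ^+ 2) `^ beta by exact: powR_ge0.
(* Test families are functions of sets; [wd] recovers the word of a dyadic set, and its values on
   other sets are immaterial. *)
have /choice[wd Hwd] : forall I : set E, exists s : word, dyadic Q I -> tcell Q s = I.
  move=> I; have [DI|nD] := pselect (dyadic Q I); last by exists [::].
  by move: DI; rewrite dyadic_range => -[s _ sI]; exists s.
have D s : dyadic Q (tcell Q s) by rewrite dyadic_range; exists s.
have wdK s : wd (tcell Q s) = s by apply: (@tcell_inj R n n_gt0 Q); exact: Hwd.
pose lam' (I : set E) := (kp ^+ 2) `^ beta * lam (wd I).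
have lam'0 I : 0 <= lam' I by rewrite mulr_ge0.
apply: le_trans (ereal_inf_lbound _) _.
  exists lam'; last by reflexivity.
  split=> [I _|J DJ]; first exact: lam'0.
  rewrite -(Hwd J DJ); set s := wd J; rewrite esum_dyadic_sup//; last first.
    by move=> I _; rewrite lee_fin mulr_ge0// powR_ge0.
  rewrite sumEFin lee_fin; apply: le_trans (lam1 s) _; apply: ler_sum => i _.
  set t := drop i s; rewrite /lam' wdK -/(tvol Q s) -/(tvol Q t) !volume_tcell.
  have [t0 ratio] := tvol_ratio Q s t.
  rewrite -[leRHS]mulrA [leRHS]mulrCA ler_wpM2l//.
  have cs : 0 < @csize R n (side Q) t / @csize R n (side Q) s.
    by rewrite divr_gt0 ?exprn_gt0 ?wside_gt0.
  have tr0 : 0 <= tvol Q s / tvol Q t.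
    by rewrite divr_ge0 ?(ltW t0)// fine_ge0//; exact: lebesgue_outer_rV_ge0.
  have A0 := mulr_ge0 (ltW cs) tr0.
  rewrite -[wside _ t ^+ n]/(@csize R n (side Q) t) -[wside _ s ^+ n]/(@csize R n (side Q) s).
  rewrite -powRM ?sqr_ge0//.
  have be := Qbeta_gt0 n_gt0 alpha_lt.
  apply: ge0_ler_powR; rewrite ?nnegrE ?(ltW be)//.
  - rewrite mulr_ge0 ?(ltW cs)// divr_ge0 ?ltW//; exact: (pvol_gt0 n_gt0 updn pK Kp cpsi).
  - exact: mulr_ge0 (sqr_ge0 _) A0.
  - by rewrite [leRHS]mulrCA ler_wpM2l ?(ltW cs).
rewrite esum_dyadic//; last by move=> I _; rewrite lee_fin mulr_ge0// powR_ge0.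
rewrite /gauge_const -mulrA EFinM; apply: le_trans (lee_wpmul2l _ lamX); last by rewrite lee_fin.
rewrite -wsumZl//; last by move=> s; rewrite lee_fin mulr_ge0// powR_ge0.
rewrite le_eqVlt; apply/orP; left; apply/eqP; apply: eq_wsum => s.
rewrite -EFinM /lam' wdK mulrA volume_tcell volume_cube; congr (_ * (_ / _) `^ _)%:E.
by rewrite /csize /wside expr0 divr1.
Qed.

End necessity.

(** * Conclusion *)

Lemma gauge_ge0 {R : realType} {n : nat} (beta : R) (phi : 'rV[R]_n -> 'rV[R]_n) :
  (0 <= gauge beta phi)%E.
Proof.
apply: le_trans (ereal_sup_ubound _); last first.
  by exists (Cube (0 : 'rV[R]_n) ltr01 true true).
apply: le_ereal_inf_tmp => _ [lam [lam0 _] <-].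
by apply: esum_ge0 => I DI; rewrite lee_fin mulr_ge0 ?powR_ge0// lam0.
Qed.

Lemma comp_norm_ge0 {R : realType} {n : nat} (alpha : R) (psi : 'rV[R]_n -> 'rV[R]_n) :
  (0 <= comp_norm alpha psi)%E.
Proof. by apply: le_ereal_inf_tmp => _ [M [M0 _] <-]; rewrite lee_fin. Qed.

(** The absolute values make this at least 1 as a formula in [up] and [dn] alone, whereas the signs
    of the two constants are obtained with the help of a given map. *)
Definition comp_const {R : realType} {n : nat} (alpha : R) (up dn : R -> R) : R :=
  1 + `|@gauge_const R n alpha up dn| + `|@sufficiency_const R n alpha up|.

Lemma comp_const_ge1 {R : realType} {n : nat} (alpha : R) (up dn : R -> R) :
  1 <= @comp_const R n alpha up dn.
Proof. by rewrite /comp_const -addrA lerDl addr_ge0. Qed.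

Section two_sided_bound.
Context {R : realType} {n : nat}.
Hypothesis n_gt0 : (0 < n)%N.
Local Notation E := 'rV[R]_n.
Local Notation mu := (@lebesgue_rV R n).
Variable alpha : R.
Hypotheses (alpha_gt0 : 0 < alpha) (alpha_lt1 : alpha < 1) (alpha_lt : alpha < n%:R / 2).
Variables (up dn : R -> R) (phi psi : E -> E).
Hypotheses (updn : distortion up dn) (pK : cancel phi psi) (Kp : cancel psi phi)
  (cphi : continuous phi) (psi_cont : continuous psi) (cpsi : ratio_control up dn psi).
Hypothesis lusin : forall A : set E, mu A = 0%E -> mu (psi @^-1` A) = 0%E.
Local Notation beta := (@Qbeta R n alpha).

Let s0 : 0 <= @sufficiency_const R n alpha up.
Proof. exact: (sufficiency_const_ge0 n_gt0 alpha_gt0 updn pK Kp cphi cpsi). Qed.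

Local Notation comp_const := (@comp_const R n alpha up dn).

Let C0 : 0 < comp_const. Proof. exact: lt_le_trans ltr01 (comp_const_ge1 _ _ _). Qed.
Let gC : @gauge_const R n alpha up dn <= comp_const.
Proof. by rewrite /comp_const addrAC (le_trans (ler_norm _))// lerDr addr_ge0. Qed.
Let sC : @sufficiency_const R n alpha up <= comp_const.
Proof. by rewrite /comp_const (le_trans (ler_norm _))// lerDr addr_ge0. Qed.

Lemma gauge_le_comp_norm :
  ((comp_const^-1)%:E * gauge beta phi <= comp_norm alpha psi ^+ 2)%E.
Proof.
pose adm := [set M : R | 0 <= M /\ forall f, Qspace alpha f ->
  (Qnorm alpha (f \o psi) <= M%:E * Qnorm alpha f)%E].
have [[M1 M1adm]|noM] := pselect (exists M, adm M); last first.
  have -> : comp_norm alpha psi = +oo%E.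
    rewrite /comp_norm -/adm (_ : [set M%:E | M in adm] = set0) ?ereal_inf0//.
    by apply/seteqP; split => // y [M admM _]; apply: noM; exists M.
  by rewrite expe2 mulyy leey.
have gM M : adm M -> (gauge beta phi <= (comp_const * M ^+ 2)%:E)%E.
  move=> [M0 HM]; apply: ge_ereal_sup => _ [Q _ <-].
  apply: le_trans (necessity_bound n_gt0 alpha_gt0 alpha_lt1 alpha_lt updn pK Kp cphi psi_cont cpsi Q M0 HM) _.
  by rewrite lee_fin ler_wpM2r ?sqr_ge0.
have gfin : gauge beta phi \is a fin_num.
  by rewrite ge0_fin_numE ?gauge_ge0//; apply: le_lt_trans (gM _ M1adm) _; rewrite ltry.
set g := fine (gauge beta phi); have g00 : 0 <= g by rewrite fine_ge0// gauge_ge0.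
have -> : gauge beta phi = g%:E by rewrite fineK.
have gM' M : adm M -> g <= comp_const * M ^+ 2.
  by move=> admM; rewrite -lee_fin /g fineK//; exact: gM.
have q0 : 0 <= comp_const^-1 * g by rewrite mulr_ge0// invr_ge0 ltW.
have : ((Num.sqrt (comp_const^-1 * g))%:E <= comp_norm alpha psi)%E.
  apply: le_ereal_inf_tmp => _ [M [M0 HM] <-]; rewrite lee_fin.
  rewrite -[leRHS]ger0_norm// -sqrtr_sqr ler_sqrt ?sqr_ge0//.
  by rewrite ler_pdivrMl// gM'.
move=> H; rewrite -EFinM -[in leLHS](sqr_sqrtr q0) expe2 expr2 EFinM.
by apply: lee_pmul => //; rewrite lee_fin sqrtr_ge0.
Qed.

Lemma comp_norm_le_gauge :
  (comp_norm alpha psi ^+ 2 <= comp_const%:E * gauge beta phi)%E.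
Proof.
have [goo|gN] := eqVneq (gauge beta phi) +oo%E.
  by rewrite goo gt0_muley ?leey// lte_fin.
have gfin : gauge beta phi \is a fin_num.
  by rewrite ge0_fin_numE ?gauge_ge0// ltey.
set g := fine (gauge beta phi); have g00 : 0 <= g by rewrite fine_ge0// gauge_ge0.
have gE : gauge beta phi = g%:E by rewrite fineK.
rewrite gE; apply/lee_addgt0Pr => e e0.
(* A test family with objective at most [X] exists only if the local gauge is strictly below [X];
   the slack contributes exactly [e] to the final bound. *)
pose X := g + e / comp_const.
have gX : g < X by rewrite ltrDl divr_gt0.
have X0 : 0 <= X by lra.
have cX0 : 0 <= @sufficiency_const R n alpha up * X by rewrite mulr_ge0.
set M := Num.sqrt (@sufficiency_const R n alpha up * X).
have cM : (comp_norm alpha psi <= M%:E)%E.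
  apply: ereal_inf_lbound; exists M => //; split; first exact: sqrtr_ge0.
  move=> f [[mf _] fN]; have N0 := Qnorm_ge0 alpha f.
  have ffin : Qnorm alpha f \is a fin_num by rewrite ge0_fin_numE.
  have fE : Qnorm alpha f = (fine (Qnorm alpha f))%:E by rewrite fineK.
  rewrite fE -EFinM.
  apply: (sufficiency_bound n_gt0 alpha_gt0 alpha_lt updn pK Kp cphi cpsi lusin mf) => //.
  - by rewrite fine_ge0.
  - by rewrite -fE.
  - move=> Q; apply: le_lt_trans (_ : g%:E < X%:E)%E; last by rewrite lte_fin.
    by rewrite -gE; apply: ereal_sup_ubound; exists Q.
have c0 := comp_norm_ge0 alpha psi.
apply: (@le_trans _ _ (M ^+ 2)%:E).
  by rewrite expe2 expr2 EFinM; apply: lee_pmul.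
rewrite /M sqr_sqrtr// -EFinM -EFinD lee_fin.
apply: (@le_trans _ _ (comp_const * X)).
  by rewrite ler_wpM2r.
by rewrite /X mulrDr mulrCA divff ?mulr1// gt_eqF.
Qed.

End two_sided_bound.

Theorem theorem1p9 (R : realType) (n : nat) (alpha : R) (eta : R -> R)
    (n_gt0 : (0 < n)%N) (alpha_gt0 : 0 < alpha)
    (alpha_lt : alpha < Num.min 1 (n%:R / 2)) :
  (forall phi psi : 'rV[R]_n -> 'rV[R]_n,
     homeomorphism phi psi ->
     quasisymmetric eta phi ->
     (n = 1%N -> Ainfty_jacobian phi /\ Ainfty_jacobian psi) ->
     (comp_bounded alpha psi <->
      (gauge (1 - 2 * alpha / n%:R) phi < +oo)%E))
  /\
  (forall a b : \bar R, exists C : R, 1 <= C /\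
     forall phi psi : 'rV[R]_n -> 'rV[R]_n,
     homeomorphism phi psi ->
     quasisymmetric eta phi ->
     (n = 1%N -> Ainfty_jacobian phi /\ Ainfty_jacobian psi) ->
     Ainfty_const (Jac phi) = a ->
     Ainfty_const (Jac psi) = b ->
     (C^-1%:E * gauge (1 - 2 * alpha / n%:R) phi <= comp_norm alpha psi ^+ 2)%E
     /\
     (comp_norm alpha psi ^+ 2 <= C%:E * gauge (1 - 2 * alpha / n%:R) phi)%E).
Proof.
have [a1 a2] : alpha < 1 /\ alpha < n%:R / 2 by move: alpha_lt; rewrite lt_min => /andP.
have [C [C1 HC]] : exists C : R, 1 <= C /\
    forall phi psi : 'rV[R]_n -> 'rV[R]_n, homeomorphism phi psi -> quasisymmetric eta phi ->
    (n = 1%N -> Ainfty_jacobian phi /\ Ainfty_jacobian psi) ->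
    (C^-1%:E * gauge (1 - 2 * alpha / n%:R) phi <= comp_norm alpha psi ^+ 2)%E /\
    (comp_norm alpha psi ^+ 2 <= C%:E * gauge (1 - 2 * alpha / n%:R) phi)%E.
  (* [quasisymmetric eta] contains [increasing_homeo eta], so for any other [eta] the claim is
     vacuous. *)
  have [eta_homeo|neta] := pselect (increasing_homeo eta); last first.
    by exists 1; split => // phi psi _ [].
  have [up1 [dn1 [updn1 ctrl]]] := quasisymmetric_control n_gt0 eta_homeo.
  have [up [dn [updn ctrl']]] := @ratio_control_inverse R n up1 dn1 updn1.
  exists (@comp_const R n alpha up dn); split; first exact: comp_const_ge1.
  move=> phi psi [pK Kp cphi cpsi] qs jac.
  have cp := ctrl phi psi pK qs.
  have cp' := ctrl' phi psi pK Kp cp.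
  have lusin (A : set 'rV[R]_n) : @lebesgue_rV R n A = 0%E -> @lebesgue_rV R n (psi @^-1` A) = 0%E.
    move=> A0; have [n1|n1] := leqP n 1%N.
      have nE : n = 1%N by apply/eqP; rewrite eqn_leq n1 n_gt0.
      have [jphi _] := jac nE.
      exact: (lusin_of_jacobian pK Kp jphi A0).
    (* Applied with [phi] and [psi] exchanged, since the preimage under [psi] has to be null. *)
    exact: (lusin_of_quasisymmetric n_gt0 updn1 Kp pK cpsi cphi cp n1 A0).
  split.
    exact: (gauge_le_comp_norm n_gt0 alpha_gt0 a1 a2 updn pK Kp cphi cpsi cp').
  exact: (comp_norm_le_gauge n_gt0 alpha_gt0 a2 updn pK Kp cphi cp' lusin).
have Ci0 : 0 < C^-1 by rewrite invr_gt0 (lt_le_trans ltr01).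
split; last by move=> a b; exists C; split => // phi psi hm qs jac _ _; exact: HC.
move=> phi psi hm qs jac; have [lo hi] := HC phi psi hm qs jac.
split.
- rewrite /comp_bounded => coo; have c0 := comp_norm_ge0 alpha psi.
  rewrite ltey; apply/eqP => goo; move: lo; rewrite goo gt0_muley ?lte_fin// leye_eq.
  have -> : comp_norm alpha psi = (fine (comp_norm alpha psi))%:E by rewrite fineK// ge0_fin_numE.
  by rewrite expe2 -EFinM.
- move=> goo; rewrite /comp_bounded ltey; apply/eqP => coo; move: hi.
  have g0 := gauge_ge0 (1 - 2 * alpha / n%:R) phi.
  have -> : gauge (1 - 2 * alpha / n%:R) phi = (fine (gauge (1 - 2 * alpha / n%:R) phi))%:E.
    by rewrite fineK// ge0_fin_numE.
  by rewrite coo expe2 mulyy -EFinM leye_eq.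
Qed.
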